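(* Let $k \ge 4$ and $\zeta$ be integers with $0 \le \zeta \le k-2$. Then every $k$-$\gamma_c$-critical graph with exactly $\zeta$ cut-vertices has a hamiltonian path if and only if $k-3 \le \zeta \le k-2$.
   Context: All graphs are finite and simple. For a connected graph $G$, a connected dominating set (CD-set) is a set $S \subseteq V(G)$ such that every vertex outside $S$ has a neighbor in $S$ and the induced subgraph $G[S]$ is connected; the connected domination number $\gamma_c(G)$ is the minimum cardinality of a CD-set of $G$. A connected graph $G$ is $k$-$\gamma_c$-critical if $\gamma_c(G)=k$ and $\gamma_c(G+uv)<k$ for every pair of non-adjacent vertices $u,v$ of $G$. A cut-vertex is a vertex whose removal increases the number of components. A hamiltonian path is a path through all vertices of the graph. *)

(* Defs.v *)
From mathcomp Require Import all_boot.

Set Implicit Arguments.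
Unset Strict Implicit.
Unset Printing Implicit Defensive.

(* A finite simple graph is a symmetric irreflexive adjacency relation [e] on
   its finite type [T] of vertices. *)
Definition simple_graph (T : finType) (e : rel T) : Prop :=
  symmetric e /\ irreflexive e.

Definition induced (T : finType) (e : rel T) (S : {set T}) : rel T :=
  [rel x y | [&& x \in S, y \in S & e x y]].

(* Since [connect] is reflexive also outside [S], both ends must range over
   [S]. *)
Definition connected_in (T : finType) (e : rel T) (S : {set T}) : bool :=
  [forall x in S, forall y in S, connect (induced e S) x y].

Definition connected_graph (T : finType) (e : rel T) : bool :=
  connected_in e [set: T].

Definition dominating (T : finType) (e : rel T) (S : {set T}) : bool :=
  [forall x in ~: S, exists y in S, e x y].

Definition cd_set (T : finType) (e : rel T) (S : {set T}) : bool :=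
  dominating e S && connected_in e S.

(* [[set: T]] is a CD-set exactly when the graph is connected, so this is the
   minimum size of a CD-set of a connected graph; the value is meaningless for
   a disconnected graph. *)
Definition gamma_c (T : finType) (e : rel T) : nat :=
  #|[arg min_(S < [set: T] | cd_set e S) #|S| ]|.

Definition add_edge (T : finType) (e : rel T) (u v : T) : rel T :=
  [rel x y | [|| e x y, (x == u) && (y == v) | (x == v) && (y == u)]].

Definition gamma_c_critical (k : nat) (T : finType) (e : rel T) : Prop :=
  [/\ connected_graph e,
      gamma_c e = k &
      forall u v : T, u != v -> ~~ e u v -> gamma_c (add_edge e u v) < k].

Definition components_in (T : finType) (e : rel T) (S : {set T}) : nat :=
  n_comp (induced e S) S.

Definition cut_vertex (T : finType) (e : rel T) (v : T) : bool :=
  components_in e [set: T] < components_in e [set~ v].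

Definition cut_vertices (T : finType) (e : rel T) : {set T} :=
  [set v | cut_vertex e v].

Definition has_hamiltonian_path (T : finType) (e : rel T) : Prop :=
  exists (x : T) (p : seq T),
    [/\ path e x p, uniq (x :: p) & forall y : T, y \in x :: p].

(* Main.v *)
Require Import Defs.
From mathcomp Require Import all_boot.
From mathcomp Require Import zify.

(* For [k - 3 <= zeta]: two simplicial vertices of a critical graph are adjacent,
   because a minimum CD-set of [G + uv] could otherwise be rerouted inside [G].
   Call excess of a branch at a cut vertex without further cut vertices the
   number of vertices that a CD-set needs there.  Branches of excess at most 1
   are cliques with a simplicial vertex, so there is at most one of them, and as
   the total excess is at most 3 there is exactly one other branch.  The cut
   vertices are therefore linearly ordered, the blocks between consecutive ones
   are complete up to one edge, and only the branch of excess 2 or 3 has to be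
   traversed by a path starting at its root [c].  For excess 3 let [N] be the
   clique of neighbours of [c] and [R] the rest: nonadjacent [x], [y] in [R] have,
   up to order, a [w] in [N] adjacent to [x], not to [y], such that [w] and [x]
   dominate [R] except [y] (a Sumner-Blitch type tournament).  Linking the paths
   of a minimum path cover of [R] by such vertices [w] yields the path.

   For [zeta <= k - 4]: a fixed 15-vertex core, in which deleting seven vertices
   leaves eight isolated ones, is extended by a tail of cliques of size 1 or 2;
   each tail level raises [k] by one, and each level of size 1 is a cut vertex. *)

Set Implicit Arguments.
Unset Strict Implicit.
Unset Printing Implicit Defensive.

(** * Connectivity and connected dominating sets *)

(** The excess is bounded because every CD-set contains every cut vertex: [k] is at least the number
    of cut vertices plus the excesses of disjoint branches, while [k] is at most [zeta + 3].
    Criticality only yields a global CD-set of [G + xy]. It becomes local by restricting that set to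
    a branch, and a CD-set of the branch in [G] can be glued back. The linking argument has two
    obstacles. Linking vertices must be distinct; this is automatic, since in a minimum cover the
    witness of an arc from [x] to [y] sees all ends of the paths not containing [x], except [y], so
    witnesses with different targets differ. Each contradiction is therefore a leftover vertex of
    [N] adjacent to such an end, or a cover with fewer paths. In the counterexample the eight
    isolated vertices and the tail make nine components, and a path using seven deleted vertices
    meets at most eight. *)

Section Connectivity.
Variables (T : finType).
Implicit Types (e f : rel T) (S A B D : {set T}) (x y z : T).

Lemma inducedE e S x y : induced e S x y = [&& x \in S, y \in S & e x y].
Proof. by []. Qed.

Lemma induced_sym e S : symmetric e -> symmetric (induced e S).
Proof. by move=> es x y; rewrite !inducedE es andbCA. Qed.

Lemma induced_connect_sym e S : symmetric e -> connect_sym (induced e S).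
Proof. by move=> es; apply/sym_connect_sym/induced_sym. Qed.

Lemma connected_inP e S :
  reflect {in S &, forall x y, connect (induced e S) x y} (connected_in e S).
Proof.
apply: (iffP forall_inP) => [h x y xS yS|h x xS].
  by have /forall_inP := h x xS; apply.
by apply/forall_inP => y yS; apply: h.
Qed.

Lemma connected_in_root e S x :
    symmetric e -> {in S, forall y, connect (induced e S) x y} ->
  connected_in e S.
Proof.
move=> es h; apply/connected_inP => y z yS zS; apply: connect_trans (h z zS).
by rewrite (induced_connect_sym S es); apply: h.
Qed.

Lemma connected_in_cross e S A x y :
    connected_in e S -> x \in S -> x \in A -> y \in S -> y \notin A ->
  exists u v, [/\ u \in S, u \in A, v \in S, v \notin A & e u v].
Proof.
move=> /connected_inP h xS xA yS yA.
have /connectP[p] := h x y xS yS.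
elim: p x xS xA {h} => [|z p IH] x xS xA /=; first by move=> _ eyx; rewrite eyx xA in yA.
case/andP=> /and3P[_ zS exz] pzp lst.
case zA: (z \in A); first exact: (IH z).
by exists x, z; split; rewrite ?zA.
Qed.

Lemma connected_in_cut e S :
    (forall A x y, x \in S -> x \in A -> y \in S -> y \notin A ->
       exists u v, [/\ u \in S, u \in A, v \in S, v \notin A & e u v]) ->
  connected_in e S.
Proof.
move=> h; apply/connected_inP => x y xS yS; apply/negPn/negP => nc.
have [||||u [v [uS uA vS vA euv]]] := h [set z | connect (induced e S) x z] x y;
  rewrite ?inE //.
move: vA; rewrite inE => /negP; apply; move: uA; rewrite inE => /connect_trans; apply.
by apply: connect1; rewrite inducedE uS vS.
Qed.

Lemma connected_in_sub e f S :
  (forall x y, x \in S -> y \in S -> e x y -> f x y) ->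
  connected_in e S -> connected_in f S.
Proof.
move=> ef /connected_inP h; apply/connected_inP => x y xS yS.
apply: connect_sub (h x y xS yS) => u v /and3P[uS vS euv].
by apply: connect1; rewrite inducedE uS vS ef.
Qed.

Lemma connected_in1 e x : connected_in e [set x].
Proof. by apply/connected_inP => y z /set1P-> /set1P->. Qed.

Lemma connectedU1 e D z w :
    symmetric e -> connected_in e D -> w \in D -> e w z -> connected_in e (z |: D).
Proof.
move=> es /connected_inP h wD ewz; apply: (@connected_in_root _ _ w) => // y.
case/setU1P => [->|yD]; first by apply: connect1; rewrite inducedE !inE eqxx wD ewz orbT.
apply: connect_sub (h w y wD yD) => u v /and3P[uS vS euv].
by apply: connect1; rewrite inducedE !inE uS vS euv !orbT.
Qed.

Lemma connectedU e A B x :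
    symmetric e -> connected_in e A -> connected_in e B -> x \in A -> x \in B ->
  connected_in e (A :|: B).
Proof.
move=> es /connected_inP hA /connected_inP hB xA xB.
apply: (@connected_in_root _ _ x) => // y /setUP[yA|yB].
  apply: connect_sub (hA x y xA yA) => u v /and3P[uS vS euv].
  by apply: connect1; rewrite inducedE !inE uS vS euv.
apply: connect_sub (hB x y xB yB) => u v /and3P[uS vS euv].
by apply: connect1; rewrite inducedE !inE uS vS euv !orbT.
Qed.

Lemma dominatingP e D :
  reflect (forall x, x \notin D -> exists2 y, y \in D & e x y) (dominating e D).
Proof.
apply: (iffP forall_inP) => h x xD; apply/exists_inP; apply: h.
  by rewrite inE.
by rewrite inE in xD.
Qed.

Lemma cd_setP e D :
  reflect ((forall x, x \notin D -> exists2 y, y \in D & e x y) /\ connected_in e D)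
    (cd_set e D).
Proof.
by apply: (iffP andP) => -[/dominatingP h1 h2]; split=> //; apply/dominatingP.
Qed.

Lemma cd_setT e : connected_graph e -> cd_set e [set: T].
Proof. by move=> ce; apply/cd_setP; split=> // x; rewrite inE. Qed.

Lemma gamma_c_le e D : connected_graph e -> cd_set e D -> gamma_c e <= #|D|.
Proof.
move=> /cd_setT cT cD; rewrite /gamma_c; case: arg_minnP => // S _; exact.
Qed.

Lemma gamma_c_min e :
  connected_graph e -> exists2 D, cd_set e D & #|D| = gamma_c e.
Proof.
move=> /cd_setT cT; rewrite /gamma_c; case: arg_minnP => // S cS _.
by exists S.
Qed.

Lemma add_edgeE e u v x y :
  add_edge e u v x y = [|| e x y, (x == u) && (y == v) | (x == v) && (y == u)].
Proof. by []. Qed.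

Lemma add_edge_sym e u v : symmetric e -> symmetric (add_edge e u v).
Proof.
by move=> es x y; rewrite !add_edgeE (es x y); congr (_ || _); rewrite orbC; congr (_ || _); exact: andbC.
Qed.

Lemma connected_add_edge e u v :
  connected_graph e -> connected_graph (add_edge e u v).
Proof. by apply: connected_in_sub => x y _ _; rewrite add_edgeE => ->. Qed.

Lemma components_in1 e S x :
  symmetric e -> x \in S -> connected_in e S -> components_in e S = 1.
Proof.
move=> es xS /connected_inP h; have is_sym := induced_connect_sym S es.
rewrite -(n_comp_connect is_sym x); apply: eq_n_comp_r => y.
apply/idP/idP => [yS|]; first by rewrite inE; apply: h.
rewrite inE => /connectP[p pp ->]; elim: p x xS pp => //= z p IH x _ /andP[].
by case/and3P=> _ zS _; apply: IH.
Qed.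

Lemma components_in_gt1 e S :
  symmetric e -> ~~ connected_in e S -> 1 < components_in e S.
Proof.
move=> es; have is_sym := induced_connect_sym S es.
rewrite negb_forall_in => /exists_inP[x xS]; rewrite negb_forall_in.
case/exists_inP=> y yS nc.
have := n_comp_closure2 is_sym x y; rewrite nc => <-.
apply: subset_leq_card; apply/subsetP => z; rewrite !inE => /andP[-> /=].
case/existsP=> w /andP[/= /connectP[p pp ->]]; rewrite !inE => wxy.
have: last z p \in S by case/orP: wxy => /eqP->.
elim: p z pp {wxy} => //= u p IH z /andP[/and3P[zS _ _] _]; by [].
Qed.

Lemma cut_vertexE e v :
    symmetric e -> connected_graph e -> 1 < #|T| ->
  cut_vertex e v = ~~ connected_in e [set~ v].
Proof.
move=> es ce T2.
have /card_gt0P[y yv]: 0 < #|[set~ v]| by rewrite cardsC1; case: #|T| T2 => [|[]].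
rewrite /cut_vertex (components_in1 es (in_setT v) ce).
apply/idP/idP => [|]; last exact: components_in_gt1.
by apply: contraTN => /(components_in1 es yv)->.
Qed.

Lemma cut_vertexP e v :
    symmetric e -> connected_graph e -> 1 < #|T| ->
  reflect (exists A x y, [/\ x \in A, y \notin A, x != v, y != v &
      forall a b, a \in A -> b \notin A -> a != v -> b != v -> ~~ e a b])
    (cut_vertex e v).
Proof.
move=> es ce T2; rewrite cut_vertexE //; apply: (iffP idP).
  rewrite negb_forall_in => /exists_inP[x xv]; rewrite negb_forall_in.
  case/exists_inP=> y yv nc; rewrite !inE in xv yv.
  exists [set z | connect (induced e [set~ v]) x z], x, y; split; rewrite ?inE //.
  move=> a b; rewrite !inE => ca ncb av bv; apply: contra ncb => eab.
  by apply: connect_trans ca (connect1 _); rewrite inducedE !inE av bv.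
case=> A [x [y [xA yA xv yv nE]]]; apply/negP => c.
have [||a [b [av aA bv bA]]] := connected_in_cross c _ xA _ yA; rewrite ?inE //.
by rewrite !inE in av bv; apply/negP; apply: nE.
Qed.

(** Every vertex other than [v] lies in [D] or next to it, and [D] is connected without [v]. The
    contrapositive puts every cut vertex into every CD-set. *)
Lemma cd_set_connected_del e D v :
  symmetric e -> cd_set e D -> v \notin D -> connected_in e [set~ v].
Proof.
move=> es /cd_setP[dom con] vD.
have anchor x : exists2 y, y \in D & connect (induced e [set~ v]) x y \/ x = v.
  have [->|xv] := eqVneq x v.
    by have [y yD _] := dom v vD; exists y => //; right.
  have [xD|/dom[y yD xy]] := boolP (x \in D); first by exists x => //; left.
  exists y => //; left; apply: connect1; rewrite inducedE !inE xv xy andbT /=.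
  by apply: contraNneq vD => <-.
have conv : {in D &, forall x y, connect (induced e [set~ v]) x y}.
  move=> x y xD yD; have /connected_inP/(_ x y xD yD) := con.
  apply: connect_sub => a b /and3P[aD bD ab]; apply: connect1.
  by rewrite inducedE !inE ab andbT; apply/andP; split; apply: contraNneq vD => <-.
apply/connected_inP => x y; rewrite !inE => /eqP xv /eqP yv.
have [x' x'D [xx'|//]] := anchor x; have [y' y'D [yy'|//]] := anchor y.
apply: connect_trans xx' (connect_trans (conv _ _ x'D y'D) _).
by rewrite (induced_connect_sym _ es).
Qed.

(** A walk through [v] can be shortened, as its neighbours before and after [v] are equal or
    adjacent. *)
Lemma connected_del e D v : symmetric e ->
    {in D &, forall a b, e v a -> e v b -> a != b -> e a b} ->
  connected_in e D -> connected_in e (D :\ v).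
Proof.
move=> es cl cD; apply: connected_in_cut => A x y /setD1P[xv xD] xA /setD1P[yv yD] yA.
(* If [A] contains a neighbour [n] of [v], then [v] is counted with [A] and a crossing edge at [v]
   is replaced by one at [n]. Otherwise [v] goes to the other side and no crossing edge meets it. *)
have [/exists_inP[n nD /and3P[nA nv vn]]|no] :=
  boolP [exists n in D, [&& n \in A, n != v & e v n]].
  have [||a [b [aD + bD + ab]]] := connected_in_cross cD (A := v |: A) xD _ yD.
  - by rewrite inE xA orbT.
  - by rewrite !inE negb_or yv.
  rewrite !inE negb_or => avA /andP[bv bA].
  have [av|av] := eqVneq a v; last first.
    by exists a, b; rewrite (negbTE av) /= in avA; rewrite !inE av bv.
  exists n, b; rewrite !inE nv bv; split=> //.
  by rewrite av in ab; apply: cl => //; apply: contraNneq bA => <-.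
have [||a [b [aD + bD + ab]]] := connected_in_cross cD (A := A :\ v) xD _ yD.
- by rewrite !inE xv.
- by rewrite !inE yv.
rewrite !inE negb_and negbK => /andP[av aA] /orP[/eqP bv|bA].
  case/exists_inP: no; exists a => //; rewrite aA av /=.
  by rewrite es -bv.
have [bv|bv] := eqVneq b v; last by exists a, b; rewrite !inE av bv.
by case/exists_inP: no; exists a => //; rewrite aA av es -bv.
Qed.

Lemma connectedU_edge e A B a b : symmetric e -> connected_in e A -> connected_in e B ->
  a \in A -> b \in B -> e a b -> connected_in e (A :|: B).
Proof.
move=> es cA cB aA bB ab.
have -> : A :|: B = (b |: A) :|: B.
  by apply/setP => x; rewrite !inE; case: eqP => // ->; rewrite bB !orbT.
apply: (connectedU es _ cB (x := b)) => //; last by rewrite setU11.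
exact: connectedU1 ab.
Qed.

Definition component e S x : {set T} := [set y in S | connect (induced e S) x y].

Lemma component_refl e S x : x \in S -> x \in component e S x.
Proof. by rewrite inE => ->; rewrite connect0. Qed.

Lemma component_in e S x y : y \in component e S x -> y \in S.
Proof. by rewrite inE => /andP[]. Qed.

Lemma component_closed e S x a b :
  a \in component e S x -> b \in S -> e a b -> b \in component e S x.
Proof.
rewrite !inE => /andP[aS xa] bS ab; rewrite bS /=; apply: connect_trans xa _.
by apply: connect1; rewrite inducedE aS bS.
Qed.

Lemma component_eq e S x y : symmetric e -> y \in component e S x ->
  component e S y = component e S x.
Proof.
move=> es; rewrite inE => /andP[yS xy]; apply/setP => w; rewrite !inE.
by rewrite (same_connect (induced_connect_sym S es) xy).
Qed.

Lemma component_connected e S x : symmetric e -> connected_in e (component e S x).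
Proof.
move=> es; apply: connected_in_cut => A a b aC aA bC bA.
have bCa : b \in component e S a by rewrite (component_eq es aC).
have aS := component_in aC.
have /connectP[p] : connect (induced e S) a b by move: bCa; rewrite inE => /andP[].
elim: p a aC aA {bCa} aS => [|w p IH] a aC aA aS /=; first by move=> _ ba; rewrite ba aA in bA.
case/andP=> /and3P[_ wS aw] pp bE; have wC := component_closed aC wS aw.
have [wA|wA] := boolP (w \in A); first exact: IH pp bE.
by exists a, w.
Qed.

Lemma component_sub e S A a x : connected_in e A -> A \subset S ->
  a \in A -> a \in component e S x -> A \subset component e S x.
Proof.
move=> cA /subsetP AS aA aC; apply/subsetP => b bA; apply/negPn/negP => bC.
have [u [v [uA uC vA vC uv]]] := connected_in_cross cA aA aC bA bC.
by rewrite (component_closed uC (AS _ vA) uv) in vC.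
Qed.

Lemma add_edgeP e u v x y : add_edge e u v x y ->
  [\/ e x y, x = u /\ y = v | x = v /\ y = u].
Proof.
rewrite add_edgeE => /or3P[|/andP[/eqP-> /eqP->]|/andP[/eqP-> /eqP->]].
- by constructor 1.
- by constructor 2.
- by constructor 3.
Qed.

Lemma add_edgeC e u v x y : add_edge e u v x y = add_edge e v u x y.
Proof. by rewrite !add_edgeE; congr (_ || _); rewrite orbC. Qed.

Lemma cd_set_eq e f D : (forall x y, e x y = f x y) -> cd_set e D -> cd_set f D.
Proof.
move=> ef /cd_setP[dom con]; apply/cd_setP; split=> [x /dom[y yD xy]|].
  by exists y; rewrite -?ef.
by apply: connected_in_sub con => x y _ _; rewrite ef.
Qed.

End Connectivity.

(** * Critical graphs with few cut vertices and no hamiltonian path *)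

(* [has], [all] and [&&] are strict under [vm_compute]; these short-circuit. *)
Fixpoint lazy_has (X : Type) (p : pred X) (s : seq X) : bool :=
  if s is x :: s' then if p x then true else lazy_has p s' else false.

Fixpoint lazy_all (X : Type) (p : pred X) (s : seq X) : bool :=
  if s is x :: s' then if p x then lazy_all p s' else false else true.

Lemma lazy_hasE (X : Type) (p : pred X) s : lazy_has p s = has p s.
Proof. by elim: s => //= x s ->; case: ifP. Qed.

Lemma lazy_allE (X : Type) (p : pred X) s : lazy_all p s = all p s.
Proof. by elim: s => //= x s ->; case: ifP. Qed.

(** * Connected dominating sets as lists, for verification by computation *)

Section ListedSets.
Variable g : rel nat.

(** A connectivity certificate that is cheap to evaluate: the last entry is the root of a spanning
    tree in which the parent of an entry comes later in the list. *)
Fixpoint grown (s : seq nat) : bool :=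
  if s is x :: s' then nilp s' || (has (g x) s' && grown s') else false.

Definition dominates_below (m : nat) (s : seq nat) : bool :=
  lazy_all (fun v => if v \in s then true else has (g v) s) (iota 0 m).

Definition cd_list (m : nat) (s : seq nat) : bool :=
  if grown s then dominates_below m s && all (fun x => x < m) s else false.

End ListedSets.

(* Found by a computer search among edge-maximal graphs of connected domination
   number 4; the tail is attached to the adjacent vertices 0 and 1. *)
Definition core_nbrs : seq (seq nat) :=
  [:: [:: 1; 4; 5; 6; 8; 9; 10; 12]; [:: 0; 4; 5; 6; 7; 11; 12; 13];
      [:: 3; 4; 6; 8; 12; 13; 14]; [:: 2; 7; 8; 9; 10; 11; 12; 13];
      [:: 0; 1; 2; 5; 6; 8; 9; 11; 12; 13; 14];
      [:: 0; 1; 4; 6; 7; 9; 10; 11; 12; 14];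
      [:: 0; 1; 2; 4; 5; 7; 8; 10; 12; 13; 14];
      [:: 1; 3; 5; 6]; [:: 0; 2; 3; 4; 6]; [:: 0; 3; 4; 5];
      [:: 0; 3; 5; 6]; [:: 1; 3; 4; 5]; [:: 0; 1; 2; 3; 4; 5; 6];
      [:: 1; 2; 3; 4; 6]; [:: 2; 4; 5; 6]].

Definition core_adj : rel nat := [rel a b | b \in nth [::] core_nbrs a].

Definition core_ports : pred nat := [pred a | a < 2].

Definition core_add (x y : nat) : rel nat :=
  [rel a b | [|| core_adj a b, (a == x) && (b == y) | (a == y) && (b == x)]].

(** [x] comes last because [grown] takes the last entry as root. Repeated entries are allowed, so
    smaller sets are included. *)
Definition triples (x : nat) : seq (seq nat) :=
  [seq [:: c; b; x] | b <- iota 0 15, c <- iota 0 15].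

Definition quads (x : nat) : seq (seq nat) :=
  [seq a :: s | s <- triples x, a <- iota 0 15].

Arguments triples : simpl never.
Arguments quads : simpl never.
Arguments core_adj : simpl never.

Lemma core_sym_check :
  all (fun a => all (fun b => core_adj a b == core_adj b a) (iota 0 15)) (iota 0 15).
Proof. by vm_compute. Qed.

Lemma core_irr_check : all (fun a => ~~ core_adj a a) (iota 0 15).
Proof. by vm_compute. Qed.

(** This gives the lower bound in the core: a CD-set of the whole graph contains a port, and no
    connected set of at most three core vertices around a port dominates. The equalities in the
    filter cover sets with fewer than three vertices. *)
Lemma core_no_triple_check :
  all (fun x => all (fun s => ~~ dominates_below core_adj 15 s)
    [seq s <- triples x | let: c := nth 0 s 0 in let: b := nth 0 s 1 in
        [|| b == x | core_adj x b] && [|| c == x, c == b, core_adj x c | core_adj b c]])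
  [:: 0; 1].
Proof. by vm_compute. Qed.

(** For a new edge from [y] to a tail level above 1: the core part must contain both [y] and a
    port. *)
Lemma core_quad_check :
  all (fun y => lazy_has (fun s => if y \in s then cd_list core_adj 15 s else false) (quads 0 ++ quads 1))
    (iota 0 15).
Proof. by vm_compute. Qed.

(** This shows that no core vertex is a cut vertex. *)
Lemma core_avoid_check :
  all (fun y => lazy_has (fun s => if y \in s then false else cd_list core_adj 15 s) (quads 0 ++ quads 1))
    (iota 0 15).
Proof. by vm_compute. Qed.

(** For a new edge from a non-port [y] to level 1: the tail then hangs on [y], so the triple needs
    no port. *)
Lemma core_triple_check :
  all (fun y => lazy_has (cd_list core_adj 15) (triples y)) (iota 2 13).
Proof. by vm_compute. Qed.

(** For a new edge inside the core the tail still hangs on a port, hence triples rooted at 0 or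
    1. *)
Lemma core_critical_check :
  all (fun x => all (fun y => if (x == y) || core_adj x y then true else
      lazy_has (cd_list (core_add x y) 15) (triples 0 ++ triples 1)) (iota 0 15))
    (iota 0 15).
Proof. by vm_compute. Qed.

Lemma core_independent_check :
  all (fun a => all (fun b => ~~ core_adj a b || (a < 7) || (b < 7)) (iota 0 15)) (iota 0 15).
Proof. by vm_compute. Qed.

Lemma core_sym a b : a < 15 -> b < 15 -> core_adj a b = core_adj b a.
Proof.
move=> a15 b15; have /allP/(_ a) := core_sym_check; rewrite mem_iota => /(_ a15).
by move/allP/(_ b); rewrite mem_iota => /(_ b15)/eqP.
Qed.

(** * The core with its tail *)

Section Counterexample.
Variables (t z : nat).
Hypothesis zt : z <= t.

(** The first tail summand has one vertex on each of the levels [1..t+1], the second doubles the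
    levels [z+1..t]. So the single levels are [1..z], which are the cut vertices, and the end [t+1]
    of the tail. *)
Definition vert : finType := ('I_15 + ('I_t.+1 + 'I_(t - z)))%type.

Definition level (v : vert) : nat :=
  match v with
  | inl _ => 0
  | inr (inl i) => i.+1
  | inr (inr j) => (z + j).+1
  end.

Definition adj : rel vert := fun u v =>
  match u, v with
  | inl a, inl b => core_adj a b
  | inl a, inr _ => core_ports a && (level v == 1)
  | inr _, inl b => core_ports b && (level u == 1)
  | inr _, inr _ => [&& u != v, level u <= (level v).+1 & level v <= (level u).+1]
  end.

Definition cv (a : nat) : vert := inl (inord a : 'I_15).
Definition tv (i : nat) : vert := inr (inl (inord i.-1 : 'I_t.+1)).

Lemma cvK (a : 'I_15) : cv a = inl a.
Proof. by rewrite /cv inord_val. Qed.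

Lemma level_cv a : level (cv a) = 0. Proof. by []. Qed.

Lemma level_tv i : 0 < i <= t.+1 -> level (tv i) = i.
Proof. by case: i => // i it; rewrite /= inordK. Qed.

Lemma level_le v : level v <= t.+1.
Proof. by case: v => [a|[i|j]] //=; have := ltn_ord j; lia. Qed.

Lemma level_gt0 v : 0 < level v -> exists w, v = inr w.
Proof. by case: v => // w _; exists w. Qed.

Lemma level_inr w : 0 < level (inr w).
Proof. by case: w. Qed.

Lemma level0 v : level v = 0 -> exists2 a, a < 15 & v = cv a.
Proof. by case: v => [a|[i|j]] // _; exists (a : nat); rewrite ?cvK. Qed.

Lemma adj_cv a b : a < 15 -> b < 15 -> adj (cv a) (cv b) = core_adj a b.
Proof. by move=> a15 b15; rewrite /= !inordK. Qed.

Lemma adj_port a v : a < 15 -> 0 < level v ->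
  adj (cv a) v = core_ports a && (level v == 1).
Proof. by move=> a15 /level_gt0[w ->]; rewrite /= inordK. Qed.

Lemma adj_tail u v : 0 < level u -> 0 < level v ->
  adj u v = [&& u != v, level u <= (level v).+1 & level v <= (level u).+1].
Proof. by move=> /level_gt0[w ->] /level_gt0[w' ->]. Qed.

Lemma adj_succ u v : 0 < level v -> level u = (level v).+1 -> adj u v.
Proof.
move=> v0 uv; rewrite adj_tail ?uv // leqnn (leq_trans (leqnSn _)) // !andbT.
by apply/eqP => euv; move: uv; rewrite euv; lia.
Qed.

Lemma adj_sym : symmetric adj.
Proof.
move=> [a|u] [b|v] //=; first exact: core_sym.
by rewrite eq_sym; congr (_ && _); rewrite andbC.
Qed.

Lemma adj_irr : irreflexive adj.
Proof.
move=> [a|u] /=; last by rewrite eqxx.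
by have /allP/(_ a) := core_irr_check; rewrite mem_iota ltn_ord => /(_ isT)/negbTE.
Qed.

Lemma level_top v : level v = t.+1 -> v = tv t.+1.
Proof.
case: v => [a|[i|j]] //= [h]; last by have := ltn_ord j; lia.
by congr (inr (inl _)); apply: val_inj; rewrite /= inordK.
Qed.

Lemma level_single v : 0 < level v <= z -> v = tv (level v).
Proof.
case: v => [a|[i|j]] //= h; last lia.
by congr (inr (inl _)); apply: val_inj; rewrite /= inord_val.
Qed.

(** * Connected dominating sets with at most one vertex on each tail level *)

Section TailCDSet.
Variables (f : rel vert) (g : rel nat) (s : seq nat) (j : nat) (rep : nat -> vert).
Hypothesis f_sym : symmetric f.
Hypothesis sub_f : subrel adj f.
Hypothesis sub_gf : forall a b, a < 15 -> b < 15 -> g a b -> f (cv a) (cv b).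
Hypothesis cd_s : cd_list g 15 s.
Hypothesis s_neq0 : ~~ nilp s.
(** At [j = t.+2] no level is omitted and no shortcut is required. At [j = 1] no level is omitted
    either, but the shortcut attaches the tail to [s] in place of a port. The values between save
    one vertex. *)
Hypothesis j_range : 0 < j <= t.+2.
Hypothesis s_port : 1 < j -> has core_ports s.
Hypothesis level_rep : forall i, 0 < i <= t.+1 -> level (rep i) = i.
Hypothesis shortcut : j <= t.+1 -> exists2 p, f (rep j) p &
  (exists2 a, a \in s & p = cv a) \/ [/\ 0 < level p, level p + 2 <= j & p = rep (level p)].

(* The core part [s] together with one vertex of each of the levels 1..t
   except the level [j.-1]: the tail from level [j] on hangs on the shortcut. *)
Definition tail_cd : {set vert} :=
  [set v | match v with
           | inl a => val a \in s
           | inr _ => [&& v == rep (level v), level v <= t & (level v).+1 != j]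
           end].

Lemma s_lt a : a \in s -> a < 15.
Proof.
by move: cd_s; rewrite /cd_list; case: ifP => // _ /andP[_ /allP h]; apply: h.
Qed.

Lemma mem_tail_cd_cv a : a < 15 -> (cv a \in tail_cd) = (a \in s).
Proof. by move=> a15; rewrite inE /= inordK. Qed.

Lemma mem_tail_cd v : 0 < level v ->
  (v \in tail_cd) = [&& v == rep (level v), level v <= t & (level v).+1 != j].
Proof. by move=> /level_gt0[w ->]; rewrite inE. Qed.

Lemma mem_rep i : 0 < i <= t -> i.+1 != j -> rep i \in tail_cd.
Proof.
move=> it ij; rewrite mem_tail_cd level_rep; try lia.
by rewrite eqxx ij; lia.
Qed.

Lemma tail_step u v : u \in tail_cd -> v \in tail_cd -> f u v ->
  forall x, connect (induced f tail_cd) x u -> connect (induced f tail_cd) x v.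
Proof.
by move=> uD vD fuv x xu; apply: connect_trans xu (connect1 _); rewrite inducedE uD vD.
Qed.

Lemma grown_connect : {in s &, forall a b, connect (induced f tail_cd) (cv a) (cv b)}.
Proof.
have cs := induced_connect_sym tail_cd f_sym.
have gs : grown g s by move: cd_s; rewrite /cd_list; case: ifP.
suff: forall s', grown g s' -> {subset s' <= s} ->
    {in s' &, forall a b, connect (induced f tail_cd) (cv a) (cv b)} by apply.
elim=> [|x s' IH] //= {}gs sD.
have xs : x \in s by apply: sD; rewrite mem_head.
have s's a : a \in s' -> a \in s by move=> h; apply: sD; rewrite inE h orbT.
case/orP: gs => [/nilP s'0|/andP[/hasP[y ys' gxy] gs]].
  by move=> a b; rewrite s'0 !inE => /eqP-> /eqP->.
have IH' := IH gs s's.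
have toy a : a \in x :: s' -> connect (induced f tail_cd) (cv a) (cv y).
  rewrite inE => /orP[/eqP->|as']; last exact: IH'.
  apply: connect1; rewrite inducedE !mem_tail_cd_cv ?s_lt ?xs ?(s's y) //=.
  by apply: sub_gf; rewrite ?s_lt ?(s's y).
by move=> a b ax bx; apply: connect_trans (toy a ax) _; rewrite cs; apply: toy.
Qed.

Lemma tail_cd_cd_set : cd_set f tail_cd.
Proof.
apply/cd_setP; split=> [v vD|].
  case lv: (level v) => [|i].
    have [a a15 va] := level0 lv; move: vD; rewrite va mem_tail_cd_cv // => as'.
    move: cd_s; rewrite /cd_list /dominates_below; case: ifP => // _ /andP[].
    rewrite lazy_allE => /allP/(_ a); rewrite mem_iota (negbTE as') => /(_ a15).
    move=> /hasP[b bs gab] _; exists (cv b); first by rewrite mem_tail_cd_cv ?s_lt.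
    by apply: sub_gf => //; apply: s_lt.
  have lei := level_le v; rewrite lv in lei.
  (* The omitted level is dominated from below, by a port or by the vertex chosen on the level
     before it. *)
  have [ij|ij] := eqVneq i.+2 j.
    case: i => [|i] in lv lei ij *.
      have /hasP[n ns pn] := s_port (ltac:(lia)).
      exists (cv n); first by rewrite mem_tail_cd_cv ?s_lt.
      by rewrite f_sym; apply: sub_f; rewrite adj_port ?s_lt ?lv // pn.
    exists (rep i.+1); first by apply: mem_rep; lia.
    by apply: sub_f; apply: adj_succ; rewrite ?lv level_rep; lia.
  have [it|it] := ltnP i t.
    exists (rep i.+1); first by apply: mem_rep; lia.
    apply: sub_f; rewrite adj_tail ?lv ?level_rep ?leqnSn ?andbT; try lia.
    by apply: contraNneq vD => ->; apply: mem_rep; lia.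
  have ei : i = t by lia.
  (* The top level is dominated by the vertex chosen on level [t]. If that is the omitted level, the
     far end of the shortcut takes over. *)
  have [jt|jt] := eqVneq j t.+1.
    have [p fp hp] := shortcut (ltac:(lia)).
    have -> : v = rep j.
      have lr : level (rep j) = t.+1 by rewrite level_rep; lia.
      have vt : level v = t.+1 by lia.
      by rewrite (level_top vt) (level_top lr).
    exists p => //; case: hp => [[a as' ->]|[h1 h2 ->]].
      by rewrite mem_tail_cd_cv ?s_lt.
    by apply: mem_rep; lia.
  exists (rep t); first by apply: mem_rep; lia.
  by apply: sub_f; apply: adj_succ; rewrite ?lv level_rep; lia.
have [r rs] : exists r, r \in s by case: s s_neq0 => // r s' _; exists r; apply: mem_head.
apply: (@connected_in_root _ _ _ (cv r)) => // v vD.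
(* Each chosen tail vertex has a chosen neighbour on a lower level: the previous one, or the end of
   the shortcut when the previous level is omitted. *)
have [i] := ubnP (level v); elim: i v vD => // i IH v vD lvi.
case lv: (level v) => [|k].
  have [a a15 va] := level0 lv; move: vD; rewrite va mem_tail_cd_cv // => as'.
  exact: grown_connect.
have := vD; rewrite mem_tail_cd ?lv // => /and3P[/eqP vr kt kj].
have [jk|jk] := eqVneq j k.+1.
  have [p fp hp] := shortcut (ltac:(lia)).
  have [pD lp] : p \in tail_cd /\ level p < i.
    case: hp => [[a as' ->]|[h1 h2 h3]]; split.
    - by rewrite mem_tail_cd_cv ?s_lt.
    - by rewrite level_cv; lia.
    - by rewrite h3; apply: mem_rep; lia.
    - by lia.
  apply: tail_step (IH p pD lp) => //.
  by rewrite vr -jk f_sym.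
case: k => [|k] in lv lvi vr kt kj jk *.
  have /hasP[n ns pn] := s_port (ltac:(lia)).
  have nD : cv n \in tail_cd by rewrite mem_tail_cd_cv ?s_lt.
  apply: tail_step (IH _ nD _) => //; last by rewrite level_cv; lia.
  by apply: sub_f; rewrite adj_port ?s_lt ?lv // pn.
have uD : rep k.+1 \in tail_cd by apply: mem_rep; lia.
apply: tail_step (IH _ uD _) => //; last by rewrite level_rep; lia.
by rewrite f_sym; apply: sub_f; apply: adj_succ; rewrite ?lv level_rep; lia.
Qed.

End TailCDSet.

Lemma card_tail_cd g s j rep :
    cd_list g 15 s -> 0 < j <= t.+2 ->
  #|tail_cd s j rep| <= size s + (t - (1 < j <= t.+1)).
Proof.
move=> cd_s j_range.
pose I := [seq i <- iota 1 t | i != j.-1].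
have -> : t - (1 < j <= t.+1) = size I.
  rewrite size_filter; have := count_predC (pred1 j.-1) (iota 1 t).
  rewrite size_iota count_uniq_mem ?iota_uniq // mem_iota.
  by rewrite /predC /=; set c := count _ _; case: (j) j_range => [|j'] /=; lia.
rewrite -(size_map cv) -(size_map rep I) -size_cat.
apply: leq_trans (card_size _); apply: subset_leq_card; apply/subsetP => v vD.
rewrite mem_cat; case lv: (level v) => [|k].
  have [a a15 va] := level0 lv; move: vD; rewrite va mem_tail_cd_cv // => as'.
  by apply/orP; left; apply: map_f.
move: vD; rewrite mem_tail_cd ?lv // => /and3P[/eqP-> kt kj].
apply/orP; right; apply: map_f; rewrite mem_filter mem_iota.
by case: (j) kj j_range => [|j'] /=; lia.
Qed.

Lemma quadP y : y < 15 -> exists s, [/\ y \in s, cd_list core_adj 15 s,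
  has core_ports s & size s = 4].
Proof.
move=> y15; have /allP/(_ y) := core_quad_check; rewrite mem_iota => /(_ y15).
rewrite lazy_hasE => /hasP[s sq]; case: ifP => // ys cs; exists s; split=> //.
  by move: sq; rewrite mem_cat => /orP[] /allpairsP[[s' a] [/= /allpairsP[[b c] [_ _ ->]] _ ->]];
     rewrite /= !orbT.
by move: sq; rewrite mem_cat => /orP[] /allpairsP[[s' a] [/= /allpairsP[[b c] [_ _ ->]] _ ->]].
Qed.

Lemma quad_avoidP y : exists s, [/\ y \notin s, cd_list core_adj 15 s,
  has core_ports s & size s = 4].
Proof.
have [y15|y15] := ltnP y 15; last first.
  have [s [_ cs ps ss]] := quadP (isT : 0 < 15); exists s; split=> //.
  move: cs; rewrite /cd_list; case: ifP => // _ /andP[_ /allP h].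
  by apply/negP => /h; lia.
have /allP/(_ y) := core_avoid_check; rewrite mem_iota => /(_ y15).
rewrite lazy_hasE => /hasP[s sq]; case: ifP => // ys cs; exists s; split=> //.
  by rewrite ys.
  by move: sq; rewrite mem_cat => /orP[] /allpairsP[[s' a] [/= /allpairsP[[b c] [_ _ ->]] _ ->]];
     rewrite /= !orbT.
by move: sq; rewrite mem_cat => /orP[] /allpairsP[[s' a] [/= /allpairsP[[b c] [_ _ ->]] _ ->]].
Qed.

Lemma tripleP y : 1 < y < 15 -> exists s, [/\ y \in s, cd_list core_adj 15 s & size s = 3].
Proof.
move=> y15; have /allP/(_ y) := core_triple_check; rewrite mem_iota => /(_ y15).
rewrite lazy_hasE => /hasP[s /allpairsP[[b c] [_ _ ->]]] cs.
by exists [:: c; b; y]; split=> //=; rewrite !inE eqxx !orbT.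
Qed.

Lemma triple_addP x y : x < 15 -> y < 15 -> x != y -> ~~ core_adj x y ->
  exists s, [/\ cd_list (core_add x y) 15 s, has core_ports s & size s = 3].
Proof.
move=> x15 y15 /negbTE xy /negbTE nxy; have /allP/(_ x) := core_critical_check.
rewrite mem_iota => /(_ x15)/allP/(_ y); rewrite mem_iota => /(_ y15).
rewrite xy nxy orbF lazy_hasE => /hasP[s sq cs]; exists s; split=> //.
  by move: sq; rewrite mem_cat => /orP[] /allpairsP[[b c] [_ _ ->]]; rewrite /= !orbT.
by move: sq; rewrite mem_cat => /orP[] /allpairsP[[b c] [_ _ ->]].
Qed.

(** On a doubled level the twin of [v] can be chosen instead. This yields both the upper bound on
    the connected domination number and the absence of further cut vertices. *)
Lemma adj_avoiding v : z < level v \/ level v = 0 -> v != tv t.+1 ->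
  exists D, [/\ cd_set adj D, v \notin D & #|D| <= t + 4].
Proof.
move=> lv vt; have [a sa] : exists a, level v = 0 -> v = cv a /\ a < 15.
  case: (posnP (level v)) => [/level0[a a15 ->]|h]; first by exists a.
  by exists 0 => h0; rewrite h0 in h.
have [s [as' cs ps ss]] := quad_avoidP a.
have [rep [hrep nrep]] : exists rep, (forall i, 0 < i <= t.+1 -> level (rep i) = i) /\
   (forall i, 0 < i <= t -> rep i != v).
  have [[w vw]|nw] : (exists i, v = inr (inl i)) \/ (forall i, v != inr (inl i)).
  - by case: (v) => [b|[i|i]]; [right|left; exists i|right].
  - have wt : w < t.
      rewrite ltn_neqAle -ltnS ltn_ord andbT; apply: contraNneq vt => wt.
      by rewrite vw; apply/eqP; apply: level_top; rewrite /= wt.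
    have zw : z <= w by move: lv; rewrite vw /=; case.
    have wz : w - z < t - z by lia.
    exists (fun i => if i == w.+1 then inr (inr (Ordinal wz)) else tv i); split=> i hi.
      by case: eqP => [->|_] /=; [lia|apply: level_tv].
    case: (i =P w.+1) => [_|iw]; first by rewrite vw.
    apply: contra_not_neq iw => iv; rewrite -(@level_tv i); last lia.
    by rewrite iv vw.
  exists tv; split=> i hi; first exact: level_tv.
  by rewrite eq_sym; apply: nw.
exists (tail_cd s t.+2 rep); split.
- apply: (@tail_cd_cd_set _ core_adj) => //;
    first [exact: adj_sym | by move=> *; rewrite adj_cv | by case: (s) ss
          | by move=> i; apply: level_tv | by lia].
- have [v0|v0] := posnP (level v).
    have [-> a15] := sa v0; by rewrite mem_tail_cd_cv.
  rewrite mem_tail_cd //; apply/negP => /and3P[/eqP vr vlt _].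
  by have := nrep (level v); rewrite -vr eqxx v0 vlt => /(_ isT).
- have jr : 0 < t.+2 <= t.+2 by lia.
  by apply: leq_trans (card_tail_cd rep cs jr) _; rewrite ss addnC leq_add2r leq_subr.
Qed.

(** [tail_cd_cd_set] does not presuppose connectivity, so a CD-set can serve to prove it. *)
Lemma connected_adj : connected_graph adj.
Proof.
have [s [_ cs ps ss]] := quadP (isT : 0 < 15).
have /cd_setP[dom con] : cd_set adj (tail_cd s t.+2 tv).
  apply: (@tail_cd_cd_set _ core_adj) => //;
    first [exact: adj_sym | by move=> *; rewrite adj_cv | by case: (s) ss
          | by move=> i; apply: level_tv | by lia].
apply: connected_in_cut => A x y _ xA _ yA.
have [/existsP[u /andP[uA /existsP[v /andP[vA uv]]]]|n] :=
  boolP [exists u in A, [exists v in ~: A, adj u v]].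
  by exists u, v; rewrite !inE in vA *.
have nA u v : u \in A -> v \notin A -> adj u v = false.
  move=> uA vA; apply: contraNF n => uv; apply/exists_inP; exists u => //.
  by apply/exists_inP; exists v; rewrite ?inE.
have side u : exists2 w, w \in tail_cd s t.+2 tv & (w \in A) = (u \in A).
  have [uD|/dom[w wD uw]] := boolP (u \in tail_cd s t.+2 tv); first by exists u.
  exists w => //; have [uA|uA] := boolP (u \in A).
    by apply: contraTT uw => wA; rewrite nA.
  by apply: contraTF uw => wA; rewrite adj_sym nA.
have [x' x'D x'A] := side x; have [y' y'D y'A] := side y.
rewrite xA in x'A; rewrite (negbTE yA) in y'A.
have [|u [v [_ uA _ vA uv]]] := connected_in_cross con x'D x'A y'D; first by rewrite y'A.
by exists u, v.
Qed.

(** The new edge saves one vertex, either in the core, where a triple replaces a quadruple, or on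
    the level below [v], which the edge bypasses. The relation [f] is abstract so that the two ends
    can be ordered by level. *)
Lemma gamma_c_add (f : rel vert) u v :
    symmetric f -> subrel adj f -> f u v -> u != v -> ~~ adj u v ->
    level u <= level v -> gamma_c f < t + 4.
Proof.
move=> fs sub fuv nuv nadj luv.
have cf : connected_graph f by apply: connected_in_sub connected_adj => x y _ _; apply: sub.
have core_sub a b : a < 15 -> b < 15 -> core_adj a b -> f (cv a) (cv b).
  by move=> a15 b15 ab; apply: sub; rewrite adj_cv.
suff [g [s [j [rep [sub_g [cs s0 jr] [sp lr sc] le]]]]] :
   exists (g : rel nat) (s : seq nat) (j : nat) (rep : nat -> vert),
   [/\ forall a b, a < 15 -> b < 15 -> g a b -> f (cv a) (cv b),
       [/\ cd_list g 15 s, ~~ nilp s & 0 < j <= t.+2],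
       [/\ 1 < j -> has core_ports s, forall i, 0 < i <= t.+1 -> level (rep i) = i &
           j <= t.+1 -> exists2 p, f (rep j) p &
             (exists2 a, a \in s & p = cv a) \/
             [/\ 0 < level p, level p + 2 <= j & p = rep (level p)]] &
       size s + (t - (1 < j <= t.+1)) < t + 4].
  apply: leq_ltn_trans le.
  apply: leq_trans (card_tail_cd rep cs jr); apply: gamma_c_le => //.
  exact: (tail_cd_cd_set fs sub sub_g).
have [v0|v0] := posnP (level v).
  have [a a15 ua] := @level0 u (ltac:(lia)); have [b b15 vb] := level0 v0.
  rewrite {}ua {}vb in fuv nuv nadj *; rewrite adj_cv // in nadj.
  have ab : a != b by apply: contraNneq nuv => ->.
  have [s [cs ps ss]] := triple_addP a15 b15 ab nadj.
  exists (core_add a b), s, t.+2, tv; split=> //.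
  - move=> x y x15 y15 /or3P[|/andP[/eqP-> /eqP->]|/andP[/eqP-> /eqP->]] //; first exact: core_sub.
    by rewrite fs.
  - by split=> //; first [by case: (s) ss | by rewrite leqnn].
  - by split=> //; first [by move=> i; apply: level_tv | by rewrite ltnn].
  - by rewrite ss; lia.
(* The chosen vertices must run through the ends of the new edge that lie in the tail. *)
pose rep i := if i == level v then v else if i == level u then u else tv i.
have lr i : 0 < i <= t.+1 -> level (rep i) = i.
  by rewrite /rep => hi; case: eqP => [->//|_]; case: eqP => [->//|_]; apply: level_tv.
have rv : rep (level v) = v by rewrite /rep eqxx.
have lv := level_le v.
have [u0|u0] := posnP (level u).
  have [a a15 ua] := level0 u0; rewrite ua adj_port // in nadj.
  (* On level 1 there is no tail level below [v] to omit. As [u] is then not a port, the saving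
     comes from a core triple through [u]. *)
  have [v1|v1] := eqVneq (level v) 1.
    rewrite v1 eqxx andbT /= -leqNgt in nadj.
    have [s [as' cs ss]] := @tripleP a (ltac:(lia)).
    exists core_adj, s, (level v), rep; split=> //.
    - by split=> //; first [by case: (s) ss | by lia].
    - split=> //; first lia.
      by move=> _; exists u; [rewrite rv fs | left; exists a].
    - by rewrite ss; lia.
  have [s [as' cs ps ss]] := quadP a15.
  exists core_adj, s, (level v), rep; split=> //.
  - by split=> //; first [by case: (s) ss | by lia].
  - by split=> // _; exists u; [rewrite rv fs | left; exists a].
  - by rewrite ss; lia.
rewrite adj_tail // nuv /= in nadj.
(* Nonadjacent tail vertices are at least two levels apart, so the level just below [v] can be
   omitted. *)
have [s [as' cs ps ss]] := quadP (isT : 0 < 15).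
exists core_adj, s, (level v), rep; split=> //.
- by split=> //; first [by case: (s) ss | by lia].
- split=> // _; exists u; first by rewrite rv fs.
  right; split=> //; first lia.
  by rewrite /rep eqxx; case: eqP => // h; lia.
- by rewrite ss; lia.
Qed.

Lemma adj_level u v : adj u v -> level v <= (level u).+1.
Proof.
case: u v => [a|u] [b|v] //; first by move=> /andP[_ /eqP->].
by rewrite adj_tail ?level_inr // => /and3P[].
Qed.

Lemma port_adj a b : a < 2 -> b < 2 -> a != b -> core_adj a b.
Proof. by case: a b => [|[|a]] [|[|b]]. Qed.

(** * Lower bound: four core vertices and one vertex on each of the levels [1..t] *)

Section CDSetBound.
Variable D : {set vert}.
Hypothesis cd_D : cd_set adj D.

Let domD : forall x, x \notin D -> exists2 y, y \in D & adj x y.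
Proof. by have /cd_setP[] := cd_D. Qed.
Let conD : connected_in adj D.
Proof. by have /cd_setP[] := cd_D. Qed.

Lemma cd_core : exists2 c, c \in D & level c = 0.
Proof.
have [cD|/domD[[c|w] cD //]] := boolP (cv 14 \in D); first by exists (cv 14).
  by exists (inl c).
by rewrite adj_port ?level_inr.
Qed.

(** An edge raises the level by at most one, and [D] has vertices in the core and on level [t] or
    above. *)
Lemma cd_level i : 0 < i <= t -> exists2 v, v \in D & level v = i.
Proof.
move=> it; have [/existsP[v /andP[vD /eqP lv]]|n] := boolP [exists v in D, level v == i].
  by exists v.
have nD v : v \in D -> level v != i.
  by move=> vD; apply: contraNneq n => lv; apply/exists_inP; exists v; rewrite ?lv.
have [c cD lc] := cd_core.
have [d dD ld] : exists2 d, d \in D & i <= level d.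
  have lt : level (tv t.+1) = t.+1 by apply: level_tv; lia.
  have [h|/domD[d dD]] := boolP (tv t.+1 \in D).
    by exists (tv t.+1); rewrite ?lt; lia.
  by rewrite adj_sym => /adj_level; rewrite lt => h; exists d => //; lia.
have [||u [v [uD + vD + /adj_level uv]]] :=
  connected_in_cross (A := [set v | level v < i]) conD cD _ dD; rewrite ?inE; try lia.
by have := nD v vD; lia.
Qed.

Lemma cd_port : exists2 a, a < 2 & cv a \in D.
Proof.
have [c cD lc] := cd_core.
have edge u v : adj u v -> u \in D -> level u = 0 -> 0 < level v -> exists2 a, a < 2 & cv a \in D.
  move=> uv uD /level0[a a15 ua]; move: uv; rewrite ua => uv lv.
  by rewrite adj_port // in uv; exists a; [case/andP: uv | rewrite -ua].
have [d dD ld] : exists2 d, d \in D & (0 < level d) || adj (tv 1) d.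
  have [h|/domD[d dD td]] := boolP (tv 1 \in D); first by exists (tv 1).
  by exists d; rewrite ?td ?orbT.
have [d0|d0] := posnP (level d).
  by rewrite d0 adj_sym in ld; apply: (edge d (tv 1)).
have [||u [v [uD + vD + uv]]] :=
  connected_in_cross (A := [set v | level v == 0]) conD cD _ dD; rewrite ?inE ?lc //; first lia.
by move=> /eqP lu; rewrite -lt0n => lv; apply: (edge u v).
Qed.

Definition core_part : {set 'I_15} := [set a | inl a \in D].

(** An excursion of [D] into the tail leaves and re-enters the core at ports, which are adjacent to
    each other. So the core part is connected by itself. *)
Lemma core_part_cross (A : {set 'I_15}) a y :
    a \in core_part -> a \in A -> a < 2 -> y \in core_part -> y \notin A ->
  exists x z, [/\ x \in A, z \in core_part, z \notin A & core_adj x z].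
Proof.
move=> aC aA a2 yC yA; rewrite !inE in aC yC.
pose B := [set v : vert | if v is inl b then b \in A else true].
have [||u [v [uD + vD + uv]]] := connected_in_cross (A := B) conD aC _ yC; rewrite ?inE //.
case: v vD uv => [b|w] // bD ub uA bA; case: u uD ub uA => [x|w] uD ub uA.
  by exists x, b; rewrite ?inE.
exists a, b; split; rewrite ?inE //; apply: port_adj => //; first by case/andP: ub.
by apply: contraNneq bA => /val_inj<-.
Qed.

(** A core part of at most three vertices is exhausted by two growth steps from a port [a]. It
    dominates the core, because a core vertex dominated from the tail is a port and hence adjacent
    to [a]. This contradicts [core_no_triple_check]. *)
Lemma core_part_ge : 3 < #|core_part|.
Proof.
rewrite ltnNge; apply/negP => C3; have [a0 a2 aD] := cd_port.
have [a aC ea] : exists2 a : 'I_15, a \in core_part & a = a0 :> nat.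
  by exists (inord a0); [rewrite inE | apply: inordK; lia].
rewrite -{}ea {a0 aD} in a2.
suff [b [c [hb hc sub]]] : exists b c : 'I_15,
   [/\ (b == a :> nat) || core_adj a b,
       [|| c == a :> nat, c == b :> nat, core_adj a c | core_adj b c] &
       core_part \subset [set a; b; c]].
  have /allP/(_ (a : nat)) := core_no_triple_check.
  have -> : (a : nat) \in [:: 0; 1] by case: (a : nat) a2 => [|[|]].
  move=> /(_ isT)/allP/(_ [:: c : nat; b : nat; a : nat]); rewrite mem_filter.
  have -> : [:: c : nat; b : nat; a : nat] \in triples a.
    by apply/allpairsP; exists (b : nat, c : nat); rewrite !mem_iota !ltn_ord.
  rewrite /= hb hc => /(_ isT)/negP; apply.
  rewrite /dominates_below lazy_allE; apply/allP => v; rewrite mem_iota => /andP[_ v15].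
  have inC d : d \in core_part -> (d : nat) \in [:: c : nat; b : nat; a : nat].
    by move/(subsetP sub); rewrite !inE -!(inj_eq val_inj) => /orP[/orP[]|] ->; rewrite ?orbT.
  case: ifPn => // vs; apply/hasP.
  have vD : cv v \notin D.
    apply: contraNN vs => vD; have := inC (inord v); rewrite inordK //; apply.
    by rewrite inE.
  have [[d|w] dD] := domD vD.
    by rewrite -cvK adj_cv //; exists (d : nat); rewrite ?inC ?inE.
  rewrite adj_port ?level_inr // => /andP[v2 _]; exists (a : nat); first by rewrite !inE eqxx !orbT.
  by apply: port_adj => //; apply: contraNneq vs => ->; rewrite !inE eqxx !orbT.
have [Ca|[b bC ba]] : core_part \subset [set a] \/ exists2 b, b \in core_part & b \notin [set a].
  by case: (boolP (core_part \subset [set a])) => [|/subsetPn]; [left|right].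
  exists a, a; rewrite eqxx; split=> //; apply: subset_trans Ca _.
  by apply/subsetP => x; rewrite !inE => ->.
have [x [{}b [/set1P-> {}bC {}ba ab]]] := core_part_cross aC (set11 a) a2 bC ba.
rewrite inE in ba.
have [Cb|[c cC cb]] : core_part \subset [set a; b] \/ exists2 c, c \in core_part & c \notin [set a; b].
  by case: (boolP (core_part \subset [set a; b])) => [|/subsetPn]; [left|right].
  exists b, b; rewrite eqxx ab orbT; split; rewrite ?orbT //; apply: subset_trans Cb _.
  by apply/subsetP => y; rewrite !inE => ->.
have [{}x [{}c [xab {}cC {}cb xc]]] := core_part_cross aC (set21 a b) a2 cC cb.
exists b, c; rewrite ab orbT; split=> //.
  by case/set2P: xab xc => -> ->; rewrite ?orbT.
have sub : [set a; b; c] \subset core_part.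
  by apply/subsetP => y; rewrite !inE => /orP[/orP[]|] /eqP->; move: aC bC cC; rewrite !inE.
have card3 : #|[set a; b; c]| = 3.
  by rewrite setUC cardsU1 cb cards2 eq_sym ba.
by have /eqP<- : [set a; b; c] == core_part by rewrite eqEcard sub card3.
Qed.

Lemma card_cd_ge : t + 4 <= #|D|.
Proof.
rewrite -(cardsID [set v | level v == 0] D) addnC leq_add //.
  apply: leq_trans core_part_ge _.
  rewrite -(card_imset core_part (@inl_inj _ ('I_t.+1 + 'I_(t - z)))).
  by apply/subset_leq_card/subsetP => v /imsetP[a]; rewrite !inE => aD ->; rewrite aD.
rewrite -(size_iota 1 t) cardE -(size_map level).
apply: uniq_leq_size (iota_uniq _ _) _ => i; rewrite mem_iota => it.
have [v vD lv] := @cd_level i (ltac:(lia)).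
by rewrite -lv map_f // mem_enum !inE vD lv; lia.
Qed.

End CDSetBound.

Lemma critical_adj : gamma_c_critical (t + 4) adj.
Proof.
have [s [_ cs ps ss]] := quadP (isT : 0 < 15).
split; first exact: connected_adj.
  apply/eqP; rewrite eqn_leq; apply/andP; split.
    have [D [cD _ le]] := @adj_avoiding (cv 0) (or_intror erefl) isT.
    by apply: leq_trans le; apply: gamma_c_le cD; apply: connected_adj.
  by have [D cD <-] := gamma_c_min connected_adj; apply: card_cd_ge.
move=> u v nuv nadj; have su := add_edge_sym u v adj_sym.
have sub : subrel adj (add_edge adj u v) by move=> x y xy; rewrite add_edgeE xy.
have [luv|/ltnW luv] := leqP (level u) (level v).
  by apply: (@gamma_c_add _ u v) => //; rewrite add_edgeE !eqxx orbT.
apply: (@gamma_c_add _ v u) => //; rewrite 1?eq_sym 1?adj_sym //.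
by rewrite add_edgeE !eqxx !orbT.
Qed.

Lemma cut_adj v : cut_vertex adj v = (0 < level v <= z).
Proof.
have T2 : 1 < #|vert| by rewrite card_sum card_ord; lia.
have sv := adj_sym; have cg := connected_adj.
apply/idP/idP => [|lv].
  apply: contraLR => lv; rewrite cut_vertexE // negbK.
  have [->|vt] := eqVneq v (tv t.+1); last first.
    have [|D [cD vD _]] := @adj_avoiding v _ vt; last exact: cd_set_connected_del cD vD.
    by case: posnP lv => [->|]; [right | left; lia].
  have [s [_ cs ps ss]] := quadP (isT : 0 < 15).
  apply: (@cd_set_connected_del _ _ (tail_cd s t.+2 tv)) => //.
    by apply: (@tail_cd_cd_set _ core_adj) => //;
    first [by move=> *; rewrite adj_cv | by case: (s) ss | by move=> i; apply: level_tv | by lia].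
  by rewrite mem_tail_cd level_tv ?ltnn ?andbF; lia.
apply/cut_vertexP => //; exists [set u | level u < level v], (cv 0), (tv t.+1).
have lt : level (tv t.+1) = t.+1 by apply: level_tv; lia.
split.
- by rewrite inE level_cv; lia.
- by rewrite inE lt; lia.
- by apply: contraTneq lv => <-.
- by apply: contraTneq lv => <-; rewrite lt; lia.
move=> a b; rewrite !inE => av bv _ nb; apply: contra nb => /adj_level ab.
by rewrite (level_single lv) (level_single (v := b)); [apply/eqP; congr tv; lia | lia].
Qed.

Lemma card_cut_adj : #|cut_vertices adj| = z.
Proof.
have -> : cut_vertices adj = [set tv i.+1 | i : 'I_z].
  apply/setP => v; rewrite inE cut_adj; apply/idP/imsetP => [lv|[i _ ->]].
    have iz : (level v).-1 < z by lia.
    by exists (Ordinal iz) => //=; rewrite prednK; [apply: level_single | lia].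
  by rewrite level_tv; have := ltn_ord i; lia.
rewrite card_imset ?card_ord // => i i' /(congr1 level).
have li := ltn_ord i; have li' := ltn_ord i'.
by rewrite !level_tv ?ltnS ?(leq_trans (ltnW _) zt) // => -[/val_inj].
Qed.

(** * Components met by a path *)

Definition color (v : vert) : nat := if v is inl a then a else 15.

Lemma color_adj u v : adj u v -> 7 <= color u -> 7 <= color v -> color u = color v.
Proof.
case: u v => [a|u] [b|v] //=.
- have /allP/(_ a) := core_independent_check; rewrite mem_iota ltn_ord => /(_ isT).
  move/allP/(_ b); rewrite mem_iota ltn_ord => /(_ isT) h ab a7 b7.
  by move: h; rewrite ab /= ltnNge a7 /= ltnNge b7.
- by move=> /andP[a2 _]; case: ltngtP a2 => //; case: (nat_of_ord a) => [|[|]].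
- by move=> /andP[b2 _] _; case: (nat_of_ord b) b2 => [|[|]].
Qed.

(* Deleting the seven core vertices 0..6 leaves nine components, while a path
   meets at most one more component than the number of deleted vertices. *)
Lemma path_colors u p : path adj u p ->
  size (undup (filter (leq 7) (map color (u :: p))))
    <= count [pred v | color v < 7] (u :: p) + (7 <= color u).
Proof.
elim: p u => [|v p IH] u; first by move=> _ /=; case: (7 <= color u); rewrite ?addn1.
rewrite [path _ _ _]/= => /andP[uv /IH {IH}].
set F := filter (leq 7) _; set c := count _ _ => h.
have vF : 7 <= color v -> color v \in F by move=> v7; rewrite mem_filter v7 mem_head.
have -> : filter (leq 7) (map color (u :: v :: p)) =
  if 7 <= color u then color u :: F else F by [].
have -> : count [pred v | color v < 7] (u :: v :: p) = (color u < 7) + c by [].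
move: (F) (c) vF h => {}F {}c vF h; case: (leqP 7 (color u)) => u7 /=.
  case: ifP => [_|/negbT uF] /=.
    by apply: leq_trans h _; rewrite leq_add2l leq_b1.
  case: (leqP 7 (color v)) vF h => v7 vF h; last first.
    by rewrite addn1 ltnS; apply: leq_trans h _; rewrite addn0.
  by rewrite (color_adj uv u7 v7) vF in uF.
by apply: leq_trans h _; rewrite addn0 [1 + c]addnC leq_add2l leq_b1.
Qed.

Lemma not_hamiltonian_adj : ~ has_hamiltonian_path adj.
Proof.
case=> u [p [/path_colors + un all_p]]; apply/negP; rewrite -ltnNge.
have cnt : count [pred v | color v < 7] (u :: p) <= 7.
  rewrite -size_filter -(size_map color).
  apply: (@uniq_leq_size _ _ (iota 0 7)) => [|x /mapP[v]]; last first.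
    by rewrite mem_filter => /andP[h _ ->]; rewrite mem_iota.
  rewrite map_inj_in_uniq ?filter_uniq // => v w; rewrite !mem_filter /=.
  by case: v w => [a|v] [b|w] //= _ _ /val_inj ->.
apply: leq_ltn_trans (leq_add cnt (leq_b1 _)) _.
(* The colours 7 to 14 are the isolated core vertices and 15 is the tail: nine colours against the
   bound 7 + 1. *)
apply: (@uniq_leq_size _ (iota 7 9)) => [|x]; first exact: iota_uniq.
rewrite mem_iota => x15.
rewrite mem_undup mem_filter; apply/andP; split; first lia.
have [x15'|x15'] := ltnP x 15.
  by apply/mapP; exists (inl (Ordinal x15')).
by apply/mapP; exists (tv 1); rewrite //=; lia.
Qed.

End Counterexample.

Lemma nontraceable_critical (k zeta : nat) : 4 <= k -> zeta <= k - 4 ->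
  exists (T : finType) (e : rel T),
    [/\ simple_graph e, gamma_c_critical k e, #|cut_vertices e| = zeta
       & ~ has_hamiltonian_path e].
Proof.
move=> k4 zk; exists (vert (k - 4) zeta), (@adj (k - 4) zeta); split.
- by split; [apply: adj_sym | apply: adj_irr].
- by have := critical_adj zk; rewrite subnK.
- exact: card_cut_adj.
- exact: not_hamiltonian_adj.
Qed.

(** * Linking path covers through a dominating clique *)

Section SortedCat.
Variables (T : eqType) (e : rel T) (x0 : T).
Hypothesis e_sym : symmetric e.
Implicit Types (q s : seq T).

Lemma sorted_cat q s : ~~ nilp q -> ~~ nilp s ->
  sorted e (q ++ s) = [&& sorted e q, e (last x0 q) (head x0 s) & sorted e s].
Proof. by case: q s => [|x q] [|y s] //= _ _; rewrite cat_path. Qed.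

Lemma sorted_rev q : sorted e (rev q) = sorted e q.
Proof. by rewrite rev_sorted; case: q => //= x q; apply: eq_path => a b; apply: e_sym. Qed.

Lemma head_rev q : head x0 (rev q) = last x0 q.
Proof. by case/lastP: q => // q x; rewrite rev_rcons last_rcons. Qed.

Lemma last_rev q : last x0 (rev q) = head x0 q.
Proof. by rewrite -[in RHS](revK q) head_rev. Qed.

Lemma nilp_rev q : nilp (rev q) = nilp q.
Proof. by rewrite /nilp size_rev. Qed.

Lemma head_mem q : ~~ nilp q -> head x0 q \in q.
Proof. by case: q => // x q _; apply: mem_head. Qed.

Lemma last_mem q : ~~ nilp q -> last x0 q \in q.
Proof. by case: q => // x q _; rewrite /= mem_last. Qed.

Lemma sorted_clique s :
  uniq s -> {in s &, forall a b, a != b -> e a b} -> sorted e s.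
Proof.
elim: s => [|x [|y s] IH] //= /andP[xs us] cl.
apply/andP; split.
  by apply: cl; rewrite ?inE ?eqxx ?orbT //; move: xs; rewrite inE negb_or => /andP[].
by apply: (IH us) => a b ha hb; apply: cl; rewrite inE ?ha ?hb orbT.
Qed.

End SortedCat.

Section Linkage.
Variables (T : finType) (e : rel T) (N R : {set T}) (x0 : T).
Hypothesis e_sym : symmetric e.
Hypothesis e_irr : irreflexive e.
Hypothesis NR : [disjoint N & R].
Hypothesis N_clique : {in N &, forall a b, a != b -> e a b}.
Implicit Types (q m : seq T) (qs c : seq (seq T)) (w x y : T).

Definition arc_via w x y : bool :=
  [&& w \in N, e w x, ~~ e w y &
      [forall r in R, (r != y) ==> (r != x) ==> (e w r || e x r)]].

Definition arc x y : bool := [exists w, arc_via w x y].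

(** In the application [N] and [R] are the neighbours and non-neighbours of the root in a branch of
    excess 3. [arc_total] comes from criticality, [N_meet] from the excess being more than 2, and
    [no_simplicial] from a simplicial vertex on the other side of the root. *)
Hypothesis arc_total :
  {in R &, forall x y, x != y -> ~~ e x y -> arc x y || arc y x}.
Hypothesis N_meet :
  {in N &, forall w w', exists2 r, r \in R & ~~ e w r && ~~ e w' r}.
Hypothesis no_simplicial : {in R, forall y, exists a b,
  [/\ a \in N :|: R, b \in N :|: R, e y a, e y b & (a != b) && ~~ e a b]}.
Hypothesis NR_edge : exists n r, [/\ n \in N, r \in R & e n r].

Definition traceable_from_N : Prop :=
  exists n p, [/\ n \in N, path e n p, uniq (n :: p) & n :: p =i N :|: R].

Hypothesis not_traceable : ~ traceable_from_N.

Local Notation hd := (head x0).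
Local Notation lt := (last x0).

Lemma not_NR x : x \in N -> x \in R -> False.
Proof. by move=> xN xR; have /pred0P/(_ x) := NR; rewrite /= xN xR. Qed.

Lemma arc_viaP w x y : arc_via w x y ->
  [/\ w \in N, e w x, ~~ e w y &
      forall r, r \in R -> r != y -> r != x -> ~~ e x r -> e w r].
Proof.
case/and4P=> wN wx wy /forall_inP h; split=> // r rR ry rx nxr.
by have := h r rR; rewrite ry rx (negbTE nxr) orbF.
Qed.

Lemma arc_nbr x y : arc x y -> exists2 w, w \in N & e w x.
Proof. by case/existsP=> w /arc_viaP[wN wx _ _]; exists w. Qed.

(** Otherwise the vertices of the clique [N] outside [X], with [n] placed last, could be prepended
    to [X] or its reverse, giving a hamiltonian path that starts in [N]. *)
Lemma end_not_adj X n : sorted e X -> uniq X -> {subset R <= X} ->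
    {subset X <= N :|: R} -> ~~ nilp X -> n \in N -> n \notin X ->
  ~~ e n (hd X) && ~~ e n (lt X).
Proof.
suff half Y : sorted e Y -> uniq Y -> {subset R <= Y} ->
    {subset Y <= N :|: R} -> ~~ nilp Y -> n \in N -> n \notin Y -> ~~ e n (hd Y).
  move=> sX uX RX XNR X0 nN nX; rewrite half //= -(head_rev x0) half //.
  - by rewrite sorted_rev.
  - by rewrite rev_uniq.
  - by move=> r /RX; rewrite mem_rev.
  - by move=> r; rewrite mem_rev => /XNR.
  - by rewrite nilp_rev.
  - by rewrite mem_rev.
move=> sY uY RY YNR Y0 nN nY; apply/negP => enY; apply: not_traceable.
have [s us0 sE] : exists2 s, uniq s &
    forall x, (x \in s) = [&& x != n, x \notin Y & x \in N].
  by exists (enum (N :\: [set x in Y] :\ n)) => [|x]; rewrite ?enum_uniq // mem_enum !inE.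
have us : uniq (rcons s n) by rewrite rcons_uniq sE eqxx us0.
have ss : sorted e (rcons s n).
  apply: sorted_clique us _ => a b; rewrite !mem_rcons !inE !sE => ha hb.
  by apply: N_clique; [case/orP: ha => [/eqP->|/and3P[]] | case/orP: hb => [/eqP->|/and3P[]]].
have sX : sorted e (rcons s n ++ Y).
  by rewrite (sorted_cat _ x0) ?ss ?sY ?last_rcons ?enY //; case: (s).
have uX : uniq (rcons s n ++ Y).
  rewrite cat_uniq us uY andbT /=; apply/hasPn => y yY.
  rewrite mem_rcons inE sE yY andbF orbF; apply: contraNneq nY => <- //.
have mX : rcons s n ++ Y =i N :|: R.
  move=> x; rewrite mem_cat mem_rcons inE sE inE.
  apply/idP/idP => [|xNR].
    case/orP => [/orP[/eqP->|/and3P[_ _ ->]] //|/YNR]; first by rewrite nN.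
    by rewrite inE.
  have [//|xY] := boolP (x \in Y); first by rewrite orbT.
  have [//|xn] := eqVneq x n; case/orP: xNR => [->//|/RY].
  by rewrite (negbTE xY).
have hN : hd (rcons s n ++ Y) \in N.
  case es: s => [|a s'] //=.
  by have /[!sE]/and3P[] : a \in s by rewrite es mem_head.
case eX: (rcons s n ++ Y) sX uX mX hN => [|h p] sX uX mX hN.
  by move: eX; case: (s).
by exists h, p.
Qed.

(** * Path covers of [R] *)

Definition cover qs : Prop :=
  [/\ all (sorted e) qs, [::] \notin qs, uniq (flatten qs) & flatten qs =i R].

Lemma cover_perm qs qs' : perm_eq qs qs' -> cover qs -> cover qs'.
Proof.
move=> pq [s0 n0 u0 m0]; have pf := perm_flatten pq; split.
- by rewrite -(perm_all _ pq).
- by rewrite -(perm_mem pq).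
- by rewrite -(perm_uniq pf).
- by move=> x; rewrite -(perm_mem pf).
Qed.

Lemma cover_rev q qs : cover (q :: qs) -> cover (rev q :: qs).
Proof.
case=> /= /andP[sq sqs]; rewrite inE negb_or => /andP[q0 n0] u m.
have pf : perm_eq (flatten (q :: qs)) (flatten (rev q :: qs)).
  by rewrite /= perm_cat2r perm_sym perm_rev.
split.
- by rewrite /= sorted_rev ?sq.
- rewrite inE negb_or n0 andbT; apply: contraNneq q0 => h.
  by rewrite -(revK q) -h.
- by rewrite -(perm_uniq pf).
- by move=> x; rewrite -(perm_mem pf).
Qed.

Lemma cover_neq0 q qs : cover qs -> q \in qs -> ~~ nilp q.
Proof. by case=> _ n0 _ _ qq; apply: contraNN n0 => /nilP <-. Qed.

Lemma cover_sub q qs x : cover qs -> q \in qs -> x \in q -> x \in R.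
Proof. by case=> _ _ _ m qq xq; rewrite -m; apply/flattenP; exists q. Qed.

Lemma cover_sorted q qs : cover qs -> q \in qs -> sorted e q.
Proof. by case=> /allP h _ _ _; apply: h. Qed.

Lemma cover_disj q qs m x : cover (q :: qs) -> m \in qs -> x \in q -> x \in m -> False.
Proof.
case=> _ _ /= + _ mqs xq xm; rewrite cat_uniq => /and3P[_ /hasPn/(_ x) h _].
have /h/negP : x \in flatten qs by apply/flattenP; exists m.
exact.
Qed.

Lemma cover_uniq qs : cover qs -> uniq qs.
Proof.
elim: qs => //= q qs IH cv; have qq := mem_head q qs.
apply/andP; split.
  apply/negP => /(cover_disj cv); have := cover_neq0 cv qq.
  by case: (q) => // x q' _ /(_ x); rewrite mem_head => /(_ isT isT).
case: cv => /= /andP[_ sqs]; rewrite inE negb_or => /andP[_ n0].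
rewrite cat_uniq => /and3P[_ _ u] m.
elim: qs {IH m qq} sqs n0 u => //= p qs IH /andP[sp sqs].
rewrite inE negb_or => /andP[p0 n0]; rewrite cat_uniq => /and3P[up hp u].
rewrite IH // andbT; apply: contraNN hp => pqs; case: p p0 pqs {sp up} => // x p _ pqs.
apply/hasP; exists x; rewrite ?mem_head //.
by apply/flattenP; exists (x :: p); rewrite ?mem_head.
Qed.

Definition is_end q x := (x == hd q) || (x == lt q).

Lemma end_mem q qs x : cover qs -> q \in qs -> is_end q x -> x \in q.
Proof.
move=> cv qq; have q0 := cover_neq0 cv qq.
by case/orP=> /eqP->; rewrite ?head_mem ?last_mem.
Qed.

Lemma is_end_rev q x : is_end (rev q) x = is_end q x.
Proof. by rewrite /is_end head_rev last_rev orbC. Qed.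

Lemma end_hd q : is_end q (hd q). Proof. by rewrite /is_end eqxx. Qed.
Lemma end_lt q : is_end q (lt q). Proof. by rewrite /is_end eqxx orbT. Qed.
Hint Resolve end_hd end_lt : core.

Section Minimal.
Variable r : nat.
Hypothesis r_min : forall qs, cover qs -> r <= size qs.

Definition min_cover qs := cover qs /\ size qs = r.

Lemma min_perm qs qs' : perm_eq qs qs' -> min_cover qs -> min_cover qs'.
Proof. by move=> pq [cv sz]; split; [apply: cover_perm cv | rewrite -(perm_size pq)]. Qed.

Lemma min_rev q qs : min_cover (q :: qs) -> min_cover (rev q :: qs).
Proof. by case=> cv sz; split; first apply: cover_rev. Qed.

Lemma min_not_merge q m qs s : min_cover (q :: m :: qs) -> perm_eq s (q ++ m) ->
  ~~ sorted e s.
Proof.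
case=> cv sz ps; apply/negP => ss; have [sqs n0 u mm] := cv.
have : cover (s :: qs).
  have pf : perm_eq (flatten (q :: m :: qs)) (flatten (s :: qs)).
    by rewrite /= catA perm_cat2r perm_sym.
  split.
  - by move: sqs => /= /and3P[_ _ ->]; rewrite ss.
  - move: n0; rewrite !inE !negb_or => /and3P[q0 m0 ->]; rewrite andbT.
    apply: contraNneq q0 => s0; rewrite -s0 in ps.
    by have := perm_size ps; rewrite size_cat; case: (q).
  - by rewrite -(perm_uniq pf).
  - by move=> x; rewrite -(perm_mem pf).
by move/r_min; rewrite -sz /= ltnn.
Qed.

Lemma ends_not_adj q m qs x y : min_cover (q :: qs) -> m \in qs ->
  is_end q x -> is_end m y -> ~~ e x y.
Proof.
move=> mc mqs ex ey.
wlog -> : q x mc ex / x = lt q.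
  move=> gen; case/orP: (ex) => /eqP xE; last exact: (gen q x mc ex xE).
  by apply: (gen (rev q)); [apply: min_rev | rewrite is_end_rev | rewrite last_rev].
have {}mc : min_cover (q :: m :: rem m qs).
  by apply: min_perm mc; rewrite perm_cons perm_to_rem.
have [cv _] := mc; have q0 := cover_neq0 cv (mem_head _ _).
have m0 : ~~ nilp m by apply: cover_neq0 cv _; rewrite !inE eqxx orbT.
have sq : sorted e q by apply: cover_sorted cv _; rewrite mem_head.
have sm : sorted e m by apply: cover_sorted cv _; rewrite !inE eqxx orbT.
case/orP: ey => /eqP->.
  have := min_not_merge mc (perm_refl (q ++ m)).
  by rewrite (sorted_cat _ x0) // sq sm andbT.
have pr : perm_eq (q ++ rev m) (q ++ m) by rewrite perm_cat2l perm_rev.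
have := min_not_merge mc pr.
by rewrite (sorted_cat _ x0) ?nilp_rev // sorted_rev // sq sm head_rev andbT.
Qed.

Lemma ends_neq q m qs x y : min_cover (q :: qs) -> m \in qs ->
  is_end q x -> is_end m y -> x != y.
Proof.
case=> cv _ mqs ex ey; apply/eqP => xy; apply: (cover_disj cv mqs (x := x)).
  exact: end_mem cv (mem_head _ _) ex.
by rewrite xy; apply: end_mem cv _ ey; rewrite inE mqs orbT.
Qed.

Lemma ends_arc q m qs x y : min_cover (q :: qs) -> m \in qs ->
  is_end q x -> is_end m y -> arc x y || arc y x.
Proof.
move=> mc mqs ex ey; have [cv _] := mc; apply: arc_total.
- by apply: (cover_sub cv (mem_head _ _)); apply: end_mem cv (mem_head _ _) ex.
- by apply: (cover_sub cv) (end_mem cv _ ey); rewrite inE mqs orbT.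
- exact: ends_neq mc mqs ex ey.
- exact: ends_not_adj mc mqs ex ey.
Qed.

(** In a minimum cover [x] sees no end of another path, so [w] has to dominate all of them except
    [y]. This makes witnesses distinct and usable as links. *)
Lemma arc_via_end q m qs w x y u : min_cover (q :: qs) -> m \in qs ->
  is_end q x -> is_end m u -> arc_via w x y -> u != y -> e w u.
Proof.
move=> mc mqs ex eu /arc_viaP[_ _ _ h] uy; have [cv _] := mc; apply: h => //.
- by apply: (cover_sub cv) (end_mem cv _ eu); rewrite inE mqs orbT.
- by rewrite eq_sym; apply: ends_neq mc mqs ex eu.
- exact: ends_not_adj mc mqs ex eu.
Qed.

End Minimal.

(** A path with adjacent ends is a cycle, which can be opened before [x]. *)
Lemma rot_sorted q s x : sorted e (q ++ x :: s) ->
  nilp q || e (lt (x :: s)) (hd q) -> sorted e (x :: s ++ q).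
Proof.
case: q => [|y q]; first by rewrite cats0.
rewrite (sorted_cat e x0) //= => /andP[sq /andP[_ ss]] exy.
by rewrite cat_path ss /= exy.
Qed.

Lemma single_path q : uniq q -> ~~ nilp q -> hd q = lt q -> q = [:: hd q].
Proof.
case: q => [|x [|y q]] //= /andP[xq _] _ xl.
by rewrite xl mem_last in xq.
Qed.

(** No vertex of [N] sees an end of [q], so there is no arc between the two ends and they must be
    adjacent. The resulting cycle can be opened at a vertex [v] that does have a neighbour in
    [N]. *)
Lemma cover1_false q : cover [:: q] -> False.
Proof.
move=> cv; have [sq n0 u m] := cv; rewrite /= cats0 in u m.
have qq := mem_head q [::]; have q0 := cover_neq0 cv qq.
have {}sq := cover_sorted cv (mem_head _ _).
have sub x : x \in q -> x \in N :|: R by rewrite m inE => ->; rewrite orbT.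
have noN n : n \in N -> ~~ e n (hd q) && ~~ e n (lt q).
  move=> nN; apply: end_not_adj => //; first by move=> x; rewrite m.
  by apply/negP; rewrite m => /(not_NR nN).
have [n [v [nN vR env]]] := NR_edge.
have vq : v \in q by rewrite m.
case/splitPr: vq sq u m sub noN {cv n0 qq} q0 => q1 q2 sq u m sub noN q0.
have q10 : ~~ nilp q1.
  by apply: contraTN env => /nilP q1E; have := noN n nN; rewrite q1E => /andP[].
have eyz : e (lt (v :: q2)) (hd q1).
  have hE : hd (q1 ++ v :: q2) = hd q1 by case: (q1) q10.
  have lE : lt (q1 ++ v :: q2) = lt (v :: q2) by rewrite last_cat.
  rewrite hE lE in noN; apply/negPn/negP => ne.
  have h1 : hd q1 \in q1 by apply: head_mem.
  have l2 : lt (v :: q2) \in v :: q2 by apply: last_mem.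
  have ne' : lt (v :: q2) != hd q1.
    apply: contraTneq u => eq; rewrite cat_uniq; apply/negP => /and3P[_ /hasPn h _].
    by have := h _ l2; rewrite eq h1.
  have /orP[] : arc (lt (v :: q2)) (hd q1) || arc (hd q1) (lt (v :: q2)).
  - by apply: arc_total => //; rewrite -m mem_cat ?h1 // l2 orbT.
  - by case/arc_nbr => w wN ew; have /andP[_ /negP] := noN w wN.
  - by case/arc_nbr => w wN ew; have /andP[/negP] := noN w wN.
have pX : perm_eq (v :: q2 ++ q1) (q1 ++ v :: q2) by rewrite -cat_cons perm_catC.
have /andP[/negP] : ~~ e n (hd (v :: q2 ++ q1)) && ~~ e n (lt (v :: q2 ++ q1)).
  apply: end_not_adj => //.
  - by apply: rot_sorted sq _; rewrite eyz orbT.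
  - by rewrite (perm_uniq pX).
  - by move=> x xR; rewrite (perm_mem pX) m.
  - by move=> x; rewrite (perm_mem pX) => /sub.
  - by apply/negP; rewrite (perm_mem pX) m => /(not_NR nN).
by [].
Qed.

Lemma two_link q m w n : cover [:: q; m] -> w \in N -> e (lt q) w -> e w (hd m) ->
  n \in N -> n != w -> ~~ e n (hd q) && ~~ e n (lt m).
Proof.
move=> cv wN eqw ewm nN nw; have [_ _ u mm] := cv; rewrite /= cats0 in u mm.
have qq := mem_head q [:: m]; have mq : m \in [:: q; m] by rewrite !inE eqxx orbT.
have q0 := cover_neq0 cv qq; have m0 := cover_neq0 cv mq.
have NX x : x \in N -> x \notin q ++ m by move=> xN; apply/negP; rewrite mm => /(not_NR xN).
have pX : perm_eq (q ++ w :: m) (w :: q ++ m) by rewrite -cat1s perm_catCA.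
have -> : hd q = hd (q ++ w :: m) by case: (q) q0.
have -> : lt m = lt (q ++ w :: m) by rewrite last_cat /=; case: (m) m0.
apply: end_not_adj => //.
- rewrite (sorted_cat e x0) // (cover_sorted cv (mem_head _ _)) eqw /=.
  by case: (m) m0 ewm (cover_sorted cv mq) => //= y m' _ -> ->.
- by rewrite (perm_uniq pX) /= u NX.
- by move=> x xR; rewrite (perm_mem pX) inE mm xR orbT.
- move=> x; rewrite (perm_mem pX) inE mm => /orP[/eqP->|xR]; first by rewrite inE wN.
  by rewrite inE xR orbT.
- by case: (q).
- by rewrite (perm_mem pX) inE negb_or nw NX.
Qed.

Lemma nbr_in_R y : y \in R -> exists2 b, b \in R & e y b.
Proof.
move=> yR; have [a [b [aNR bNR ya yb /andP[ab nab]]]] := no_simplicial yR.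
have [aR|aR] := boolP (a \in R); first by exists a.
have [bR|bR] := boolP (b \in R); first by exists b.
move: aNR bNR; rewrite !inE (negbTE aR) (negbTE bR) !orbF => aN bN.
by rewrite N_clique in nab.
Qed.

Lemma cover_swap q m : cover [:: q; m] -> cover [:: m; q].
Proof. by apply: cover_perm; rewrite -[[:: q; m]]/([:: q] ++ [:: m]) perm_catC. Qed.

(** * Minimum covers with two paths *)

Section TwoPaths.
Hypothesis r_min : forall qs, cover qs -> 2 <= size qs.
Local Notation cover2 q m := (min_cover 2 [:: q; m]).

Let cover2_swap q m : cover2 q m -> cover2 m q.
Proof. by case=> cv _; split=> //; apply: cover_swap. Qed.

Let cover2_mem q m x : cover2 q m -> (x \in R) = (x \in q) || (x \in m).
Proof. by case=> -[_ _ _ <-] _; rewrite /= cats0 mem_cat. Qed.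

Let cover2_uniq q m : cover2 q m -> uniq q && uniq m.
Proof. by case=> -[_ _] + _ _; rewrite /= cats0 cat_uniq => /and3P[-> _ ->]. Qed.

(** If [m] had two different ends, linking [q] and [m] through [w] in several orientations would
    show that no vertex of [N] sees [hd m] and only [w] sees the ends of [q]. The arc between [hd q]
    and [lt m] then needs a second witness, which forces [q] to be a single vertex and [m] to close
    to a cycle. *)
Lemma two_target q m w : cover2 q m -> arc_via w (hd q) (hd m) -> hd m = lt m.
Proof.
move=> mc aw; apply/eqP/negPn/negP => hl; have [cv _] := mc.
have mc' := cover2_swap mc; have [cv' _] := mc'.
have mm := mem_head m [::]; have qq := mem_head q [::].
have crm : cover [:: q; rev m] by apply: cover_swap; apply: cover_rev.
have crr : cover [:: rev q; rev m] by apply: cover_rev.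
have [wN wy1 wy2 _] := arc_viaP aw.
have wz2 : e w (lt m).
  by apply: (arc_via_end r_min mc mm _ _ aw); rewrite ?end_hd ?end_lt // eq_sym.
have h1 n : n \in N -> n != w -> ~~ e n (lt q) && ~~ e n (hd m).
  move=> nN nw; rewrite -(head_rev x0 q) -(last_rev x0 m).
  by apply: (two_link crr wN) => //; rewrite ?last_rev ?head_rev // e_sym.
have y2N n : n \in N -> ~~ e n (hd m).
  by move=> nN; have [->//|/(h1 n nN)/andP[]] := eqVneq n w.
have wz1 : e w (lt q).
  have /orP[/existsP[w' aw']|] := ends_arc r_min mc mm (end_lt q) (end_hd m).
    have [w'N ew' _ _] := arc_viaP aw'.
    by have [<-//|/(h1 w' w'N)] := eqVneq w' w; rewrite ew'.
  by case/arc_nbr=> w' w'N; rewrite (negbTE (y2N w' w'N)).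
have h2 n : n \in N -> n != w -> ~~ e n (hd q).
  move=> nN nw; have := @two_link q (rev m) w n crm wN.
  by rewrite head_rev e_sym wz1 wz2 => /(_ isT isT nN nw)/andP[].
have /orP[/existsP[w' aw']|/existsP[w' aw']] := ends_arc r_min mc mm (end_hd q) (end_lt m).
  have [w'N ew' nw' _] := arc_viaP aw'.
  have [w'w|/(h2 w' w'N)] := eqVneq w' w; last by rewrite ew'.
  by rewrite w'w wz2 in nw'.
have [w'N ew' nw' hw'] := arc_viaP aw'.
have w'w : w' != w by apply: contraNneq nw' => ->.
have z1y1 : hd q = lt q.
  apply/eqP/negPn/negP => ne.
  have : e w' (lt q).
    by apply: (arc_via_end r_min mc' qq _ _ aw'); rewrite ?end_hd ?end_lt // eq_sym.
  by have /andP[/negbTE->] := h1 w' w'N w'w.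
have ez2y2 : e (lt m) (hd m).
  apply/negPn/negP => ne; have /negP := y2N w' w'N; apply; apply: hw' => //.
  - by rewrite (cover2_mem _ mc) head_mem ?orbT //; apply: cover_neq0 cv' (mem_head _ _).
  - by rewrite eq_sym; apply: (ends_neq mc mm (end_hd q) (end_hd m)).
have qE : q = [:: hd q].
  apply: single_path => //; first by have /andP[] := cover2_uniq mc.
  exact: cover_neq0 cv (mem_head _ _).
have y1R : hd q \in R.
  by rewrite (cover2_mem _ mc) head_mem //; apply: cover_neq0 cv (mem_head _ _).
have [b bR yb] := nbr_in_R y1R.
have bm : b \in m.
  move: bR; rewrite (cover2_mem _ mc) qE inE => /orP[/eqP bE|//].
  by move: yb; rewrite -bE e_irr.
have sm := cover_sorted cv' (mem_head _ _).
(* The cycle on [m] is opened at a neighbour [b] of the vertex [q], which merges the two paths. *)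
case/splitPr: bm => B1 B2 in mc ez2y2 sm {hl aw wy2 wz2 h1 y2N crm crr cv cv' mc' mm hw' ew' aw'}.
have sX : sorted e (b :: B2 ++ B1).
  apply: rot_sorted sm _; case: (B1) ez2y2 => [|x B] //=.
  by rewrite last_cat /= => ->.
have pX : perm_eq (q ++ b :: B2 ++ B1) (q ++ (B1 ++ b :: B2)).
  by rewrite perm_cat2l -cat_cons perm_catC.
have /negP := min_not_merge r_min mc pX; apply.
by rewrite qE /= yb; exact: sX.
Qed.

(** By [two_target], [m] is a single vertex [y], and both ends of [q] have arcs to it. If these ends
    are adjacent, the cycle on [q] is opened next to [y]. Otherwise there is an arc between them:
    its witness links its source to [y], while the witness of the arc from its target to [y] is left
    over and sees the free end. *)
Lemma cover2_false q m : cover2 q m -> False.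
Proof.
wlog /existsP[w aw] : q m / arc (hd q) (hd m).
  move=> gen mc; have mc' := cover2_swap mc.
  have /orP[] := ends_arc r_min mc (mem_head m [::]) (end_hd q) (end_hd m).
    by move/gen/(_ mc).
  by move/gen/(_ mc').
move=> mc; have [cv _] := mc; have mc' := cover2_swap mc; have [cv' _] := mc'.
have q0 := cover_neq0 cv (mem_head _ _); have m0 := cover_neq0 cv' (mem_head _ _).
have mm := mem_head m [::]; have qq := mem_head q [::].
have hm := two_target mc aw; have [wN wy1 wy _] := arc_viaP aw.
have /andP[uq um] := cover2_uniq mc.
have mE := single_path um m0 hm; set y := hd m in mE wy aw.
have yR : y \in R by rewrite (cover2_mem _ mc) head_mem ?orbT.
have hy1 : ~~ e (hd q) y by apply: (ends_not_adj r_min mc mm).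
have hz1 : ~~ e (lt q) y by apply: (ends_not_adj r_min mc mm).
have y1y : hd q != y by apply: (ends_neq mc mm).
have z1y : lt q != y by apply: (ends_neq mc mm).
have [hq|hq] := eqVneq (hd q) (lt q).
  have qE := single_path uq q0 hq.
  have RE x : (x \in R) = (x == hd q) || (x == y).
    by rewrite (cover2_mem _ mc) qE mE !inE.
  have [b bR] := nbr_in_R yR; move: bR; rewrite RE => /orP[] /eqP-> => [|/[!e_irr]//].
  by rewrite e_sym (negbTE hy1).
have /existsP[w' aw'] : arc (lt q) y.
  have /orP[//|/existsP[w' aw']] := ends_arc r_min mc mm (end_lt q) (end_hd m).
  have mcr : cover2 m (rev q) by apply/cover2_swap/min_rev.
  have := @two_target m (rev q) w' mcr; rewrite head_rev last_rev => /(_ aw') hq'.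
  by rewrite hq' eqxx in hq.
have [w'N w'z1 w'y _] := arc_viaP aw'.
have [b bR yb] := nbr_in_R yR.
have bq : b \in q.
  move: bR; rewrite (cover2_mem _ mc) mE inE => /orP[//|/eqP bE].
  by rewrite bE e_irr in yb.
have nz1y1 : ~~ e (lt q) (hd q).
  apply/negP => ez; have sq := cover_sorted cv (mem_head _ _).
  case/splitPr: bq => B1 B2 in mc' ez sq {mc cv cv' qq q0 aw wy1 uq hy1 hz1 y1y z1y hq aw' w'z1}.
  have sX : sorted e (b :: B2 ++ B1).
    apply: rot_sorted sq _; case: (B1) ez => [|x B] //=.
    by rewrite last_cat /= => ->.
  have pX : perm_eq (m ++ b :: B2 ++ B1) (m ++ (B1 ++ b :: B2)).
    by rewrite perm_cat2l -cat_cons perm_catC.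
  have /negP := min_not_merge r_min mc' pX; apply.
  by rewrite mE /= yb; exact: sX.
suff gen p n : cover [:: p; m] -> hd p != y -> lt p != y -> ~~ e (hd p) y ->
    arc (hd p) (lt p) -> n \in N -> e n (lt p) -> ~~ e n y -> False.
  have /orP[a|a] : arc (hd q) (lt q) || arc (lt q) (hd q).
  - apply: arc_total => //; last by rewrite e_sym.
      by rewrite (cover2_mem _ mc) head_mem.
    by rewrite (cover2_mem _ mc) last_mem.
  - exact: (gen q w').
  - by apply: (gen (rev q) w); rewrite ?head_rev ?last_rev //; apply: cover_rev.
move=> cp hp lp nhp /existsP[w0 aw0] nN nl nny.
have [w0N w0h _ h0] := arc_viaP aw0.
have w0y : e w0 y by apply: h0 => //; rewrite eq_sym.
have nw0 : n != w0 by apply: contraNneq nny => ->.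
have := @two_link (rev p) m w0 n (cover_rev cp) w0N.
rewrite last_rev head_rev e_sym w0h nl => /(_ isT w0y nN nw0).
by [].
Qed.

End TwoPaths.

(** The linked path alternates paths and links: [q], [ws 0], the first path of [b], [ws 1], and so
    on. Then [end_not_adj] applies to it. *)
Lemma weave q b ws n : cover (q :: b) ->
    (forall i, i < size b -> [/\ ws i \in N, e (ws i) (hd (nth [::] b i))
                               & e (ws i) (lt (nth [::] (q :: b) i))]) ->
    uniq (mkseq ws (size b)) -> n \in N -> n \notin mkseq ws (size b) ->
  ~~ e n (hd q) && ~~ e n (lt (last q b)).
Proof.
move=> cv link uws nN nws; pose f i := ws i :: nth [::] b i.
pose X k := q ++ flatten (mkseq f k).
have XS k : X k.+1 = X k ++ ws k :: nth [::] b k.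
  by rewrite /X -[k.+1]addn1 /mkseq iotaD map_cat flatten_cat /= cats0 catA.
have b0 i : i < size b -> ~~ nilp (nth [::] b i).
  by move=> ib; apply: cover_neq0 cv _; rewrite inE mem_nth ?orbT.
have q0 : ~~ nilp q := cover_neq0 cv (mem_head _ _).
have ltX k : k <= size b -> lt (X k) = lt (nth [::] (q :: b) k).
  case: k => [|k] kb; first by rewrite /X /= cats0.
  by rewrite XS last_cat /=; case: (nth [::] b k) (b0 k kb).
have X0 k : ~~ nilp (X k) by rewrite /X; case: (q) q0.
have sX k : k <= size b -> sorted e (X k).
  elim: k => [|k IH] kb; first by rewrite /X /= cats0; apply: cover_sorted cv (mem_head _ _).
  have [wN wh wl] := link k kb.
  rewrite XS (sorted_cat e x0) // IH 1?ltnW // ltX 1?ltnW //= e_sym wl /=.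
  have : sorted e (nth [::] b k) by apply: cover_sorted cv _; rewrite inE mem_nth ?orbT.
  by case: (nth [::] b k) (b0 k kb) wh => //= y m _ ->.
have pf k : perm_eq (flatten (mkseq f k)) (mkseq ws k ++ flatten (mkseq (nth [::] b) k)).
  elim: k => // k IH; rewrite -[k.+1]addn1 /mkseq !iotaD !map_cat !flatten_cat /= !cats0.
  rewrite -!/(mkseq _ _) -(cat1s (ws k)) (catA _ [:: ws k]) -catA.
  rewrite perm_sym -catA perm_sym [perm_eq _ _](_ : _ = true) //.
  apply: perm_trans (perm_cat IH (perm_refl _)) _.
  by rewrite -catA perm_cat2l /= -cat1s perm_catCA.
have pX : perm_eq (X (size b)) (mkseq ws (size b) ++ flatten (q :: b)).
  rewrite /X; apply: perm_trans (perm_cat (perm_refl _) (pf _)) _.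
  by rewrite mkseq_nth perm_catCA.
have [_ _ u m] := cv.
have wsN x : x \in mkseq ws (size b) -> x \in N.
  by move=> /mapP[i]; rewrite mem_iota => /link[wN _ _] ->.
have -> : hd q = hd (X (size b)) by rewrite /X; case: (q) q0.
have -> : lt (last q b) = lt (X (size b)).
  by rewrite ltX //; congr (last x0 _); apply: (esym (nth_last [::] (q :: b))).
apply: end_not_adj => //; first exact: sX.
- rewrite (perm_uniq pX) cat_uniq uws u andbT /=; apply/hasPn => x; rewrite m => xR.
  by apply/negP => /wsN/not_NR; apply.
- by move=> x xR; rewrite (perm_mem pX) mem_cat m xR orbT.
- by move=> x; rewrite (perm_mem pX) mem_cat m inE => /orP[/wsN->|->]; rewrite ?orbT.
- rewrite (perm_mem pX) mem_cat negb_or nws m; apply/negP; exact: not_NR.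
Qed.

(** * Minimum covers with at least three paths *)

Section ManyPaths.
Variable k : nat.
Hypothesis k_gt1 : 1 < k.
Hypothesis r_min : forall qs, cover qs -> k.+1 <= size qs.
Implicit Types (n v : T) (rest : seq (seq T)).

Local Notation mcover := (min_cover k.+1).
Local Notation "c `_ i" := (nth [::] c i).

(** The order is cyclic: the linked path starts with path number [k] and continues with 0 up to
    [k.-1], with [ws i] just before path [i]. A witness that misses the head of path [i.+1] fits
    exactly there. *)
Lemma weave_nth c ws n : mcover c ->
    (forall i, i < k -> [/\ ws i \in N, e (ws i) (hd c`_i)
        & e (ws i) (lt c`_(if i is j.+1 then j else k))]) ->
    uniq (mkseq ws k) -> n \in N -> n \notin mkseq ws k ->
  ~~ e n (hd c`_k) && ~~ e n (lt c`_k.-1).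
Proof.
case=> cv sc; case/lastP: c sc cv => // b q; rewrite size_rcons => -[sb] cv link uws nN nws.
have kE : (rcons b q)`_k = q by rewrite nth_rcons sb ltnn eqxx.
have iE i : i < k -> (rcons b q)`_i = b`_i by rewrite nth_rcons sb => ->.
have lE : (rcons b q)`_k.-1 = last q b.
  by rewrite iE ?prednK ?(ltnW k_gt1) // -sb nth_last; case: (b) sb k_gt1 => [<-|].
rewrite kE lE; apply: (@weave q b ws) => //; rewrite ?sb //.
  by apply: cover_perm cv; rewrite perm_rcons.
move=> i ik; have [wN wh wl] := link i ik; split=> //; first by rewrite -iE.
by case: i ik wl {wh wN} => [|i] ik /=; rewrite ?kE // iE // ltnW.
Qed.

Lemma mem_via_end c q m w x y u : mcover c -> q \in c -> m \in c -> m != q ->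
  is_end q x -> is_end m u -> arc_via w x y -> u != y -> e w u.
Proof.
move=> mc qc mmc mq; apply: (arc_via_end r_min (min_perm (perm_to_rem qc) mc)).
by rewrite mem_rem_uniq ?inE ?mq //; apply: cover_uniq; case: mc.
Qed.

Lemma mem_ends_neq c q m x y : mcover c -> q \in c -> m \in c -> m != q ->
  is_end q x -> is_end m y -> x != y.
Proof.
move=> mc qc mmc mq; apply: (ends_neq (min_perm (perm_to_rem qc) mc)).
by rewrite mem_rem_uniq ?inE ?mq //; apply: cover_uniq; case: mc.
Qed.

Lemma mem_ends_arc c q m x y : mcover c -> q \in c -> m \in c -> m != q ->
  is_end q x -> is_end m y -> arc x y || arc y x.
Proof.
move=> mc qc mmc mq; apply: (ends_arc r_min (min_perm (perm_to_rem qc) mc)).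
by rewrite mem_rem_uniq ?inE ?mq //; apply: cover_uniq; case: mc.
Qed.

Lemma nth_mem c i : mcover c -> i <= k -> c`_i \in c.
Proof. by case=> _ sc ik; rewrite mem_nth // sc. Qed.

Lemma nth_neq c i j : mcover c -> i <= k -> j <= k -> i != j -> c`_i != c`_j.
Proof. by case=> cv sc ik jk ij; rewrite nth_uniq ?sc //; apply: cover_uniq. Qed.

Definition wit x y := odflt x [pick w | arc_via w x y].

Lemma witP x y : arc x y -> arc_via (wit x y) x y.
Proof. by rewrite /wit; case: pickP => // n0 /existsP[w]; rewrite n0. Qed.

Lemma uniq_missed c (ws : nat -> T) :
  (forall i, i < k -> ~~ e (ws i) (hd c`_i.+1)) ->
  (forall i j, i < k -> j < k -> i != j -> e (ws j) (hd c`_i.+1)) ->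
  uniq (mkseq ws k).
Proof.
move=> miss hit; rewrite map_inj_in_uniq ?iota_uniq // => i j; rewrite !mem_iota => ik jk wij.
by apply/eqP/negPn/negP => ij; have := miss i ik; rewrite wij (hit i j).
Qed.

Definition chain c := forall i, i < k -> arc (hd c`_i) (hd c`_i.+1).

(** All witnesses of the chain see the head of path 0, so [n] is not among them and is left over
    when they are used as links. *)
Lemma chain_end c n : mcover c -> chain c -> n \in N -> ~~ e n (hd c`_0) ->
  ~~ e n (hd c`_k) && ~~ e n (lt c`_k.-1).
Proof.
move=> mc ch nN n0; pose ws i := wit (hd c`_i) (hd c`_i.+1).
have wv i : i < k -> arc_via (ws i) (hd c`_i) (hd c`_i.+1) by move=> ik; apply/witP/ch.
have k0 : 0 < k by apply: ltnW.
have hit i j u : i <= k -> j < k -> i != j -> is_end c`_i u -> u != hd c`_j.+1 -> e (ws j) u.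
  move=> ik jk ij eu un; apply: (mem_via_end mc _ _ _ (end_hd _) eu (wv j jk) un);
  by rewrite ?nth_mem ?nth_neq // ltnW.
have neq i j u u' : i <= k -> j <= k -> i != j -> is_end c`_i u -> is_end c`_j u' -> u != u'.
  by move=> ik jk ij; apply: (mem_ends_neq mc); rewrite ?nth_mem // nth_neq // eq_sym.
apply: (@weave_nth c ws) => //.
- move=> i ik; have [wN wh _ _] := arc_viaP (wv i ik); split=> //.
  case: i ik wh wN => [|i] ik _ _.
    by apply: (hit k 0); rewrite ?end_lt // 1?gtn_eqF //; apply: (neq k 1); rewrite ?end_lt ?end_hd // gtn_eqF.
  apply: (hit i); rewrite ?end_lt ?(ltnW (ltnW ik)) ?ltn_eqF //.
  by apply: (neq i i.+2); rewrite ?end_lt ?end_hd ?(ltnW (ltnW ik)) // ltn_eqF // ltnW.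
- apply: (@uniq_missed c) => [i ik|i j ik jk ij]; first by have [] := arc_viaP (wv i ik).
  have [ji|ji] := eqVneq j i.+1.
    by have [_ h _ _] := arc_viaP (wv j jk); rewrite ji in h *.
  apply: (hit i.+1 j) => //; first by rewrite eq_sym.
  by apply: (neq i.+1 j.+1).
apply/negP => /mapP[i]; rewrite mem_iota => /= ik nw; move: n0; rewrite nw.
case: i ik {nw} => [|i] ik; first by have [_ -> _ _] := arc_viaP (wv 0 ik).
rewrite (hit 0) ?end_hd //.
by apply: (neq 0 i.+2); rewrite ?end_hd.
Qed.

(** A tournament has a hamiltonian path. Its first vertex is a source here: the witness of an arc
    into it would miss its head but see the head of the last path, against [chain_end]. *)
Lemma chain_exists c : mcover c -> exists c', [/\ perm_eq c c', chain c' &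
  forall q, q \in c' -> q != c'`_0 -> ~~ arc (hd q) (hd c'`_0)].
Proof.
move=> mc; pose leR q m := (q == m) || arc (hd q) (hd m); pose c' := sort leR c.
have pc : perm_eq c c' by rewrite perm_sym perm_sort.
have mc' : mcover c' := min_perm pc mc.
have sc : sorted leR c'.
  (* Totality of [leR] is enough for sorting; the tournament need not be transitive. *)
  apply: (@sort_sorted_in _ (mem c)); last by apply/allP.
  move=> q m qc mmc; rewrite /leR; have [//|qm] := eqVneq q m.
  by apply: (mem_ends_arc mc qc mmc); rewrite // eq_sym.
have ch : chain c'.
  move=> i ik; move/(sortedP [::])/(_ i): sc; have [_ -> //] := mc'.
  move/(_ ik)/orP => [h|//].
  by have := nth_neq mc' (ltnW ik) ik (negbT (ltn_eqF (ltnSn i))); rewrite h.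
exists c'; split=> // q qc q0; apply/negP => /existsP[w aw].
have [wN wq wh _] := arc_viaP aw.
have c0 : c'`_0 \in c' by apply: nth_mem.
have ck : c'`_k \in c' by apply: nth_mem.
have k0 : c'`_k != c'`_0 by apply: nth_neq => //; rewrite gtn_eqF // ltnW.
have /andP[/negP h _] := chain_end mc' ch wN wh; apply: h.
have [->|kq] := eqVneq c'`_k q; first exact: wq.
apply: (mem_via_end mc' qc ck kq (end_hd _) (end_hd _) aw).
by rewrite eq_sym; apply: (mem_ends_neq mc' c0 ck k0); rewrite end_hd.
Qed.

(* By [ends_arc] the head of [q] then reaches the heads of all the other paths. *)
Definition source q rest : Prop :=
  mcover (q :: rest) /\ forall m, m \in rest -> ~~ arc (hd m) (hd q).

Lemma source_perm q rest rest' : perm_eq rest rest' -> source q rest -> source q rest'.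
Proof.
move=> pr [mc h]; split; first by apply: min_perm mc; rewrite perm_cons.
by move=> m; rewrite -(perm_mem pr); apply: h.
Qed.

Lemma source_notin q rest : mcover (q :: rest) -> q \notin rest.
Proof. by case=> /cover_uniq /= /andP[]. Qed.

Lemma source_arc q rest m : source q rest -> m \in rest -> arc (hd q) (hd m).
Proof.
move=> [mc h] mr; have mq : m != q by apply: contraTneq mr => ->; apply: source_notin mc.
have qc := mem_head q rest; have mmc : m \in q :: rest by rewrite inE mr orbT.
have := mem_ends_arc mc qc mmc mq (end_hd q) (end_hd m).
by rewrite (negbTE (h m mr)) orbF.
Qed.

Lemma source_exists c : mcover c -> exists q rest, perm_eq c (q :: rest) /\ source q rest.
Proof.
move=> mc; have [c' [pc ch h]] := chain_exists mc; have mc' := min_perm pc mc.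
case: c' pc h mc' {ch} => [|q rest] pc h mc'; first by case: mc'.
exists q, rest; split=> //; split=> // m mr; apply: h; rewrite ?inE ?mr ?orbT //.
by apply: contraTneq mr => /= ->; apply: source_notin mc'.
Qed.

(** If after the reversal another path came first in the chain, the witness of the arc from [hd q]
    to its head would see all other ends in [rest]. By [chain_end] it misses an end of each of the
    last two paths, and one of these is not [rev q]. *)
Lemma source_rev q rest : source q rest -> source (rev q) rest.
Proof.
move=> sq; have [mc hq] := sq; have mcr := min_rev mc.
have [c [pc ch h]] := chain_exists mcr; have mc' := min_perm pc mcr.
have memc m : (m \in c) = (m == rev q) || (m \in rest) by rewrite -(perm_mem pc) inE.
have c0 : c`_0 \in c by apply: nth_mem.
have rqn : rev q \notin rest := source_notin mcr.
move: (c0); rewrite memc => /orP[/eqP c0E|c0r].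
  split=> // m mr; rewrite -c0E; apply: h; first by rewrite memc mr orbT.
  by rewrite c0E; apply: contraTneq mr => ->.
have /existsP[v av] := source_arc sq c0r; have [vN _ v0 _] := arc_viaP av.
have /andP[/negP hk /negP hk1] := chain_end mc' ch vN v0.
have hit m u : m \in rest -> is_end m u -> u != hd c`_0 -> e v u.
  move=> mr eu un; apply: (mem_via_end mc (mem_head _ _) _ _ (end_hd q) eu av un).
    by rewrite inE mr orbT.
  by apply: contraTneq mr => ->; apply: source_notin mc.
have neq i u : 0 < i <= k -> is_end c`_i u -> u != hd c`_0.
  move=> /andP[i0 ik] eu; rewrite eq_sym.
  by apply: (mem_ends_neq mc' c0 _ _ (end_hd _) eu); rewrite ?nth_mem ?nth_neq // gtn_eqF.
have /orP[/eqP ck|ck] : (c`_k == rev q) || (c`_k \in rest) by rewrite -memc nth_mem.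
  apply: False_ind; apply: hk1.
  have k1 : k.-1 <= k by apply: leq_pred.
  have /orP[/eqP ck1|ck1] : (c`_k.-1 == rev q) || (c`_k.-1 \in rest) by rewrite -memc nth_mem.
    by have := @nth_neq c k.-1 k mc' k1 (leqnn _); rewrite ck1 ck eqxx => /(_ (ltac:(lia))).
  apply: (hit _ _ ck1 (end_lt _)); apply: (neq k.-1 _ _ (end_lt _)).
  by rewrite k1 andbT -subn1 subn_gt0.
apply: False_ind; apply: hk; apply: (hit _ _ ck (end_hd _)).
by apply: (neq k); rewrite ?end_hd // leqnn ltnW.
Qed.

(** The new cover has some source. A path of [rest] is excluded by the arc from [q], and [rev m] is
    excluded because reversing it back would make [m] a source beside [q]. *)
Lemma source_rev_rest q m rest : source q (m :: rest) -> source q (rev m :: rest).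
Proof.
move=> sq; have [mc hq] := sq.
have p1 : perm_eq (m :: q :: rest) (q :: m :: rest).
  by apply/permPl; apply: (perm_catCA [:: m] [:: q] rest).
have p2 : perm_eq (rev m :: q :: rest) (q :: rev m :: rest).
  by apply/permPl; apply: (perm_catCA [:: rev m] [:: q] rest).
have mcr : mcover (q :: rev m :: rest).
  by apply: (min_perm p2); apply: min_rev; apply: min_perm mc; rewrite perm_sym.
split=> // p; rewrite inE => /orP[/eqP->|pr]; last by apply: hq; rewrite inE pr orbT.
apply/negP => am; have [s [rest' [ps ss]]] := source_exists mcr.
have [mcs hs] := ss.
have sin : s \in q :: rev m :: rest by rewrite (perm_mem ps) mem_head.
have other p' : p' \in q :: rev m :: rest -> p' != s -> ~~ arc (hd p') (hd s).
  by move=> h1 h2; apply: hs; move: h1; rewrite (perm_mem ps) inE (negbTE h2).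
move: (sin); rewrite !inE => /or3P[/eqP sE|/eqP sE|sr].
- move: am; apply/negP; rewrite -sE; apply: other; first by rewrite !inE eqxx orbT.
  by rewrite sE; apply: contraTneq sin => mq; have := source_notin mcr; rewrite -mq mem_head.
- have sm : source m (q :: rest).
    rewrite -(revK m); apply: source_rev; apply: (@source_perm _ rest').
      rewrite -(perm_cons (rev m)) perm_sym -{2}sE; exact: perm_trans ps.
    by rewrite -sE.
  have [_ /(_ q (mem_head _ _))/negP] := sm; apply; apply: source_arc sq _.
  by rewrite mem_head.
- have qs : q != s.
    by apply: contraTneq sr => <-; have := source_notin mcr; rewrite inE negb_or => /andP[].
  have /negP := other q (mem_head _ _) qs; apply.
  by apply: source_arc sq _; rewrite inE sr orbT.
Qed.

(** Otherwise the witnesses of the arcs from [q] to the other heads, [v] among them, link all the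
    paths, and [n] is left over but sees the head of the outermost path. *)
Lemma source_missed q rest v n : source q rest -> arc_via v (hd q) (hd rest`_0) ->
  n \in N -> {in behead rest, forall m, e n (hd m)} -> n = v.
Proof.
move=> sq av nN hn; apply/eqP/negPn/negP => nv.
have [mc hq] := sq; have sr := source_rev sq; pose c := q :: rest.
have sc : size rest = k by case: mc => _ [].
have cE i : c`_i.+1 = rest`_i by [].
have restm i : i < k -> rest`_i \in rest by move=> ik; rewrite mem_nth ?sc.
(* Link number 1 follows [q] and must see its last vertex, so it is taken from an arc that starts
   there, which [source_rev] provides. *)
pose src i := if i == 1 then lt q else hd q.
pose ws i := if i == 0 then v else wit (src i) (hd c`_i.+1).
have srcE i : is_end q (src i) by rewrite /src; case: ifP.
have wv i : i < k -> arc_via (ws i) (src i) (hd c`_i.+1).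
  case: i => [|i] ik //; apply: witP; rewrite /src; case: ifP => _.
    by rewrite -(head_rev x0); apply: (source_arc sr); exact: (restm _ ik).
  by apply: (source_arc sq); exact: (restm _ ik).
have neq i j u u' : i <= k -> j <= k -> i != j -> is_end c`_i u -> is_end c`_j u' -> u != u'.
  by move=> ik jk ij; apply: (mem_ends_neq mc); rewrite ?nth_mem // nth_neq // eq_sym.
have hit i j u : 0 < i <= k -> j < k -> i != j.+1 -> is_end c`_i u -> e (ws j) u.
  move=> /andP[i0 ik] jk ij eu.
  have un : u != hd c`_j.+1 by apply: (neq i j.+1).
  apply: (mem_via_end mc (mem_head _ _) _ _ (srcE j) eu (wv j jk) un).
    exact: nth_mem.
  by rewrite (@nth_neq _ i 0 mc) // gtn_eqF.
have k0 : 0 < k := ltnW k_gt1.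
have links i : i < k -> [/\ ws i \in N, e (ws i) (hd c`_i)
      & e (ws i) (lt c`_(if i is j.+1 then j else k))].
  move=> ik; have [wN ws_src _ _] := arc_viaP (wv i ik); split=> //.
    case: i ik wN ws_src => [|i] ik wN ws_src; first exact: ws_src.
    by apply: (hit i.+1) => //; lia.
  case: i ik wN ws_src => [|[|i]] ik wN ws_src; [|exact: ws_src|].
    by apply: (hit k) => //; lia.
  by apply: (hit i.+1) => //; lia.
have uws : uniq (mkseq ws k).
  apply: (@uniq_missed c) => [i ik|i j ik jk ij]; first by have [] := arc_viaP (wv i ik).
  by apply: (hit i.+1).
have nws : n \notin mkseq ws k.
  apply/negP => /mapP[[|i]]; rewrite mem_iota => /= ik nw.
    by rewrite nw eqxx in nv.
  have [_ _ /negP h _] := arc_viaP (wv i.+1 ik); apply: h; rewrite -nw; apply: hn.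
  by rewrite cE -nth_behead mem_nth // size_behead sc; case: (k) ik.
have /andP[/negP h _] := weave_nth mc links uws nN nws; apply: h; apply: hn.
rewrite -(prednK k0) cE; case: (k) sc k_gt1 => [|[|k']] sc _ //=.
by rewrite -nth_behead mem_nth // size_behead sc.
Qed.

Lemma source_no_common q rest n : source q rest -> n \in N ->
  {in rest, forall m, e n (hd m)} -> False.
Proof.
move=> sq nN hn; have [mc _] := sq; have sc : size rest = k by case: mc => _ [].
have r0 : rest`_0 \in rest by rewrite mem_nth // sc ltnW.
have /existsP[v av] := source_arc sq r0.
have nv := source_missed sq av nN (fun m mr => hn m (mem_behead mr)).
by have [_ _ /negP h _] := arc_viaP av; apply: h; rewrite -nv; apply: hn.
Qed.

(** If [m] had two ends, the witness of the arc from [hd q] to [lt m] would see the heads of all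
    paths other than [q], against [source_no_common]. *)
Lemma source_single q m rest : source q (m :: rest) -> hd m = lt m.
Proof.
move=> sq; apply/eqP/negPn/negP => hl; have [mc _] := sq.
have sr := source_rev_rest sq; have /existsP[w aw] := source_arc sr (mem_head _ _).
rewrite head_rev in aw; have [wN _ _ _] := arc_viaP aw.
apply: (source_no_common sq wN) => p; rewrite inE => pr.
have pc : p \in q :: m :: rest by rewrite !inE pr orbT.
have pq : p != q.
  by apply: contraTneq pr => ->; have := source_notin mc; rewrite inE.
apply: (mem_via_end mc (mem_head _ _) pc pq (end_hd q) (end_hd p) aw).
have [->|pm] := eqVneq p m; first exact: hl.
rewrite eq_sym; apply: (mem_ends_neq mc _ pc pm (end_lt m) (end_hd p)).
by rewrite !inE eqxx orbT.
Qed.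

(** All paths but the source [q] are single vertices. A vertex [z] missed by two suitable witnesses
    lies inside [q], and cutting [q] there produces another minimum cover that violates this
    structure. *)
Lemma many_paths_false c : mcover c -> False.
Proof.
move=> mc; have [q [rest [_ sq]]] := source_exists mc; have [mcq _] := sq.
have : size rest = k by case: mcq => _ [].
case: rest sq mcq => [|m2 [|m3 rest]] sq mcq sz; try by move: k_gt1; rewrite -sz.
wlog /existsP[w aw] : m2 m3 sq mcq sz / arc (hd m2) (hd m3).
  move=> gen; have m3c : m3 \in [:: q, m2, m3 & rest] by rewrite !inE eqxx !orbT.
  have m2c : m2 \in [:: q, m2, m3 & rest] by rewrite !inE eqxx !orbT.
  have m32 : m3 != m2.
    by have [/cover_uniq /= /and3P[_ + _] _] := mcq; rewrite inE negb_or eq_sym => /andP[].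
  have p23 : perm_eq [:: m2, m3 & rest] [:: m3, m2 & rest].
    by apply/permPl; apply: (perm_catCA [:: m2] [:: m3] rest).
  have /orP[a|a] := mem_ends_arc mcq m2c m3c m32 (end_hd _) (end_hd _).
    exact: (gen m2 m3).
  apply: (gen m3 m2) => //; first exact: source_perm sq.
  by apply: min_perm mcq; rewrite perm_cons.
have [cv _] := mcq; have /= /and3P[qn m2n _] := cover_uniq cv.
have p32 : perm_eq [:: m2, m3 & rest] [:: m3, m2 & rest].
  by apply/permPl; apply: (perm_catCA [:: m2] [:: m3] rest).
have sq3 : source q [:: m3, m2 & rest] := source_perm p32 sq.
have m3c : m3 \in [:: q, m2, m3 & rest] by rewrite !inE eqxx !orbT.
have m2c : m2 \in [:: q, m2, m3 & rest] by rewrite !inE eqxx !orbT.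
have qc := mem_head q [:: m2, m3 & rest].
have neq p p' : p \in [:: q, m2, m3 & rest] -> p' \in [:: q, m2, m3 & rest] ->
    p != p' -> hd p != hd p'.
  by move=> h1 h2 pp; apply: (mem_ends_neq mcq h1 h2) => //; rewrite ?end_hd // eq_sym.
have m23 : m2 != m3 by move: m2n; rewrite inE negb_or => /andP[].
have [wN w2 w3 hw] := arc_viaP aw.
have whit p : p \in [:: q, m2, m3 & rest] -> p != m3 -> p != m2 -> e w (hd p).
  move=> pc p3 p2; apply: (mem_via_end mcq m2c pc p2 (end_hd _) (end_hd _) aw).
  exact: neq.
have /existsP[v2 a2] := source_arc sq (mem_head _ _).
have [v2N v2q v2m h2] := arc_viaP a2.
(* [w] sees every head in the rest except that of [m3], so by [source_missed] it is also the witness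
   of the arc from [q] to [m3]. *)
have a3 : arc_via w (hd q) (hd m3).
  have /existsP[v3 a3] := source_arc sq3 (mem_head _ _).
  rewrite (_ : w = v3) //; apply: (source_missed sq3 a3 wN) => p /= pr.
  have [->//|p2] := eqVneq p m2; apply: whit => //.
    by move: pr; rewrite !inE (negbTE p2) /= => ->; rewrite !orbT.
  move: pr; rewrite inE (negbTE p2) /= => pr; apply: contraTneq pr => ->.
  by have [/cover_uniq /= /and4P[]] := mcq.
have [_ wq _ h3] := arc_viaP a3.
have v2hit p : p \in [:: q, m2, m3 & rest] -> p != q -> p != m2 -> e v2 (hd p).
  move=> pc pq p2; apply: (mem_via_end mcq qc pc pq (end_hd _) (end_hd _) a2).
  exact: neq.
have [z zR /andP[v2z wz]] := N_meet v2N wN.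
have zq : z != hd q by apply: contraNneq v2z => ->.
have z2 : z != hd m2 by apply: contraNneq wz => ->.
have z3 : z != hd m3.
  apply: contraNneq v2z => ->; apply: v2hit => //; last by rewrite eq_sym.
  by apply: contraNneq qn => <-; rewrite !inE eqxx orbT.
have ezq : e (hd q) z by apply: contraNT v2z => nz; apply: h2.
have ez2 : e (hd m2) z by apply: contraNT wz => nz; apply: hw.
have single p : p \in [:: m2, m3 & rest] -> p = [:: hd p].
  move=> pr; have pc : p \in [:: q, m2, m3 & rest] by rewrite inE pr orbT.
  apply: single_path; first 2 last.
  - by apply: (@source_single q p (rem p [:: m2, m3 & rest])); apply: source_perm sq; apply: perm_to_rem.
  - have [_ _ + _] := cv; elim: (q :: _) pc => //= a l IH; rewrite inE cat_uniq => /orP[/eqP->|pl] /and3P[u1 _ u2] //.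
    exact: IH.
  - exact: cover_neq0 cv pc.
have zq' : z \in q.
  have : z \in flatten [:: q, m2, m3 & rest] by case: cv => _ _ _ ->.
  case/flattenP => p; rewrite inE => /orP[/eqP-> //|pr] zp.
  have pc : p \in [:: q, m2, m3 & rest] by rewrite inE pr orbT.
  have zE : z = hd p by move: zp; rewrite (single p pr) inE => /eqP.
  have /negP := v2z; case; rewrite zE; apply: v2hit => //.
    by apply: contraTneq pr => ->.
  by apply: contraNneq z2 => <-; rewrite zE.
have sm2 := single m2 (mem_head _ _).
case/splitPr: zq' sq mcq a2 zq ezq cv v2q {sq3 qn m3c m2c qc neq whit a3 wq h3 v2hit h2} =>
  A B sq mcq a2 zq ezq cv v2q.
have A0 : ~~ nilp A by apply: contraNN zq => /nilP->.
have hA : hd (A ++ z :: B) = hd A by case: (A) A0.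
rewrite hA in a2 zq ezq v2q.
(* The final piece of [q] is moved to [m2], which is adjacent to [z]. The new path is no source,
   because [v2] still gives an arc from [A] to it, and it has too many vertices for a non-source. *)
pose c' := [:: A, m2 ++ z :: B, m3 & rest].
have mc' : mcover c'.
  have [_ szc] := mcq; split; last by rewrite -szc.
  have [sc n0 u mm] := cv.
  have pf : perm_eq (flatten c') (flatten [:: A ++ z :: B, m2, m3 & rest]).
    by rewrite /c' /= -!catA perm_cat2l perm_catCA.
  move: (sc) => /= /and4P[sAB _ s3 sr].
  move: sAB; rewrite (sorted_cat e x0) // => /and3P[sA _ sB].
  split.
  - by rewrite /c' /= sA s3 sr sm2 /= ez2 andbT.
  - move: n0; rewrite /c' !inE !negb_or => /and4P[_ _ -> ->]; rewrite !andbT.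
    by rewrite sm2; case: (A) A0.
  - by rewrite (perm_uniq pf).
  - by move=> x; rewrite (perm_mem pf) mm.
have [s [rest' [ps ss]]] := source_exists mc'; have [_ hs] := ss.
have min' : m2 ++ z :: B \in c' by rewrite !inE eqxx orbT.
have Ain' : A \in c' by rewrite mem_head.
have [sE|sn] := eqVneq (m2 ++ z :: B) s.
  have As : A \in rest'.
    have : A \in s :: rest' by rewrite -(perm_mem ps).
    rewrite inE -sE => /orP[/eqP AE|//]; have [/cover_uniq] := mc'.
    by rewrite /c' /= inE {1}AE eqxx.
  have /negP := hs A As; apply; rewrite -sE {1}sm2 /=; apply/existsP; exists v2.
  exact: a2.
have sin : m2 ++ z :: B \in rest'.
  by have : m2 ++ z :: B \in s :: rest'; [rewrite -(perm_mem ps) | rewrite inE (negbTE sn)].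
have := source_single (source_perm (perm_to_rem sin) ss).
rewrite last_cat sm2 /= => hl.
apply: (@cover_disj _ _ m2 (hd m2) cv); rewrite ?mem_head //.
  by rewrite mem_cat hl mem_last orbT.
by rewrite {2}sm2 mem_head.
Qed.

End ManyPaths.

Lemma cover_false c : cover c -> False.
Proof.
have [n] := ubnP (size c); elim: n c => // n IH c sz cv.
have r_min c' : cover c' -> size c <= size c'.
  by move=> cv'; rewrite leqNgt; apply/negP => lt; apply: (IH c') => //; lia.
case: c {sz} cv r_min => [|q [|m [|m' c]]] cv r_min.
- by have [n' [v [_ + _]]] := NR_edge; case: cv => _ _ _ <-.
- exact: cover1_false cv.
- exact: (cover2_false r_min (conj cv (erefl _))).
- by apply: (@many_paths_false (size c).+2 _ r_min [:: q, m, m' & c]).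
Qed.

Lemma linkage_false : False.
Proof.
apply: (@cover_false [seq [:: y] | y <- enum R]).
have fl : flatten [seq [:: y] | y <- enum R] = enum R by apply: flatten_seq1.
split.
- by apply/allP => q /mapP[y _ ->].
- by apply/negP => /mapP[].
- by rewrite fl enum_uniq.
- by move=> x; rewrite fl mem_enum.
Qed.

End Linkage.

(** The length of the path is known, so its existence is a decidable statement about tuples. *)
Lemma traceable_dec (T : finType) (e : rel T) (N R : {set T}) (x0 : T) :
  (~ traceable_from_N e N R -> False) -> traceable_from_N e N R.
Proof.
move=> contra.
pose good (s : seq T) := [&& sorted e s, uniq s, head x0 s \in N, ~~ nilp s &
  [forall x, (x \in s) == (x \in N :|: R)]].
have [/existsP[s /and5P[ss us hs s0 /forallP ms]]|no] :=
  boolP [exists s : #|N :|: R|.-tuple T, good s].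
  case: (s : seq T) ss us hs s0 ms => //= n p pp up nN _ mp.
  by exists n, p; split=> // x; apply/eqP.
apply: False_ind; apply: contra => -[n [p [nN pp up mp]]].
have sz : size (n :: p) == #|N :|: R|.
  by rewrite -(card_uniqP up); apply/eqP/eq_card => x; rewrite mp.
have /negP := no; apply; apply/existsP; exists (Tuple sz).
apply/and5P; split=> //; apply/forallP => x; apply/eqP; exact: mp.
Qed.

Section LinkageTheorem.
Variables (T : finType) (e : rel T) (N R : {set T}).
Hypothesis e_sym : symmetric e.
Hypothesis e_irr : irreflexive e.
Hypothesis NR : [disjoint N & R].
Hypothesis N_clique : {in N &, forall a b, a != b -> e a b}.
Hypothesis arc_total :
  {in R &, forall x y, x != y -> ~~ e x y -> arc e N R x y || arc e N R y x}.
Hypothesis N_meet :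
  {in N &, forall w w', exists2 r, r \in R & ~~ e w r && ~~ e w' r}.
Hypothesis no_simplicial : {in R, forall y, exists a b,
  [/\ a \in N :|: R, b \in N :|: R, e y a, e y b & (a != b) && ~~ e a b]}.
Hypothesis NR_edge : exists n r, [/\ n \in N, r \in R & e n r].

Lemma linkage : traceable_from_N e N R.
Proof.
have [x0 _] := NR_edge; apply: (traceable_dec x0) => nt.
exact: (@linkage_false _ e N R x0).
Qed.

End LinkageTheorem.

(** * Critical graphs with many cut vertices *)

Section Critical.
Variables (T : finType) (e : rel T) (k : nat).
Hypothesis e_sym : symmetric e.
Hypothesis e_irr : irreflexive e.
Hypothesis crit : gamma_c_critical k e.
Implicit Types (u v x y z c : T) (A D L S W : {set T}).

Let cg : connected_graph e. Proof. by case: crit. Qed.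

Lemma cd_set_ge D : cd_set e D -> k <= #|D|.
Proof. by move=> cD; case: crit => _ <- _; apply: gamma_c_le. Qed.

Lemma cd_set_add u v : u != v -> ~~ e u v ->
  exists2 D, cd_set (add_edge e u v) D & #|D| < k.
Proof.
move=> uv nuv; have [D cD sD] := gamma_c_min (connected_add_edge u v cg).
by exists D => //; rewrite sD; case: crit => _ _; apply.
Qed.

(** * Simplicial vertices are pairwise adjacent *)

Definition simplicial v := forall a b, e v a -> e v b -> a != b -> e a b.

(* The next three lemmas turn a CD-set [D] of [G + uv] into one of [G] that is
   not larger: drop the simplicial ones of [u], [v] that lie in [D] and
   reconnect with at most as many vertices. *)
Lemma cd_one_end u v D : simplicial u -> u != v -> ~~ e u v ->
    cd_set (add_edge e u v) D -> #|D| < k -> u \in D -> v \in D.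
Proof.
move=> su uv nuv /cd_setP[dom con] Dk uD; apply/negPn/negP => vD.
have conD : connected_in e D.
  apply: connected_in_sub con => x y xD yD /add_edgeP[//|[_ yv]|[xv _]].
    by rewrite -yv yD in vD.
  by rewrite -xv xD in vD.
have domD x : x \notin D -> x != v -> exists2 y, y \in D & e x y.
  move=> xD xv; have [y yD /add_edgeP[xy|[xu _]|[xv' _]]] := dom x xD.
  - by exists y.
  - by rewrite xu uD in xD.
  - by rewrite xv' eqxx in xv.
have [w vw] : exists w, e v w.
  have [|a [b [_ /set1P-> _ _ vb]]] := connected_in_cross cg (in_setT v) (set11 v) (in_setT u).
    by rewrite inE.
  by exists b.
have wD : w \notin D.
  apply/negP => wD; have : cd_set e D.
    apply/cd_setP; split=> // x xD; have [->|xv] := eqVneq x v; first by exists w.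
    exact: domD.
  by move/cd_set_ge; rewrite leqNgt Dk.
have wu : w != u by apply: contraNneq nuv => <-; rewrite e_sym.
have wv : w != v by apply: contraTneq vw => ->; rewrite e_irr.
(* [u] is exchanged for a neighbour [w] of [v]: this dominates [v], and as [u] is simplicial, a
   neighbour of [u] in [D] takes over its other duties. If [D] is just [u], then [w] alone
   suffices. *)
pose D0 := D :\ u.
have cD0 : connected_in e D0 by apply: connected_del => // a b _ _; apply: su.
suff : cd_set e (w |: D0).
  move/cd_set_ge; rewrite leqNgt; case/negP; apply: leq_ltn_trans _ Dk.
  by rewrite cardsU1 (cardsD1 u D) uD leq_add2r leq_b1.
have [D00|[d dD0]] := set_0Vmem D0.
  have DE x : x \in D -> x = u.
    by move=> xD; have := in_set0 x; rewrite -D00 !inE xD andbT => /negbFE/eqP.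
  rewrite D00 setU0; apply/cd_setP; split; last exact: connected_in1.
  have uw : e u w by have [d /DE-> ] := domD w wD wv; rewrite e_sym.
  move=> x; rewrite inE => xw; exists w; rewrite ?set11 //.
  have [->//|xv] := eqVneq x v; have [->//|xu] := eqVneq x u.
  have [d /DE-> xd] := domD x (contraNN (fun h => introT eqP (DE x h)) xu) xv.
  by apply: su => //; rewrite e_sym.
have uD0 : u \notin D0 by rewrite !inE eqxx.
have [d' d'D ud'] : exists2 d', d' \in D0 & e u d'.
  have [|| a [b [_ /set1P-> bD bu ub]]] := connected_in_cross conD uD (set11 u) (x := u) (y := d).
  - by case/setD1P: dD0.
  - by rewrite inE; case/setD1P: dD0.
  by exists b => //; rewrite !inE bD andbT; rewrite inE in bu.
have toD0 x y : y \in D -> e x y -> x \in D0 \/ exists2 y', y' \in D0 & e x y'.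
  move=> yD xy; have [yu|yu] := eqVneq y u; last by right; exists y; rewrite // !inE yu.
  rewrite yu e_sym in xy; have [->|xd] := eqVneq x d'; first by left.
  by right; exists d' => //; apply: su.
apply/cd_setP; split.
  move=> x; rewrite !inE negb_or negb_and negbK => /andP[xw].
  have [->|xv] := eqVneq x v; first by exists w; rewrite ?setU11.
  have [->|xu] /= := eqVneq x u; first by exists d'; rewrite // setU1r.
  move=> xD; have [y yD xy] := domD x xD xv.
  have [|[y' y'D xy']] := toD0 x y yD xy; first by rewrite !inE (negbTE xD) andbF.
  by exists y' => //; rewrite setU1r.
have [y yD wy] := domD w wD wv.
have [|[y' y'D wy']] := toD0 w y yD wy; first by rewrite !inE (negbTE wD) andbF.
by apply: (connectedU1 e_sym cD0 y'D); rewrite e_sym.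
Qed.

Lemma cd_two_ends u v D : simplicial u -> simplicial v -> u != v -> ~~ e u v ->
    cd_set (add_edge e u v) D -> #|D| < k -> u \in D -> v \in D ->
  exists2 a, a \in D & e u a.
Proof.
move=> su sv uv nuv /cd_setP[dom con] Dk uD vD.
have [/exists_inP[a aD ua]|no] := boolP [exists a in D, e u a]; first by exists a.
have {}no a : a \in D -> ~~ e u a by move=> aD; apply: contraNN no => ua; apply/exists_inP; exists a.
have fs := add_edge_sym u v e_sym.
pose D1 := D :\ u; pose D0 := D1 :\ v.
have cD1 : connected_in e D1.
  have : connected_in (add_edge e u v) D1.
    apply: connected_del => // a b aD bD /add_edgeP[ua|[_ av]|[/eqP/negPn]]; rewrite ?uv //.
      by have := no a aD; rewrite ua.
    move=> /add_edgeP[ub|[_ bv]|[/eqP/negPn]]; rewrite ?uv //.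
      by have := no b bD; rewrite ub.
    by rewrite av bv eqxx.
  apply: connected_in_sub => x y /setD1P[xu _] /setD1P[yu _] /add_edgeP[//|[xu' _]|[_ yu']].
    by rewrite xu' eqxx in xu.
  by rewrite yu' eqxx in yu.
have cD0 : connected_in e D0 by apply: connected_del => // a b _ _; apply: sv.
have vD1 : v \in D1 by rewrite !inE vD eq_sym uv.
(* Both ends are dropped in favour of an edge [xy] that leaves the closed neighbourhood of [u]: [x]
   takes over the neighbours of [u], and [y] ties [x] to the remainder of [D]. *)
have [x [y [_ + _ + xy]]] : exists x y, [/\ x \in setT, x \in u |: [set x | e u x],
    y \in setT, y \notin u |: [set x | e u x] & e x y].
  apply: (connected_in_cross (x := u) (y := v) cg); rewrite ?inE ?eqxx //.
  by rewrite negb_or eq_sym uv.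
rewrite !inE negb_or => ux /andP[yu nuy].
have {}ux : e u x by case/orP: ux => // /eqP xu; rewrite -xu xy in nuy.
have D0v : (exists d, d \in D0) -> exists2 d, d \in D0 & e v d.
  case=> d dD0; have [dv dD1] := setD1P dD0.
  have [|a [b [_ /set1P-> bD bv vb]]] := connected_in_cross cD1 vD1 (set11 v) dD1.
    by rewrite inE.
  by exists b => //; rewrite in_setD1 bD andbT; rewrite inE in bv.
have dom' a : a \notin D -> ~~ e u a -> exists2 d, (d == v) || (d \in D0) & e a d.
  move=> aD nua; have [d dD /add_edgeP[ad|[au _]|[av _]]] := dom a aD.
  - have du : d != u by apply: contraNneq nua => <-; rewrite e_sym.
    by exists d; rewrite // !inE du dD; case: (d == v).
  - by rewrite au uD in aD.
  - by rewrite av vD in aD.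
have [v' v'W vv'] : exists2 v', v' \in y |: D0 & (v' == v) || e v v'.
  have [D00|[d dD0]] := set_0Vmem D0; last first.
    by have [d' d'D vd'] := D0v (ex_intro _ d dD0); exists d'; rewrite ?setU1r // vd' orbT.
  exists y; rewrite ?setU11 //; have [yD|yD] := boolP (y \in D).
    by have := in_set0 y; rewrite -D00 !inE yu yD !andbT => /negbFE->.
  have [d + yd] := dom' y yD nuy; rewrite D00 inE orbF => /eqP dv.
  by rewrite e_sym -dv yd orbT.
have near a : (a == v) || e v a -> a \in y |: D0 \/ exists2 d, d \in y |: D0 & e a d.
  move=> va; have [->|av'] := eqVneq a v'; first by left.
  right; exists v' => //; case/orP: va => [/eqP av|va].
    by case/orP: vv' => [/eqP v'v|]; [rewrite av v'v eqxx in av' | rewrite av].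
  by case/orP: vv' => [/eqP->|vv']; [rewrite e_sym | apply: sv].
have cy : connected_in e (y |: D0).
  have [D00|[d dD0]] := set_0Vmem D0; first by rewrite D00 setU0; apply: connected_in1.
  have [yD0|yD0] := boolP (y \in D0); first by rewrite (setUidPr _) ?sub1set.
  have [d' d'D yd'] : exists2 d', d' \in D0 & e y d'; last first.
    by apply: (connectedU1 e_sym cD0 d'D); rewrite e_sym.
  have [d1 d1D vd1] := D0v (ex_intro _ d dD0).
  have [yv|yv] := eqVneq y v; first by exists d1; rewrite ?yv.
  have yD : y \notin D by apply: contraNN yD0 => yD; rewrite !inE yv yu.
  have [d2 /orP[/eqP d2v|d2D] yd2] := dom' y yD nuy; last by exists d2.
  exists d1 => //; apply: sv => //; first by rewrite e_sym -d2v.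
  by apply: contraNneq yD0 => ->.
suff : cd_set e (x |: (y |: D0)).
  move/cd_set_ge; rewrite leqNgt; case/negP; apply: leq_ltn_trans _ Dk.
  rewrite (cardsD1 u D) uD (cardsD1 v (D :\ u)) vD1 !cardsU1.
  by rewrite leq_add ?leq_b1 // leq_add ?leq_b1.
apply/cd_setP; split; last first.
  by apply: (connectedU1 e_sym cy (setU11 _ _)); rewrite e_sym.
move=> a aW; have [au|au] := eqVneq a u.
  by exists x; rewrite ?setU11 // au.
have ax : a != x by apply: contraNneq aW => ->; rewrite setU11.
have [ua|nua] := boolP (e u a).
  by exists x; rewrite ?setU11 //; apply: su.
have lift : (a \in y |: D0 \/ exists2 d, d \in y |: D0 & e a d) ->
    exists2 d, d \in x |: (y |: D0) & e a d.
  case=> [ay|[d dW ad]]; first by rewrite setU1r in aW.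
  by exists d => //; rewrite setU1r.
have [av|av] := eqVneq a v; first by apply/lift/near; rewrite av eqxx.
have aD : a \notin D.
  by apply: contraNN aW => aD; rewrite !inE av au aD !orbT.
have [d /orP[/eqP dv|dD] ad] := dom' a aD nua; apply: lift.
  by apply: near; rewrite e_sym -dv ad orbT.
by right; exists d; rewrite // setU1r.
Qed.

Lemma cd_both_ends u v D : simplicial u -> simplicial v -> u != v -> ~~ e u v ->
    cd_set (add_edge e u v) D -> #|D| < k -> u \in D -> v \in D -> False.
Proof.
move=> su sv uv nuv cD Dk uD vD.
have [a aD ua] := cd_two_ends su sv uv nuv cD Dk uD vD.
have [b bD vb] : exists2 b, b \in D & e v b.
  apply: (cd_two_ends sv su (v := u)); rewrite // 1?eq_sym 1?e_sym //.
  by apply: cd_set_eq cD => x y; apply: add_edgeC.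
have /cd_setP[dom con] := cD; pose D0 := D :\ u :\ v.
have aD0 : a \in D0.
  rewrite !inE aD andbT; apply/andP; split; first by apply: contraNneq nuv => <-.
  by apply: contraTneq ua => ->; rewrite e_irr.
have bD0 : b \in D0.
  rewrite !inE bD andbT; apply/andP; split; first by apply: contraTneq vb => ->; rewrite e_irr.
  by apply: contraNneq nuv => <-; rewrite e_sym.
have cD0 : #|D0|.+2 = #|D|.
  by rewrite (cardsD1 u D) uD (cardsD1 v (D :\ u)) !inE vD eq_sym uv.
have dom0 x : x \notin D0 -> exists2 d, d \in D0 & e x d.
  move=> xD0; have [->|xu] := eqVneq x u; first by exists a.
  have [->|xv] := eqVneq x v; first by exists b.
  have xD : x \notin D by apply: contraNN xD0 => xD; rewrite !inE xu xv.
  have [d dD /add_edgeP[xd|[xu' _]|[xv' _]]] := dom x xD.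
  - have [du|du] := eqVneq d u.
      exists a => //; apply: su => //; first by rewrite e_sym -du.
      by apply: contraNneq xD0 => ->.
    have [dv|dv] := eqVneq d v.
      exists b => //; apply: sv => //; first by rewrite e_sym -dv.
      by apply: contraNneq xD0 => ->.
    by exists d; rewrite // !inE dv du.
  - by rewrite xu' eqxx in xu.
  - by rewrite xv' eqxx in xv.
(* Without [u] and [v] the set still dominates, but it may fall into two parts, one at each end of
   the new edge. *)
pose Ka := component e D0 a; pose Kb := component e D0 b.
have KU d : d \in D0 -> d \in Ka :|: Kb.
  move=> dD0; apply/negPn/negP => dK.
  have dD : d \in D by move: dD0; rewrite !inE => /and3P[].
  have [du dv] : d != u /\ d != v by move: dD0; rewrite !inE => /and3P[].
  have [||p [q [pD + qD + pq]]] :=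
    connected_in_cross con (A := [set u; v] :|: (Ka :|: Kb)) uD _ dD.
  - by rewrite !inE eqxx.
  - by rewrite inE negb_or dK andbT !inE negb_or du.
  rewrite [q \in _]inE negb_or !(in_set2 q) negb_or => pA /andP[/andP[qu qv] qK].
  have qD0 : q \in D0 by rewrite !inE qu qv.
  have {}pq : e p q.
    by case/add_edgeP: pq => // -[_ qE]; [rewrite qE eqxx in qv | rewrite qE eqxx in qu].
  case/negP: qK; move: pA; rewrite inE => /orP[/set2P[pE|pE]|/setUP[pK|pK]]; apply/setUP.
  - left; have [->|qa] := eqVneq q a; first exact: component_refl.
    rewrite pE in pq; apply: (component_closed (component_refl e aD0)) => //.
    by apply: su; rewrite // eq_sym.
  - right; have [->|qb] := eqVneq q b; first exact: component_refl.
    rewrite pE in pq; apply: (component_closed (component_refl e bD0)) => //.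
    by apply: sv; rewrite // eq_sym.
  - by left; apply: component_closed pK qD0 pq.
  - by right; apply: component_closed pK qD0 pq.
have D0E : D0 = Ka :|: Kb.
  by apply/setP => d; apply/idP/idP => [/KU//|/setUP[]/component_in].
have bKa : b \notin Ka.
  apply/negP => bKa; have KE : Kb = Ka by apply: component_eq.
  have : cd_set e D0.
    by apply/cd_setP; split=> //; rewrite D0E KE setUid; apply: component_connected.
  by move/cd_set_ge; rewrite leqNgt (leq_ltn_trans _ Dk) // -cD0 !leqW.
(* For an edge [xy] leaving the closed neighbourhood of [Ka], the vertex [y] lies in [Kb] or is
   dominated from it. So [x] and [y] reconnect the parts at the price of the two dropped
   vertices. *)
pose A := Ka :|: [set x | [exists d in Ka, e x d]].
have aKa : a \in Ka := component_refl e aD0.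
have [||x [y [_ xA _ yA xy]]] := connected_in_cross cg (A := A) (in_setT a) _ (in_setT b) _.
- by rewrite inE aKa.
- rewrite in_setU (negbTE bKa) inE /=; apply/exists_inP => -[d dK bd].
  by case/negP: bKa; apply: component_closed dK bD0 _; rewrite e_sym.
move: yA; rewrite in_setU negb_or inE => /andP[yKa /exists_inP yno].
have cX : connected_in e (x |: Ka).
  move: xA; rewrite in_setU => /orP[xK|].
    by rewrite (setUidPr _) ?sub1set //; apply: component_connected.
  rewrite inE => /exists_inP[d dK xd].
  by apply: (connectedU1 e_sym _ dK); [apply: component_connected | rewrite e_sym].
have cY : connected_in e (y |: Kb).
  have [yD0|yD0] := boolP (y \in D0).
    rewrite (setUidPr _) ?sub1set ?component_connected //.
    by have := KU y yD0; rewrite in_setU (negbTE yKa).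
  have [d dD0 yd] := dom0 y yD0; apply: (connectedU1 e_sym (w := d)).
  - exact: component_connected.
  - by have /setUP[dK|//] := KU d dD0; case: yno; exists d.
  - by rewrite e_sym.
have WE : (x |: Ka) :|: (y |: Kb) = x |: (y |: D0).
  by rewrite D0E setUACA -setUA.
have : cd_set e (x |: (y |: D0)).
  apply/cd_setP; split; last first.
    by rewrite -WE; apply: (connectedU_edge e_sym cX cY (setU11 _ _) (setU11 _ _) xy).
  move=> w; rewrite !in_setU !negb_or => /and3P[_ _ /dom0[d dD0 wd]].
  by exists d; rewrite // !in_setU dD0 !orbT.
move/cd_set_ge; rewrite leqNgt; case/negP; apply: leq_ltn_trans _ Dk.
rewrite -cD0 !cardsU1 -[_.+2]/(1 + (1 + #|D0|)).
by rewrite leq_add ?leq_b1 // leq_add ?leq_b1.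
Qed.

(** A CD-set of [G + uv] with fewer than [k] vertices cannot contain [u] or [v] by the previous
    lemmas, and one that avoids both never uses the new edge. *)
Lemma simplicial_adj u v : simplicial u -> simplicial v -> u != v -> e u v.
Proof.
move=> su sv uv; apply/negPn/negP => nuv; have [D cD Dk] := cd_set_add uv nuv.
have cD' : cd_set (add_edge e v u) D by apply: cd_set_eq cD => x y; apply: add_edgeC.
have [uD|uD] := boolP (u \in D).
  exact: (cd_both_ends su sv uv nuv cD Dk uD (cd_one_end su uv nuv cD Dk uD)).
have [vD|vD] := boolP (v \in D).
  by have := cd_one_end sv _ _ cD' Dk vD; rewrite 1?eq_sym 1?e_sym (negbTE uD) => /(_ uv nuv).
have : cd_set e D; last by move/cd_set_ge; rewrite leqNgt Dk.
have /cd_setP[dom con] := cD; apply/cd_setP; split.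
  move=> x xD; have [y yD /add_edgeP[xy|[_ yv]|[_ yu]]] := dom x xD; first by exists y.
    by rewrite -yv yD in vD.
  by rewrite -yu yD in uD.
apply: connected_in_sub con => x y xD yD /add_edgeP[//|[xu _]|[xv _]].
  by rewrite -xu xD in uD.
by rewrite -xv xD in vD.
Qed.

(** * Branches at a cut vertex *)

Local Notation Z := (cut_vertices e).

Lemma cut_not_connected z : z \in Z -> ~~ connected_in e [set~ z].
Proof.
rewrite inE /cut_vertex (components_in1 e_sym (in_setT z) cg); apply: contraTN => cz.
have [z0|[y yz]] := set_0Vmem [set~ z]; last by rewrite (components_in1 e_sym yz cz).
by rewrite z0 /components_in /n_comp_mem eq_card0 // => x; rewrite !inE andbF.
Qed.

Lemma cd_set_cut (f : rel T) D z A x y : symmetric f -> cd_set f D ->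
    z \notin A -> x \in A -> y \notin A -> y != z ->
    (forall a b, a \in A -> b \notin A -> f a b -> b = z) -> z \in D.
Proof.
move=> fs cD zA xA yA yz cl; apply/negPn/negP => zD.
have xz : x != z by apply: contraNneq zA => <-.
have [||||a [b [_ aA + bA fab]]] :=
  connected_in_cross (cd_set_connected_del fs cD zD) (A := A) (x := x) (y := y); rewrite ?inE //.
by rewrite (cl a b) ?eqxx.
Qed.

(* A vertex [z] that is still a cut vertex after joining two of its neighbours
   lies in every CD-set of the new graph, where it makes the new edge useless. *)
Lemma nbr_merge z a b : e z a -> e z b -> a != b -> ~~ e a b ->
  connected_in (add_edge e a b) [set~ z].
Proof.
move=> za zb ab nab; apply/negPn/negP => nc; have [D cD Dk] := cd_set_add ab nab.
have fs := add_edge_sym a b e_sym.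
have zD : z \in D by apply: contraNT nc; apply: cd_set_connected_del cD.
suff /cd_set_ge : cd_set e D by rewrite leqNgt Dk.
have /cd_setP[dom con] := cD; apply/cd_setP; split=> [x xD|].
  have [y yD /add_edgeP[xy|[-> _]|[-> _]]] := dom x xD; first by exists y.
    by exists z; rewrite // e_sym.
  by exists z; rewrite // e_sym.
apply/connected_inP => x y xD yD; have /connected_inP/(_ x y xD yD) := con.
have via p : p \in D -> e z p -> connect (induced e D) z p.
  by move=> pD zp; apply: connect1; rewrite inducedE zD pD.
have viaV p : p \in D -> e z p -> connect (induced e D) p z.
  by move=> pD zp; rewrite (induced_connect_sym D e_sym); apply: via.
apply: connect_sub => p p' /and3P[pD p'D /add_edgeP[pp'|[pE p'E]|[pE p'E]]].
- by apply: connect1; rewrite inducedE pD p'D.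
- by apply: connect_trans (viaV p pD _) (via p' p'D _); rewrite ?pE ?p'E.
- by apply: connect_trans (viaV p pD _) (via p' p'D _); rewrite ?pE ?p'E.
Qed.

Definition branch z x := component e [set~ z] x.

Lemma branch_refl z x : x != z -> x \in branch z x.
Proof. by move=> xz; apply: component_refl; rewrite !inE. Qed.

Lemma branch_neq z x y : y \in branch z x -> y != z.
Proof. by move/component_in; rewrite !inE. Qed.

Lemma branch_closed z x a b : a \in branch z x -> b \notin branch z x -> e a b -> b = z.
Proof.
move=> aC bC ab; apply/eqP/negPn/negP => bz; case/negP: bC.
by apply: component_closed aC _ ab; rewrite !inE.
Qed.

Lemma branch_eq z x y : y \in branch z x -> branch z y = branch z x.
Proof. exact: component_eq. Qed.

Lemma branch_connected z x : connected_in e (branch z x).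
Proof. exact: component_connected. Qed.

Lemma sub_branch z x A a : connected_in e A -> z \notin A -> a \in A ->
  a \in branch z x -> A \subset branch z x.
Proof.
move=> cA zA aA aC; apply: component_sub cA _ aA aC.
by apply/subsetP => w wA; rewrite !inE; apply: contraNneq zA => <-.
Qed.

Lemma branch_nbr z x : x != z -> exists2 a, a \in branch z x & e z a.
Proof.
move=> xz; have zC : z \notin branch z x by apply/negP => /branch_neq; rewrite eqxx.
have [a [b [_ aC _ bC ab]]] :=
  connected_in_cross cg (in_setT x) (branch_refl xz) (in_setT z) zC.
by exists a; rewrite // e_sym -(branch_closed aC bC ab).
Qed.

Lemma branchU_connected z x : x != z -> connected_in e (z |: branch z x).
Proof.
move=> xz; have [a aC za] := branch_nbr xz.
by apply: (connectedU1 e_sym (branch_connected z x) aC); rewrite e_sym.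
Qed.

Lemma cut_other z x : z \in Z -> x != z -> exists2 w, w != z & w \notin branch z x.
Proof.
move=> /cut_not_connected nc xz; have [/existsP[w /andP[wz wC]]|no] :=
  boolP [exists w, (w != z) && (w \notin branch z x)]; first by exists w.
case/negP: nc; apply: (@connected_in_root _ _ _ x) => // y; rewrite !inE => yz.
have : y \in branch z x.
  by apply/negPn/negP => yC; case/existsP: no; exists y; rewrite yz.
by rewrite inE => /andP[].
Qed.

(** An edge inside one branch leaves [z] a cut vertex, which [nbr_merge] forbids. *)
Lemma nbr_clique z x a b : z \in Z -> a \in branch z x -> b \in branch z x ->
  e z a -> e z b -> a != b -> e a b.
Proof.
move=> zZ aC bC za zb ab; apply/negPn/negP => nab.
have [w wz wC] := cut_other zZ (branch_neq aC); rewrite (branch_eq aC) in wC.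
have [||u [v [_ uC + vC /add_edgeP[uv|[_ vb]|[_ va]]]]] :=
  connected_in_cross (nbr_merge za zb ab nab) (x := a) _ aC (y := w) _ wC; rewrite ?in_setC1 //.
- exact: branch_neq aC.
- by rewrite (branch_closed uC vC uv) eqxx.
- by rewrite vb bC in vC.
- by rewrite va aC in vC.
Qed.

(** An edge between two branches would leave a third one separated, again against [nbr_merge]. *)
Lemma two_branches z x y w : z \in Z -> x != z -> y != z -> w != z ->
  y \notin branch z x -> (w \in branch z x) || (w \in branch z y).
Proof.
move=> zZ xz yz wz yx; apply/negPn/negP; rewrite negb_or => /andP[wx wy].
have [a aC za] := branch_nbr xz; have [b bC zb] := branch_nbr yz.
have sym p p' : p \in branch z p' -> p' != z -> p' \in branch z p.
  by move=> pp' p'z; rewrite (branch_eq pp'); apply: branch_refl.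
have bx : b \notin branch z x.
  apply: contraNN yx => bx; rewrite -(branch_eq bx) (branch_eq bC).
  exact: branch_refl.
have ab : a != b by apply: contraNneq bx => <-.
have nab : ~~ e a b.
  by apply/negP => h; have := branch_neq bC; rewrite (branch_closed aC bx h) eqxx.
have xw : x \notin branch z w by apply: contraNN wx => /sym; apply.
have [||||u [v [_ uC + vC /add_edgeP[uv|[ua _]|[ub _]]]]] :=
  connected_in_cross (nbr_merge za zb ab nab) (A := branch z w) (x := w) (y := x);
  rewrite ?in_setC1 ?branch_refl //.
- by rewrite (branch_closed uC vC uv) eqxx.
- rewrite ua in uC; case/negP: wx; rewrite -(branch_eq aC) (branch_eq uC).
  exact: branch_refl.
- rewrite ub in uC; case/negP: wy; rewrite -(branch_eq bC) (branch_eq uC).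
  exact: branch_refl.
Qed.

(** * Connected domination inside a branch *)

Definition local_cd (f : rel T) L c W :=
  [&& W \subset L, connected_in f (c |: W) &
      [forall y in L, (y \in W) || [exists w in c |: W, f y w]]].

Lemma local_cdP f L c W :
  reflect [/\ W \subset L, connected_in f (c |: W) &
      forall y, y \in L -> y \notin W -> exists2 w, w \in c |: W & f y w]
    (local_cd f L c W).
Proof.
apply: (iffP and3P) => -[WL cW dW]; split=> //.
  move=> y yL yW; move/forall_inP/(_ y yL): dW; rewrite (negbTE yW) /=.
  by move/exists_inP.
apply/forall_inP => y yL; have [//|yW] := boolP (y \in W).
by apply/exists_inP; apply: dW.
Qed.

Lemma connected_restrict (f : rel T) D L c : symmetric f -> connected_in f D ->
    c \in D -> c \notin L -> (forall a b, a \in L -> b \notin L -> f a b -> b = c) ->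
  connected_in f (c |: D :&: L).
Proof.
move=> fs cD cinD cL cl; apply: connected_in_cut => A x y.
have inD w : w \in c |: D :&: L -> w \in D by rewrite !inE => /orP[/eqP->|/andP[]].
have [cA|cA] := boolP (c \in A) => xS xA yS yA.
  have [||u [v [uD + vD + uv]]] := connected_in_cross cD (A := A :|: ~: L) cinD _ (inD y yS) _.
  - by rewrite inE cA.
  - have yc : y != c by apply: contraNneq yA => ->.
    by move: yS; rewrite !inE (negbTE yc) (negbTE yA) /= => /andP[_ ->].
  rewrite !inE negb_or negbK => uA /andP[vA vL].
  have [uL|uL] := boolP (u \in L).
    by rewrite uL /= orbF in uA; exists u, v; split; rewrite // !inE ?uD ?uL ?vD ?vL orbT.
  have uc : u = c by apply: (cl v u); rewrite // fs.
  by exists u, v; split; rewrite // ?uc // !inE ?eqxx ?vD ?vL ?orbT.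
have [||u [v [uD + vD + uv]]] := connected_in_cross cD (A := A :&: L) (inD x xS) _ (inD y yS) _.
- have xc : x != c by apply: contraTneq xA => ->.
  by move: xS; rewrite !inE (negbTE xc) xA /= => /andP[_ ->].
- by rewrite inE (negbTE yA).
rewrite !inE => /andP[uA uL] vAL; have [vL|vL] := boolP (v \in L).
  by rewrite vL andbT in vAL; exists u, v; split; rewrite // !inE ?uD ?uL ?vD ?vL orbT.
have vc : v = c by apply: (cl u v).
by exists u, v; split; rewrite // ?vc // !inE ?eqxx ?uD ?uL ?orbT.
Qed.

Lemma cd_set_restrict (f : rel T) D L c : symmetric f -> cd_set f D ->
    c \in D -> c \notin L -> (forall a b, a \in L -> b \notin L -> f a b -> b = c) ->
  local_cd f L c (D :&: L).
Proof.
move=> fs /cd_setP[dom con] cD cL cl; apply/local_cdP; split; first exact: subsetIr.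
  exact: connected_restrict.
move=> y yL; rewrite inE yL andbT => /dom[w wD yw]; exists w; rewrite // !inE wD /=.
by have [//|wL] := boolP (w \in L); [rewrite orbT | rewrite (cl y w) ?eqxx].
Qed.

(** All contact between [L] and the rest goes through [c], so the part of [D] in [L] can be
    exchanged for [W]. Added edges of [f] that meet [L] disappear in the exchange. *)
Lemma cd_set_glue (f : rel T) D L c W : symmetric f -> cd_set f D ->
    c \in D -> c \notin L -> (forall a b, a \in L -> b \notin L -> f a b -> b = c) ->
    (forall a b, a \notin L -> b \notin L -> f a b -> e a b) ->
  local_cd e L c W -> cd_set e (D :\: L :|: W).
Proof.
move=> fs /cd_setP[dom con] cD cL cl fe /local_cdP[WL cW dW].
have cDL : c \in D :\: L by rewrite inE cL.
have DLE : c |: D :&: (~: L :\ c) = D :\: L.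
  apply/setP => x; rewrite !inE; have [->|_] := eqVneq x c; first by rewrite cL cD.
  by rewrite /= andbC.
apply/cd_setP; split.
  move=> x; rewrite inE negb_or => /andP[xDL xW]; have [xL|xL] := boolP (x \in L).
    have [w] := dW x xL xW; rewrite in_setU1 => /orP[/eqP->|wW] xw.
      by exists c; rewrite // inE cDL.
    by exists w; rewrite // inE wW orbT.
  have xD : x \notin D by apply: contraNN xDL => xD; rewrite inE xL.
  have [d dD xd] := dom x xD; have dL : d \notin L.
    apply/negP => dL; rewrite fs in xd; rewrite (cl d x dL xL xd) cD in xD.
    by [].
  by exists d; [rewrite !inE dL dD | apply: fe].
have cDLf : connected_in f (D :\: L).
  rewrite -DLE; apply: connected_restrict => //; first by rewrite !inE eqxx.
  move=> a b; rewrite !inE negb_and negbK => /andP[ac aL] /orP[/eqP //|].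
  by rewrite negbK => bL; rewrite fs => /(cl b a bL aL) aE; rewrite aE eqxx in ac.
have cDLe : connected_in e (D :\: L).
  by apply: connected_in_sub cDLf => x y; rewrite !inE => /andP[xL _] /andP[yL _]; apply: fe.
have -> : D :\: L :|: W = D :\: L :|: (c |: W).
  by apply/setP => x; rewrite !in_setU in_set1; case: eqP => // ->; rewrite cDL.
by apply: (connectedU e_sym cDLe cW cDL); rewrite setU11.
Qed.

(** The essential condition is [leaf_uncut]; for a branch at a cut vertex the last three fields are
    consequences, stored so that [L] can be handled as a plain set. *)
Record leaf c L : Prop := Leaf {
  leaf_root : c \in Z;
  leaf_rootN : c \notin L;
  leaf_closed : forall a b, a \in L -> b \notin L -> e a b -> b = c;
  leaf_connected : connected_in e L;
  leaf_uncut : [disjoint L & Z];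
  leaf_neq0 : exists x, x \in L;
  leaf_out : exists2 y, y \notin L & y != c;
  leaf_clique : forall a b, a \in L -> b \in L -> e c a -> e c b -> a != b -> e a b
}.

Lemma branch_leaf z x : z \in Z -> x != z -> [disjoint branch z x & Z] -> leaf z (branch z x).
Proof.
move=> zZ xz dZ; split=> //.
- by apply/negP => /branch_neq; rewrite eqxx.
- exact: branch_closed.
- exact: branch_connected.
- by exists x; apply: branch_refl.
- by have [w wz wC] := cut_other zZ xz; exists w.
- by move=> a b; apply: nbr_clique.
Qed.

(** If the branch contains a cut vertex, some branch at that vertex avoids [z] and is strictly
    smaller. *)
Lemma leaf_exists z x : z \in Z -> x != z ->
  exists c L, leaf c L /\ L \subset branch z x.
Proof.
have [n] := ubnP #|branch z x|; elim: n z x => // n IH z x sz zZ xz.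
have [dZ|] := boolP [disjoint branch z x & Z].
  by exists z, (branch z x); split=> //; apply: branch_leaf.
case/pred0Pn => z' /= /andP[z'C z'Z]; have z'z := branch_neq z'C.
have [|w wz' wC] := cut_other z'Z (x := z); first by rewrite eq_sym.
have zw : z \notin branch z' w.
  apply: contraNN wC => h; rewrite (branch_eq h); exact: branch_refl.
have sub : z' |: branch z' w \subset branch z x.
  apply: (sub_branch (a := z') (branchU_connected wz')) => //; last exact: setU11.
  by rewrite inE negb_or zw andbT inE eq_sym.
have z'N : z' \notin branch z' w by apply/negP => /branch_neq; rewrite eqxx.
have [|c [L [lL LC]]] := IH z' w _ z'Z wz'.
  by have := subset_leq_card sub; rewrite cardsU1 z'N => /leq_trans; apply.
exists c, L; split=> //; apply: subset_trans LC _.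
by apply: subset_trans sub; apply: subsetUr.
Qed.

(** Criticality made local: if the CD-set of [G + xy] did not improve on [W] inside [L], gluing [W]
    into it would give a CD-set of [G] with fewer than [k] vertices. *)
Lemma leaf_shrink c L W x y : leaf c L -> local_cd e L c W ->
    x \in c |: L -> y \in c |: L -> x != y -> ~~ e x y ->
  exists2 W', local_cd (add_edge e x y) L c W' & #|W'| < #|W|.
Proof.
move=> lL lW xL yL xy nxy; have [D cD Dk] := cd_set_add xy nxy.
have fs := add_edge_sym x y e_sym; have cL := leaf_rootN lL.
have cl a b : a \in L -> b \notin L -> add_edge e x y a b -> b = c.
  move=> aL bL /add_edgeP[|[_ bE]|[_ bE]]; first exact: (leaf_closed lL).
    by rewrite bE in bL *; move: yL; rewrite in_setU1 (negbTE bL) orbF => /eqP.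
  by rewrite bE in bL *; move: xL; rewrite in_setU1 (negbTE bL) orbF => /eqP.
have [a aL] := leaf_neq0 lL; have [b bL bc] := leaf_out lL.
have cinD : c \in D by apply: (cd_set_cut fs cD cL aL bL bc).
exists (D :&: L); first exact: cd_set_restrict.
rewrite ltnNge; apply/negP => le.
have : cd_set e (D :\: L :|: W).
  apply: (cd_set_glue fs cD cinD cL cl _ lW) => p q pL qL /add_edgeP[//|[pE qE]|[pE qE]].
    rewrite -pE -qE !in_setU1 (negbTE pL) (negbTE qL) !orbF in xL yL xy.
    by rewrite (eqP xL) (eqP yL) eqxx in xy.
  rewrite -pE -qE !in_setU1 (negbTE pL) (negbTE qL) !orbF in xL yL xy.
  by rewrite (eqP xL) (eqP yL) eqxx in xy.
move/cd_set_ge; rewrite leqNgt => /negP; apply; apply: leq_ltn_trans Dk.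
apply: leq_trans (leq_card_setU _ _) _; rewrite -(cardsID L D) addnC.
by rewrite leq_add2r.
Qed.

(** The minimum size of such a [W] is the excess of the branch. *)
Definition small c L := [exists W, local_cd e L c W && (#|W| <= 1)].

(** A missing edge inside [L] would shrink [W] to the empty set, so [c] would see all of [L], which
    is then a clique after all. A vertex not adjacent to [c], or any vertex if there is none, is
    simplicial. *)
Lemma small_leaf c L : leaf c L -> small c L ->
  {in L &, forall x y, x != y -> e x y} /\ exists2 u, u \in L & simplicial u.
Proof.
move=> lL /existsP[W /andP[lW W1]]; have cL := leaf_rootN lL.
have shrink x y : x \in L -> y \in L -> x != y -> ~~ e x y ->
    forall y', y' \in L -> e c y'.
  move=> xL yL xy nxy y' y'L; have xc : x != c by apply: contraNneq cL => <-.
  have yc : y != c by apply: contraNneq cL => <-.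
  have [||W' /local_cdP[_ _ dW'] W'W] := leaf_shrink lL lW (x := x) (y := y) _ _ xy nxy.
  - by rewrite setU1r.
  - by rewrite setU1r.
  have W'0 : W' = set0 by apply/eqP; rewrite -cards_eq0 -leqn0 -ltnS; apply: leq_trans W'W W1.
  have [|w] := dW' y' y'L; first by rewrite W'0 inE.
  rewrite W'0 setU0 => /set1P-> /add_edgeP[|[_ cE]|[_ cE]]; first by rewrite e_sym.
    by rewrite cE eqxx in yc.
  by rewrite cE eqxx in xc.
have clL : {in L &, forall x y, x != y -> e x y}.
  move=> x y xL yL xy; apply/negPn/negP => nxy; case/negP: (nxy).
  by apply: (leaf_clique lL) => //; apply: (shrink x y).
split=> //; have [/exists_inP[u uL nu]|no] := boolP [exists u in L, ~~ e c u].
  exists u => // a b ua ub ab.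
  have inL w : e u w -> w \in L.
    move=> uw; apply/negPn/negP => wL.
    have wc := leaf_closed lL uL wL uw.
    by rewrite e_sym -wc uw in nu.
  by apply: clL => //; apply: inL.
have cN u : u \in L -> e c u.
  by move=> uL; apply: contraNT no => nu; apply/exists_inP; exists u.
have [u uL] := leaf_neq0 lL; exists u => // a b ua ub ab.
have inL w : e u w -> w \in L \/ w = c.
  by move=> uw; have [wL|wL] := boolP (w \in L); [left | right; apply: (leaf_closed lL uL wL)].
have [aL|ac] := inL a ua; have [bL|bc] := inL b ub.
- exact: clL.
- by rewrite bc e_sym; apply: cN.
- by rewrite ac; apply: cN.
- by rewrite ac bc eqxx in ab.
Qed.

(** * At most one branch of excess two or more *)

Hypothesis k_le : k <= #|Z| + 3.
Hypothesis Z_neq0 : Z != set0.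

Lemma cut_sub_cd D : cd_set e D -> Z \subset D.
Proof.
move=> cD; apply/subsetP => z /cut_not_connected; apply: contraNT.
exact: cd_set_connected_del cD.
Qed.

Lemma leaf_local_cd c L D : leaf c L -> cd_set e D -> local_cd e L c (D :&: L).
Proof.
move=> lL cD; apply: (cd_set_restrict e_sym cD); last exact: (leaf_closed lL).
  by apply: (subsetP (cut_sub_cd cD)); apply: leaf_root lL.
exact: (leaf_rootN lL).
Qed.

Lemma not_small c L W : ~~ small c L -> local_cd e L c W -> 1 < #|W|.
Proof.
move=> nsm lW; rewrite ltnNge; apply: contraNN nsm => W1.
by apply/existsP; exists W; rewrite lW.
Qed.

Lemma cdE c L D : leaf c L -> Z \subset D -> #|D| <= #|Z| + #|D :&: L| ->
  forall d, d \in D -> (d \in Z) || (d \in L).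
Proof.
move=> lL ZD le d dD; have sub : Z :|: (D :&: L) \subset D by rewrite subUset ZD subsetIl.
have dis : [disjoint Z & D :&: L].
  have /pred0P h := leaf_uncut lL; apply/pred0P => x /=; have := h x.
  by rewrite /= in_setI; case: (x \in L); case: (x \in Z); rewrite ?andbF.
have : D == Z :|: (D :&: L).
  by rewrite eq_sym eqEcard sub cardsU (disjoint_setI0 dis) cards0 subn0.
by move/eqP => DE; move: dD; rewrite {1}DE in_setU in_setI => /orP[->//|/andP[_ ->]]; rewrite orbT.
Qed.

Lemma leaf_card c L D : leaf c L -> Z \subset D -> #|Z| + #|D :&: L| <= #|D|.
Proof.
move=> lL ZD; have /pred0P h := leaf_uncut lL; rewrite -(cardsID L D) addnC leq_add2l.
apply/subset_leq_card/subsetP => z zZ; rewrite in_setD (subsetP ZD) // andbT.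
by apply/negP => zL; have := h z; rewrite /= zL zZ.
Qed.

(** A minimum CD-set would contain all cut vertices and two more vertices in each leaf, which is at
    least [#|Z| + 4]. *)
Lemma one_small c L c' L' : leaf c L -> leaf c' L' -> [disjoint L & L'] ->
  small c L || small c' L'.
Proof.
move=> lL lL' dis; apply/negPn/negP; rewrite negb_or => /andP[n n'].
have [D cD Dk] := gamma_c_min cg; have gk : gamma_c e = k by case: crit.
have ZD := cut_sub_cd cD.
have h := not_small n (leaf_local_cd lL cD); have h' := not_small n' (leaf_local_cd lL' cD).
have : #|Z| + #|D :&: L'| <= #|D :\: L|.
  have -> : D :&: L' = (D :\: L) :&: L'.
    apply/setP => x; rewrite !in_setI in_setD; have /pred0P/(_ x) /= := dis.
    by case: (x \in L); case: (x \in L'); rewrite ?andbF ?andbT.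
  apply: leaf_card lL' _; apply/subsetP => z zZ; rewrite in_setD (subsetP ZD) // andbT.
  by apply/negP => zL; have /pred0P/(_ z) := leaf_uncut lL; rewrite /= zL zZ.
rewrite -(leq_add2l #|D :&: L|) cardsID Dk gk => /leq_trans/(_ k_le); rewrite addnCA leqNgt.
by case/negP; rewrite ltn_add2l (@leq_add 2 2).
Qed.

Lemma disjoint_leaves_not_adj c L c' L' u v : leaf c L -> leaf c' L' ->
  [disjoint L & L'] -> u \in L -> v \in L' -> ~~ e u v && (u != v).
Proof.
move=> lL lL' dis uL vL'; have vL : v \notin L.
  by apply/negP => vL; have /pred0P/(_ v) := dis; rewrite /= vL vL'.
apply/andP; split; last by apply: contraNneq vL => <-.
apply/negP => uv; have vc := leaf_closed lL uL vL uv.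
by have /pred0P/(_ v) := leaf_uncut lL'; rewrite /= vL' vc (leaf_root lL).
Qed.

Lemma not_two_small c L c' L' : leaf c L -> leaf c' L' -> [disjoint L & L'] ->
  small c L -> small c' L' -> False.
Proof.
move=> lL lL' dis s s'; have [_ [u uL su]] := small_leaf lL s.
have [_ [v vL sv]] := small_leaf lL' s'.
have /andP[nuv uv] := disjoint_leaves_not_adj lL lL' dis uL vL.
by rewrite simplicial_adj in nuv.
Qed.

Lemma disjointS (A B A' B' : {set T}) :
  A \subset A' -> B \subset B' -> [disjoint A' & B'] -> [disjoint A & B].
Proof. by move=> hA hB dis; apply: disjointWl hA _; apply: disjointWr hB _. Qed.

Lemma big_leaf_exists : exists c L, leaf c L /\ ~~ small c L.
Proof.
have /set0Pn[z zZ] := Z_neq0.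
have [x xz] : exists x, x != z.
  have [[x xz]|no] : (exists x, x != z) \/ forall x, x = z; first 1 last.
  - by exists x.
  - case/negP: (cut_not_connected zZ); apply/connected_inP => x y; rewrite !inE.
    by rewrite (no x) eqxx.
  have [/existsP[x xz]|no] := boolP [exists x, x != z]; first by left; exists x.
  by right=> x; apply/eqP/negPn/negP => xz; case/existsP: no; exists x.
have [w wz wC] := cut_other zZ xz.
have [c [L [lL LC]]] := leaf_exists zZ xz; have [c' [L' [lL' LC']]] := leaf_exists zZ wz.
have dis : [disjoint L & L'].
  apply: disjointS LC LC' _; apply/pred0P => y /=; apply/negP => /andP[yx yw].
  by case/negP: wC; rewrite -(branch_eq yx) (branch_eq yw); apply: branch_refl.
have [s|s] := boolP (small c L); last by exists c, L.
by exists c', L'; split=> //; apply/negP => s'; apply: (not_two_small lL lL' dis s s').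
Qed.

Lemma local_cd_sub (f : rel T) L c W :
    {in c |: L &, forall a b, f a b -> e a b} -> local_cd f L c W -> local_cd e L c W.
Proof.
move=> fe /local_cdP[WL cW dW]; apply/local_cdP; split=> //.
  apply: connected_in_sub cW => a b aW bW; apply: fe.
    by apply: (subsetP (setUS _ WL)).
  by apply: (subsetP (setUS _ WL)).
move=> y yL yW; have [w wW yw] := dW y yL yW; exists w => //; apply: fe => //.
  by rewrite setU1r.
by apply: (subsetP (setUS _ WL)).
Qed.

(** * The linear order of the cut vertices *)

Section BigLeaf.
Variables (c q : T) (L : {set T}).
Hypothesis lL : leaf c L.
Hypothesis big : ~~ small c L.
Hypothesis qL : q \in L.

(** The side of [z] turned away from the big leaf, which [q] represents; by [two_branches] it is a
    single branch. *)
Definition away z := [set~ z] :\: branch z q.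

Let zNL z : z \in Z -> z \notin L.
Proof. by move=> zZ; apply/negP => zL; have /pred0P/(_ z) := leaf_uncut lL; rewrite /= zL zZ. Qed.

Let qz z : z \in Z -> q != z.
Proof. by move=> /zNL; apply: contraNneq => <-. Qed.

Lemma mem_away z w : (w \in away z) = (w != z) && (w \notin branch z q).
Proof. by rewrite in_setD in_setC1 andbC. Qed.

Lemma away_self z : z \notin away z.
Proof. by rewrite mem_away eqxx. Qed.

Lemma q_away z : z \in Z -> q \notin away z.
Proof. by move=> /qz qz'; rewrite mem_away branch_refl // andbF. Qed.

Lemma L_branch z : z \in Z -> L \subset branch z q.
Proof.
move=> zZ; apply: (sub_branch (a := q) (leaf_connected lL) (zNL zZ) qL).
by apply: branch_refl; apply: qz.
Qed.

Lemma L_away z : z \in Z -> [disjoint L & away z].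
Proof.
move=> zZ; apply/pred0P => w /=; apply/negP => /andP[wL].
by rewrite mem_away (subsetP (L_branch zZ)) // andbF.
Qed.

Lemma away_branch z x : z \in Z -> x \in away z -> away z = branch z x.
Proof.
move=> zZ; rewrite mem_away => /andP[xz xq]; apply/setP => w; rewrite mem_away.
apply/idP/idP => [/andP[wz wq]|wx].
  by have := two_branches zZ (qz zZ) xz wz xq; rewrite (negbTE wq).
rewrite (branch_neq wx); apply: contraNN xq => wq.
by rewrite -(branch_eq wq) (branch_eq wx); apply: branch_refl.
Qed.

Lemma away_neq0 z : z \in Z -> exists x, x \in away z.
Proof.
move=> zZ; have [w wz wq] := cut_other zZ (qz zZ).
by exists w; rewrite mem_away wz.
Qed.

Lemma away_closed z a b : z \in Z -> a \in away z -> b \notin away z -> e a b -> b = z.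
Proof. by move=> zZ aA; rewrite (away_branch zZ aA); apply: branch_closed; apply: branch_refl; move: aA; rewrite mem_away => /andP[]. Qed.

Lemma awayU_connected z : z \in Z -> connected_in e (z |: away z).
Proof.
move=> zZ; have [x xA] := away_neq0 zZ; rewrite (away_branch zZ xA).
by apply: branchU_connected; move: xA; rewrite mem_away => /andP[].
Qed.

Lemma away_nest z z' : z \in Z -> z' \in Z -> z' \in away z -> z' |: away z' \subset away z.
Proof.
move=> zZ z'Z z'A; have sub : z |: branch z q \subset branch z' q.
  apply: (sub_branch (a := q) (branchU_connected (qz zZ))).
  - by move: z'A; rewrite mem_away in_setU1 negb_or.
  - by rewrite setU1r // branch_refl // qz.
  - by rewrite branch_refl // qz.
apply/subsetP => w wA; have wq : w \notin branch z' q.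
  move: wA; rewrite in_setU1 => /orP[/eqP->|]; last by rewrite mem_away => /andP[].
  by apply/negP => /branch_neq; rewrite eqxx.
have := contraNN (subsetP sub w) wq.
by rewrite in_setU1 negb_or mem_away.
Qed.

Lemma away_anti z z' : z \in Z -> z' \in Z -> z' \in away z -> z \notin away z'.
Proof.
move=> zZ z'Z z'A; apply/negP => zA'.
have /subsetP/(_ z') := away_nest z'Z zZ zA'.
by rewrite setU1r // (negbTE (away_self z')) => /(_ isT).
Qed.

Lemma away_small z : z \in Z -> exists c' L', [/\ leaf c' L', L' \subset away z & small c' L'].
Proof.
move=> zZ; have [x xA] := away_neq0 zZ.
have xz : x != z by move: xA; rewrite mem_away => /andP[].
have [c' [L' [lL' L'C]]] := leaf_exists zZ xz; rewrite -(away_branch zZ xA) in L'C.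
exists c', L'; split=> //; have := one_small lL lL' (disjointS (subxx L) L'C (L_away zZ)).
by rewrite (negbTE big).
Qed.

(** Otherwise the two far sides are disjoint, and each contains a small leaf. *)
Lemma away_linear z z' : z \in Z -> z' \in Z -> z != z' ->
  (z \in away z') || (z' \in away z).
Proof.
move=> zZ z'Z zz'; apply/negPn/negP; rewrite negb_or => /andP[zA z'A].
have [c1 [L1 [l1 s1 sm1]]] := away_small zZ; have [c2 [L2 [l2 s2 sm2]]] := away_small z'Z.
apply: (not_two_small l1 l2 _ sm1 sm2); apply: disjointS s1 s2 _.
have sub : z' |: away z' \subset branch z q.
  apply: (sub_branch (a := z') (awayU_connected z'Z)); last first.
  - by move: z'A; rewrite mem_away eq_sym zz' /= negbK.
  - exact: setU11.
  - by rewrite in_setU1 negb_or zz'.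
apply/pred0P => w /=; apply/negP => /andP[wA wA'].
by move: wA; rewrite mem_away (subsetP sub) ?setU1r // andbF.
Qed.

Lemma away_simplicial z : z \in Z -> exists2 u, u \in away z & simplicial u.
Proof.
move=> zZ; have [c' [L' [lL' L'A sm]]] := away_small zZ.
by have [_ [u uL' su]] := small_leaf lL' sm; exists u => //; apply: (subsetP L'A).
Qed.

(** * The block between consecutive cut vertices *)

Section Block.
Variables z z' : T.
Hypothesis zZ : z \in Z.
Hypothesis z'Z : z' \in Z.
Hypothesis z'A : z' \in away z.

Let inner := away z :\: (z' |: away z').
Let block := z |: (z' |: inner).

Hypothesis inner_uncut : [disjoint inner & Z].

Let mem_inner w : (w \in inner) = [&& w != z', w \notin away z' & w \in away z].
Proof. by rewrite in_setD in_setU1 negb_or -andbA. Qed.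

Let mem_block w : (w \in block) = [|| w == z, w == z' | w \in inner].
Proof. by rewrite !in_setU1. Qed.

Let zz' : z != z'. Proof. by apply: contraTneq z'A => <-; apply: away_self. Qed.

Let block_away' w : w \in block -> w \notin away z'.
Proof.
rewrite mem_block => /or3P[/eqP->|/eqP->|]; last by rewrite mem_inner => /and3P[].
  exact: away_anti.
exact: away_self.
Qed.

Let block_away w : w \in block -> w \notin away z -> w = z.
Proof.
rewrite mem_block => /or3P[/eqP->|/eqP->|] //; first by rewrite z'A.
by rewrite mem_inner => /and3P[_ _ ->].
Qed.

Let inner_closed a b : a \in inner -> e a b -> b \in block.
Proof.
rewrite mem_inner mem_block mem_inner => /and3P[az' aA' aA] ab.
have [bA|bA] := boolP (b \in away z); last by rewrite (away_closed zZ aA bA ab) eqxx.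
have [//|bz'] := eqVneq b z'; first by rewrite orbT.
have [bA'|bA'] := boolP (b \in away z'); last by rewrite orbT.
by rewrite e_sym in ab; rewrite (away_closed z'Z bA' aA' ab) eqxx in az'.
Qed.

(** No cut vertex separates two other vertices of the block. So an edge added inside the block
    leaves all cut vertices in every CD-set. *)
Let block_sep z0 p p' : z0 \in Z -> p \in block -> p' \in block ->
  p \in away z0 -> p' \notin away z0 -> p' = z0.
Proof.
move=> z0Z pB p'B pA p'A; have [z0z|z0z] := eqVneq z0 z.
  by rewrite z0z; apply: block_away; rewrite -?z0z.
have [z0z'|z0z'] := eqVneq z0 z'.
  by have := block_away' pB; rewrite -z0z' pA.
have /orP[z0A|zA] := away_linear z0Z zZ z0z.
  have z0A' : z0 \in away z'.
    have /pred0P/(_ z0) /= := inner_uncut; rewrite z0Z andbT mem_inner z0z' z0A andbT /=.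
    by move/negbFE.
  have /subsetP/(_ p) := away_nest z'Z z0Z z0A'; rewrite setU1r // => /(_ isT).
  by rewrite (negbTE (block_away' pB)).
have sub := subsetP (away_nest z0Z zZ zA).
have [p'z|p'z] := boolP (p' \in away z); first by rewrite sub ?setU1r in p'A.
by rewrite (block_away p'B p'z) sub ?setU11 // in p'A.
Qed.

Let block_L w : w \in block -> w \notin L.
Proof.
rewrite mem_block => /or3P[/eqP->|/eqP->|]; try exact: zNL.
rewrite mem_inner => /and3P[_ _ wA]; apply/negP => wL.
by have /pred0P/(_ w) := L_away zZ; rewrite /= wL wA.
Qed.

Section MissingEdge.
Variables (x y : T) (D : {set T}).
Hypothesis xB : x \in block.
Hypothesis yB : y \in block.
Hypothesis xy : x != y.
Hypothesis cD : cd_set (add_edge e x y) D.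
Hypothesis Dk : #|D| < k.

Local Notation f := (add_edge e x y).
Let fs : symmetric f := add_edge_sym x y e_sym.

Let ZD : Z \subset D.
Proof.
apply/subsetP => z0 z0Z; have [w wA] := away_neq0 z0Z.
apply: (cd_set_cut fs cD (away_self z0) wA (q_away z0Z) (qz z0Z)).
move=> a b aA bA /add_edgeP[|[aE bE]|[aE bE]]; first exact: away_closed.
  by apply: (block_sep z0Z _ _ aA bA); rewrite ?aE ?bE.
by apply: (block_sep z0Z _ _ aA bA); rewrite ?aE ?bE.
Qed.

(** The set [D] has at most [#|Z| + 2] vertices, and the big leaf alone accounts for two that are
    not cut vertices. *)
Lemma missing_cd d : d \in D -> (d \in Z) || (d \in L).
Proof.
have cinD : c \in D by apply: (subsetP ZD); apply: leaf_root lL.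
have cap : local_cd f L c (D :&: L).
  apply: (cd_set_restrict fs cD cinD (leaf_rootN lL)).
  move=> a b aL bL /add_edgeP[|[aE _]|[aE _]]; first exact: (leaf_closed lL).
    by have := block_L xB; rewrite -aE aL.
  by have := block_L yB; rewrite -aE aL.
have inc w : w \in block -> w \in c |: L -> w = c.
  by move=> wB; rewrite in_setU1 (negbTE (block_L wB)) orbF => /eqP.
have : local_cd e L c (D :&: L).
  apply: local_cd_sub cap => a b aL bL /add_edgeP[//|[aE bE]|[aE bE]].
    by rewrite aE bE in aL bL; move: xy; rewrite (inc x xB aL) (inc y yB bL) eqxx.
  by rewrite aE bE in aL bL; move: xy; rewrite (inc x xB bL) (inc y yB aL) eqxx.
move/(not_small big) => ge2; apply: (cdE lL ZD).
rewrite -ltnS; apply: leq_trans Dk _; apply: leq_trans k_le _.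
by rewrite -addnS leq_add2l.
Qed.

Lemma missing_inner d : d \in inner -> d \notin D.
Proof.
move=> dI; apply/negP => /missing_cd /orP[dZ|dL].
  by have /pred0P/(_ d) := inner_uncut; rewrite /= dI dZ.
by have := @block_L d; rewrite dL mem_block dI !orbT => /(_ isT).
Qed.

Let zD : z \in D. Proof. exact: (subsetP ZD). Qed.
Let z'D : z' \in D. Proof. exact: (subsetP ZD). Qed.

Let blockD w : w \in block -> w \in D -> (w == z) || (w == z').
Proof.
by rewrite mem_block => /or3P[->|->|/missing_inner/negbTE->]; rewrite ?orbT.
Qed.

Lemma missing_dom w : w \in inner -> f w z || f w z'.
Proof.
move=> wI; have /cd_setP[dom _] := cD; have [d dD wd] := dom w (missing_inner wI).
suff dB : d \in block by have /orP[/eqP<-|/eqP<-] := blockD dB dD; rewrite wd ?orbT.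
by case/add_edgeP: wd => [|[_ ->]|[_ ->]] //; apply: inner_closed.
Qed.

(** [D] is connected and meets the block only in [z] and [z'], so it passes between them
    directly. *)
Lemma missing_join : f z' z.
Proof.
have /cd_setP[_ con] := cD.
have zN : z \notin z' |: away z' by rewrite in_setU1 negb_or zz' away_anti.
have [u [v [uD uA vD vA uv]]] := connected_in_cross con z'D (setU11 _ _) zD zN.
have vz' : v != z' by move: vA; rewrite in_setU1 negb_or => /andP[].
have vA' : v \notin away z' by move: vA; rewrite in_setU1 negb_or => /andP[].
have new : u \in block -> v \in block -> f z' z.
  move=> uB vB; have := blockD vB vD; rewrite (negbTE vz') orbF => /eqP vE.
  move: uA; rewrite in_setU1 (negbTE (block_away' uB)) orbF => /eqP uE.
  by rewrite -uE -vE.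
case/add_edgeP: (uv) => [euv|[uE vE]|[uE vE]]; try by apply: new; rewrite ?uE ?vE.
move: uA; rewrite in_setU1 => /orP[/eqP uE|uA']; last first.
  by rewrite (away_closed z'Z uA' vA' euv) eqxx in vz'.
apply: new; first by rewrite uE mem_block eqxx orbT.
rewrite uE in euv; rewrite mem_block mem_inner vz' vA' /=.
have [vz|vz] := boolP (v \in away z); first by rewrite !orbT.
by rewrite (away_closed zZ z'A vz euv) eqxx.
Qed.

(** Otherwise [D] does not need the new edge, neither to dominate nor to connect, and is a CD-set of
    [G]. *)
Lemma missing_undominated : e z z' ->
  exists2 w, w \in inner & ~~ e w z && ~~ e w z'.
Proof.
move=> ezz'; have [/exists_inP[w wI nw]|no] :=
  boolP [exists w in inner, ~~ e w z && ~~ e w z']; first by exists w.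
have dom_in w : w \in inner -> e w z || e w z'.
  by move=> wI; apply: contraNT no; rewrite negb_or => nw; apply/exists_inP; exists w.
suff /cd_set_ge : cd_set e D by rewrite leqNgt Dk.
have /cd_setP[dom con] := cD; apply/cd_setP; split.
  move=> w wD; have [d dD wd] := dom w wD.
  have new : w \in block -> exists2 d', d' \in D & e w d'.
    rewrite mem_block => /or3P[/eqP wE|/eqP wE|/dom_in/orP[h|h]].
    - by rewrite wE zD in wD.
    - by rewrite wE z'D in wD.
    - by exists z.
    - by exists z'.
  by case/add_edgeP: wd => [h|[wE _]|[wE _]]; [exists d | apply: new; rewrite wE | apply: new; rewrite wE].
apply: connected_in_sub con => a b aD bD; have new : a != b -> a \in block -> b \in block -> e a b.
  move=> ab aB bB; have /orP[/eqP aE|/eqP aE] := blockD aB aD;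
  have /orP[/eqP bE|/eqP bE] := blockD bB bD; rewrite aE bE ?eqxx // in ab *.
  by rewrite e_sym.
by case/add_edgeP=> [//|[aE bE]|[aE bE]]; apply: new; rewrite ?aE ?bE // eq_sym.
Qed.

End MissingEdge.

(** If [z] and [z'] are adjacent, a missing edge yields an inner vertex [w] that sees neither. By
    [missing_dom] the inner vertices then form a clique, so [w] is simplicial and would be adjacent
    to a simplicial vertex beyond [z']. *)
Lemma block_edges x y : x \in block -> y \in block -> x != y -> ~~ e x y ->
  ~~ e z z' && ([set x; y] == [set z; z']).
Proof.
move=> xB yB xy nxy; have [D cD Dk] := cd_set_add xy nxy.
have [ezz'|nzz'] := boolP (e z z'); last first.
  have /add_edgeP[h|[-> ->]|[-> ->]] := missing_join xB yB xy cD Dk.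
  - by rewrite e_sym h in nzz'.
  - by rewrite setUC eqxx.
  - by rewrite eqxx.
have [w wI /andP[nwz nwz']] := missing_undominated xB yB xy cD Dk ezz'.
have notz a : a \in inner -> (a != z) && (a != z').
  rewrite mem_inner => /and3P[-> _ aA]; rewrite andbT.
  by apply: contraTneq aA => ->; apply: away_self.
have inner_clique : {in inner &, forall a b, a != b -> e a b}.
  move=> a b aI bI ab; apply/negPn/negP => nab; have [D' cD' Dk'] := cd_set_add ab nab.
  have aB : a \in block by rewrite mem_block aI !orbT.
  have bB : b \in block by rewrite mem_block bI !orbT.
  have /andP[az az'] := notz a aI; have /andP[bz bz'] := notz b bI.
  have /orP[/add_edgeP[h|[_ h]|[_ h]]|/add_edgeP[h|[_ h]|[_ h]]] :=
    missing_dom aB bB ab cD' Dk' wI.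
  - by rewrite h in nwz.
  - by rewrite h eqxx in bz.
  - by rewrite h eqxx in az.
  - by rewrite h in nwz'.
  - by rewrite h eqxx in bz'.
  - by rewrite h eqxx in az'.
have sw : simplicial w.
  have inI a : e w a -> a \in inner.
    move=> wa; have := inner_closed wI wa; rewrite mem_block => /or3P[/eqP aE|/eqP aE|//].
      by rewrite -aE wa in nwz.
    by rewrite -aE wa in nwz'.
  by move=> a b wa wb; apply: inner_clique; apply: inI.
have [u uA su] := away_simplicial z'Z.
move: wI; rewrite mem_inner => /and3P[wz' wA' _].
have uw : u != w by apply: contraNneq wA' => <-.
have := simplicial_adj su sw uw => euw.
by rewrite (away_closed z'Z uA wA' euw) eqxx in wz'.
Qed.

Lemma block_path : exists t, [/\ path e z (rcons t z'), uniq t & t =i inner].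
Proof.
exists (enum inner); split; rewrite ?enum_uniq //; last by move=> w; rewrite mem_enum.
have iz w : w \in inner -> (w != z) && (w != z').
  rewrite mem_inner => /and3P[-> _ wA]; rewrite andbT.
  by apply: contraTneq wA => ->; apply: away_self.
have inB w : w \in inner -> w \in block by rewrite mem_block => ->; rewrite !orbT.
have adj w a : w \in inner -> a \in block -> a != w -> e a w.
  move=> wI aB aw; apply/negPn/negP => /(block_edges aB (inB w wI) aw)/andP[_ /eqP E].
  have := iz w wI; have : w \in [set z; z'] by rewrite -E !inE eqxx orbT.
  by rewrite !inE => /orP[]->; rewrite ?andbF.
have zB : z \in block by rewrite mem_block eqxx.
have z'B : z' \in block by rewrite mem_block eqxx orbT.
have sI : sorted e (enum inner).
  apply: sorted_clique; rewrite ?enum_uniq // => a b; rewrite !mem_enum => aI bI ab.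
  by apply: adj => //; apply: inB.
have mI w : w \in enum inner -> w \in inner by rewrite mem_enum.
case E: (enum inner) sI mI => [|w s] sI mI.
  (* With no inner vertices the edge between [z] and [z'] must exist: nothing else leads from [z']
     towards [q]. *)
  rewrite /= andbT; have [x xA] := away_neq0 z'Z.
  have qN : q \notin z' |: away z' by rewrite in_setU1 negb_or qz // q_away.
  have [u [v [_ uA _ vA uv]]] := connected_in_cross cg (in_setT z') (setU11 _ _) (in_setT q) qN.
  move: vA; rewrite in_setU1 negb_or => /andP[vz' vA'].
  move: uA; rewrite in_setU1 => /orP[/eqP uE|uA'].
    2: by rewrite (away_closed z'Z uA' vA' uv) eqxx in vz'.
  rewrite uE in uv; have [vA|vA] := boolP (v \in away z).
    have : v \in enum inner by rewrite mem_enum mem_inner vz' vA'.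
    by rewrite E.
  by rewrite e_sym -(away_closed zZ z'A vA uv).
rewrite /= rcons_path; apply/and3P; split.
- by have wI := mI w (mem_head _ _); apply: adj => //; rewrite eq_sym; have /andP[] := iz w wI.
- exact: sI.
- have lI := mI _ (mem_last w s); rewrite e_sym; apply: adj => //.
  by rewrite eq_sym; have /andP[] := iz _ lI.
Qed.

End Block.

Lemma away_path z : z \in Z ->
  exists p, [/\ path e z p, uniq (z :: p) & z :: p =i z |: away z].
Proof.
have [n] := ubnP #|away z|; elim: n z => // n IH z sz zZ.
have [dZ|] := boolP [disjoint away z & Z].
  have [x xA] := away_neq0 zZ; have xz : x != z by move: xA; rewrite mem_away => /andP[].
  have lA : leaf z (away z).
    rewrite (away_branch zZ xA) in dZ *; exact: branch_leaf.
  have : small z (away z).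
    by have := one_small lL lA (L_away zZ); rewrite (negbTE big).
  case/(small_leaf lA) => clA _; have [a aC za] := branch_nbr xz.
  rewrite -(away_branch zZ xA) in aC.
  exists (a :: enum (away z :\ a)); split.
  - rewrite /= za /=; apply: (@sorted_clique _ e (a :: enum _)).
      by rewrite /= enum_uniq mem_enum !inE eqxx.
    move=> b b'; rewrite !inE !mem_enum !in_setD1 => hb hb'.
    by apply: clA; [case/orP: hb => [/eqP->|/andP[]] | case/orP: hb' => [/eqP->|/andP[]]].
  - rewrite /= enum_uniq andbT inE !mem_enum !in_setD1 eqxx andbT /= (negbTE (away_self z)).
    by rewrite andbF orbF; apply: contraTneq aC => <-; apply: away_self.
  - move=> w; rewrite !in_cons mem_enum in_setD1 in_setU1; have [->|//] := eqVneq w a.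
    by rewrite aC orbT.
case/pred0Pn => z0 /= /andP[z0A z0Z].
(* The next cut vertex is the one with the largest far side, since one lying before it would have a
   larger far side. *)
have [z' /andP[z'A z'Z] z'max] := @arg_maxnP _ z0 [pred w | (w \in away z) && (w \in Z)]
  (fun w => #|away w|) (introT andP (conj z0A z0Z)).
have sub := away_nest zZ z'Z z'A.
have dI : [disjoint away z :\: (z' |: away z') & Z].
  apply/pred0P => w /=; apply/negP => /andP[+ wZ].
  rewrite in_setD in_setU1 negb_or => /andP[/andP[wz' wA'] wA].
  have /orP[//|z'w] := away_linear wZ z'Z wz'; first by rewrite (negbTE wA').
  have := z'max w; rewrite /= wA wZ => /(_ isT); rewrite leqNgt => /negP; apply.
  have := subset_leq_card (away_nest wZ z'Z z'w).
  by rewrite cardsU1 away_self.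
have [|p [pp up mp]] := IH z' _ z'Z.
  by have := subset_leq_card sub; rewrite cardsU1 away_self => /leq_trans; apply.
have [t [pt ut mt]] := block_path zZ z'Z z'A dI.
exists (rcons t z' ++ p); split.
- by rewrite cat_path pt last_rcons.
- rewrite cat_rcons cat_uniq ut up andbT andTb; apply/andP; split.
    rewrite mem_cat mt mp in_setD negb_or (negbTE (away_self z)) andbF /=.
    by apply/negP => /(subsetP sub); rewrite (negbTE (away_self z)).
  apply/hasPn => w; rewrite mp => wA.
  by rewrite mt in_setD wA.
- move=> w; rewrite cat_rcons in_cons mem_cat mt mp in_setU1 in_setD.
  congr (_ || _); have [wA|//] := boolP (w \in z' |: away z'); last by rewrite orbF.
  by rewrite (subsetP sub).
Qed.

(** * Traversing the big leaf *)

Definition inner_nbrs := [set x in L | e c x].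
Definition outer_part := L :\: inner_nbrs.

Local Notation N := inner_nbrs.
Local Notation R := outer_part.

Let cZ : c \in Z. Proof. exact: leaf_root lL. Qed.
Let mem_N w : (w \in N) = (w \in L) && e c w.
Proof. by rewrite /inner_nbrs in_set. Qed.
Let mem_R w : (w \in R) = (w \in L) && ~~ e c w.
Proof. by rewrite /outer_part in_setD mem_N; case: (w \in L); rewrite // andbT. Qed.
Let neq_c w : w \in L -> w != c.
Proof. by move=> wL; apply: contraNneq (leaf_rootN lL) => <-. Qed.

Lemma branch_L : branch c q = L.
Proof.
apply/eqP; rewrite eqEsubset L_branch // andbT; apply/subsetP => w wq; apply/negPn/negP => wL.
have [u [v [_ uL vB vL uv]]] := connected_in_cross (@branch_connected c q)
  (branch_refl (qz cZ)) qL wq wL.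
by have := branch_neq vB; rewrite (leaf_closed lL uL vL uv) eqxx.
Qed.

Let N_neq0 : exists n, n \in N.
Proof.
have [a aC ca] := branch_nbr (qz cZ); rewrite branch_L in aC.
by exists a; rewrite mem_N aC.
Qed.

Let R_neq0 : exists r, r \in R.
Proof.
have [/existsP[r rR]|no] := boolP [exists r, r \in R]; first by exists r.
have [n nN] := N_neq0; have /andP[nL cn] : (n \in L) && e c n by rewrite -mem_N.
case/negP: big; apply/existsP; exists [set n]; rewrite cards1 leqnn andbT.
apply/local_cdP; split; first by rewrite sub1set.
  by apply: (connectedU1 e_sym (connected_in1 e n) (set11 n)); rewrite e_sym.
move=> y yL _; exists c; rewrite ?setU11 // e_sym.
by apply: contraNT no => ncy; apply/existsP; exists y; rewrite mem_R yL.
Qed.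

Let NR_edge : exists n r, [/\ n \in N, r \in R & e n r].
Proof.
have [n nN] := N_neq0; have [r rR] := R_neq0.
have nL : n \in L by move: nN; rewrite mem_N => /andP[].
have rL : r \in L by move: rR; rewrite mem_R => /andP[].
have rN : r \notin N by move: rR; rewrite mem_N mem_R rL.
have [u [v [uL uN vL vN uv]]] := connected_in_cross (leaf_connected lL) nL nN rL rN.
by exists u, v; split=> //; rewrite mem_R vL; rewrite mem_N vL in vN.
Qed.

Let N_clique : {in N &, forall a b, a != b -> e a b}.
Proof.
by move=> a b; rewrite !mem_N => /andP[aL ca] /andP[bL cb]; apply: (leaf_clique lL).
Qed.

Let NUR : N :|: R = L.
Proof. by apply/setP => w; rewrite in_setU mem_N mem_R -andb_orr orbN andbT. Qed.

Let NR_disjoint : [disjoint N & R].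
Proof. by apply/pred0P => w /=; rewrite mem_N mem_R; case: (e c w); rewrite ?andbF. Qed.

(** [f] is characterised only by its edges, so that the results can be applied with [x] and [y]
    exchanged. *)
Section MissingOuterEdge.
Variables (f : rel T) (x y : T) (W : {set T}).
Hypothesis f_sym : symmetric f.
Hypothesis f_edge : forall a b, f a b -> [\/ e a b, a = x /\ b = y | a = y /\ b = x].
Hypothesis xR : x \in R.
Hypothesis yR : y \in R.
Hypothesis lW : local_cd f L c W.

Let f_e a b : b != x -> b != y -> f a b -> e a b.
Proof. by move=> bx by_ /f_edge[//|[_ E]|[_ E]]; rewrite E eqxx in bx by_ *. Qed.

Let cx : c != x. Proof. by rewrite eq_sym; apply: neq_c; move: xR; rewrite mem_R => /andP[]. Qed.
Let cy : c != y. Proof. by rewrite eq_sym; apply: neq_c; move: yR; rewrite mem_R => /andP[]. Qed.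
Let xL : x \in L. Proof. by move: xR; rewrite mem_R => /andP[]. Qed.
Let WL : W \subset L. Proof. by case/local_cdP: lW. Qed.
Let cW : c \notin W. Proof. exact: contraNN (subsetP WL c) (leaf_rootN lL). Qed.

Lemma missing_port : exists2 w, w \in W & [&& w \in N, w != x & w != y].
Proof.
case/local_cdP: lW => _ con dom.
have [W0|[d dW]] := set_0Vmem W.
  have [|w] := dom x xL; first by rewrite W0 inE.
  rewrite W0 setU0 => /set1P-> /(f_e cx cy); rewrite e_sym.
  by move: xR; rewrite mem_R => /andP[_ /negbTE->].
have dc : d \notin [set c] by rewrite in_set1; apply: contraNneq cW => <-.
have [|u [v [_ /set1P-> vW vc cv]]] := connected_in_cross con (setU11 c W) (set11 c) _ dc.
  exact: setU1r.
have {}vW : v \in W.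
  by move: vW vc; rewrite in_setU1 in_set1 => /orP[->|].
have ecv : e c v by rewrite e_sym; apply: f_e => //; rewrite f_sym.
have notR r : r \in R -> v != r.
  by apply: contraTneq => <-; rewrite mem_R ecv andbF.
by exists v; rewrite // mem_N (subsetP WL) // ecv !notR.
Qed.

Lemma missing_avoid : x \notin W -> y \notin W -> local_cd e L c W.
Proof.
move=> xW yW; case/local_cdP: lW => _ con dom.
have out w : w \in c |: W -> (w != x) && (w != y).
  rewrite in_setU1 => /orP[/eqP->|wW]; first by rewrite cx cy.
  by apply/andP; split; [apply: contraNneq xW => <- | apply: contraNneq yW => <-].
apply/local_cdP; split=> //.
  apply: connected_in_sub con => a b _ /out/andP[bx by_]; exact: f_e.
move=> v vL vW; have [w wW vw] := dom v vL vW; exists w => //.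
by have /andP[wx wy] := out w wW; apply: f_e.
Qed.

(** [W] consists of [x] and a neighbour [w] of [c]. The new edge can only serve to dominate [y] from
    [x], so [w] misses [y], and [w] and [x] dominate the rest of [R] in [G]. *)
Lemma missing_arc : #|W| <= 2 -> ~~ local_cd e L c W -> x \in W -> arc e N R x y.
Proof.
move=> W2 nl xW; have [w wW /and3P[wN wx wy]] := missing_port.
have WE : W = [set w; x].
  apply/eqP; rewrite eq_sym eqEcard subUset !sub1set wW xW.
  by rewrite cards2 wx.
case/local_cdP: (lW) => _ con dom.
have yL : y \in L by move: yR; rewrite mem_R => /andP[].
have ncR r : r \in R -> ~~ e r c by rewrite mem_R e_sym => /andP[].
have ewx : e w x.
  have xc : x \in c |: W by rewrite setU1r.
  have cx1 : c \notin [set x] by rewrite in_set1.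
  have [u [v [_ /set1P-> vW vx xv]]] := connected_in_cross con xc (set11 x) (setU11 c W) cx1.
  move: vW vx; rewrite WE !in_setU1 !in_set1 => /or3P[/eqP vE|/eqP vE|->] // _.
    by rewrite vE in xv; have := ncR x xR; rewrite (f_e cx cy xv).
  by rewrite vE in xv; rewrite e_sym; apply: f_e wx wy xv.
have close r : r \in L -> r != w -> r != x -> f r x -> e r x \/ r = y.
  by move=> _ _ rx /f_edge[|[rE _]|[rE _]]; [left | rewrite rE eqxx in rx | right].
have nwy : ~~ e w y.
  apply: contraNN nl => ewy; apply/local_cdP; split=> //.
    rewrite WE setUA; have -> : c |: [set w] :|: [set x] = x |: (c |: [set w]) by rewrite setUC.
    have cw : e c w by move: wN; rewrite mem_N => /andP[].
    apply: (connectedU1 e_sym _ _ ewx); last by rewrite !inE eqxx orbT.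
    by apply: (connectedU1 e_sym (connected_in1 e w) (set11 w)); rewrite e_sym.
  move=> r rL rW; have [v vW rv] := dom r rL rW.
  have wWc : w \in c |: W by rewrite setU1r.
  have [ry|ry] := eqVneq r y; first by exists w; rewrite // ry e_sym.
  exists v => //; case: (f_edge rv) => [//|[rE _]|[rE _]].
    by rewrite rE xW in rW.
  by rewrite rE eqxx in ry.
apply/existsP; exists w; apply/and4P; split=> //.
apply/forall_inP => r rR; apply/implyP => ry; apply/implyP => rx.
have rL : r \in L by move: rR; rewrite mem_R => /andP[].
have rw : r != w by apply: contraTneq rR => ->; rewrite mem_R; move: wN; rewrite mem_N => /andP[_ ->]; rewrite andbF.
have [|v vW rv] := dom r rL; first by rewrite WE !inE negb_or rw.
move: vW; rewrite WE !in_setU1 in_set1 => /or3P[/eqP vE|/eqP vE|/eqP vE]; rewrite vE in rv.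
- by have := ncR r rR; rewrite (f_e cx cy rv).
- by rewrite e_sym (f_e wx wy rv).
- have [h|h] := close r rL rw rx rv; first by rewrite [e x r]e_sym h orbT.
  by rewrite h eqxx in ry.
Qed.

End MissingOuterEdge.

(** There is a simplicial vertex on the far side of [c], and [y] cannot be adjacent to it. *)
Let no_simplicial_outer y : y \in R -> exists a b,
  [/\ a \in N :|: R, b \in N :|: R, e y a, e y b & (a != b) && ~~ e a b].
Proof.
move=> yR; have [yL ncy] : y \in L /\ ~~ e c y by apply/andP; rewrite -mem_R.
have [/existsP[a /existsP[b /and4P[ya yb ab nab]]]|no] :=
  boolP [exists a, exists b, [&& e y a, e y b, a != b & ~~ e a b]].
  have inL w : e y w -> w \in L.
    move=> yw; apply/negPn/negP => wL; have wc := leaf_closed lL yL wL yw.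
    by rewrite wc e_sym (negbTE ncy) in yw.
  by exists a, b; rewrite NUR !inL // ab.
have sy : simplicial y.
  move=> a b ya yb ab; apply: contraNT no => nab.
  by apply/existsP; exists a; apply/existsP; exists b; rewrite ya yb ab.
have [u uA su] := away_simplicial cZ.
have yA : y \notin away c by apply/negP => yA; have /pred0P/(_ y) := L_away cZ; rewrite /= yL yA.
have uy : u != y by apply: contraNneq yA => <-.
have := away_closed cZ uA yA (simplicial_adj su sy uy).
by move/eqP; rewrite (negbTE (neq_c yL)).
Qed.

Lemma leaf_shrink_outer W x y : local_cd e L c W -> x \in R -> y \in R -> x != y ->
  ~~ e x y -> exists2 W', local_cd (add_edge e x y) L c W' & #|W'| < #|W|.
Proof.
rewrite !mem_R => lW /andP[xL _] /andP[yL _].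
by apply: leaf_shrink lW _ _ => //; rewrite setU1r.
Qed.

Lemma big_leaf_traceable : traceable_from_N e N R.
Proof.
have [W [lW W3]] : exists W, local_cd e L c W /\ #|W| <= 3.
  have [D cD Dk] := gamma_c_min cg; have gk : gamma_c e = k by case: crit.
  exists (D :&: L); split; first exact: leaf_local_cd.
  rewrite -(leq_add2l #|Z|); apply: leq_trans (leaf_card lL (cut_sub_cd cD)) _.
  by rewrite Dk gk.
have [/existsP[V /andP[lV V2]]|no] :=
  boolP [exists V, local_cd e L c V && (#|V| <= 2)].
  have [n [r [nN rR nr]]] := NR_edge.
  (* With excess at most 2, a missing edge in [R] would leave a single vertex of [N]. It is neither
     [x] nor [y], so it would make [L] small in [G] itself. *)
  have R_clique : {in R &, forall x y, x != y -> e x y}.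
    move=> x y xR yR xy; apply/negPn/negP => nxy.
    have [V' lV' V'V] := leaf_shrink_outer lV xR yR xy nxy.
    have fs := add_edge_sym x y e_sym; have fe := @add_edgeP T e x y.
    have V'1 : #|V'| <= 1 by rewrite -ltnS; apply: leq_trans V'V V2.
    have [w wV' /and3P[_ wx wy]] := missing_port fs fe xR yR lV'.
    have V'E v : v \in V' -> v = w.
      by move=> vV'; apply/eqP; move/card_le1P: V'1 => /(_ w wV' v); rewrite inE vV'.
    case/negP: big; apply/existsP; exists V'; rewrite V'1 andbT.
    by apply: (missing_avoid fe xR yR lV'); apply/negP => /V'E E; rewrite E eqxx in wx wy.
  apply: (traceable_dec c) => nt.
  pose X := r :: enum (R :\ r).
  have mX w : (w \in X) = (w \in R).
    rewrite in_cons mem_enum in_setD1; have [->|//] := eqVneq w r; by rewrite rR.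
  have uX : uniq X by rewrite /= enum_uniq mem_enum in_setD1 eqxx.
  have sX : sorted e X by apply: sorted_clique uX _ => a b; rewrite !mX; apply: R_clique.
  have RX : {subset R <= X} by move=> w; rewrite mX.
  have XNR : {subset X <= N :|: R} by move=> w; rewrite mX in_setU => ->; rewrite orbT.
  have nX : n \notin X.
    by rewrite mX; apply/negP => nR; have /pred0P/(_ n) := NR_disjoint; rewrite /= nN nR.
  have /andP[/negP] := @end_not_adj _ e N R c e_sym N_clique nt X n sX uX RX XNR isT nN nX.
  by [].
have big3 (V : {set T}) : #|V| <= 2 -> ~~ local_cd e L c V.
  by move=> V2; apply: contraNN no => lV; apply/existsP; exists V; rewrite lV.
apply: linkage => //.
- move=> x y xR yR xy nxy; have [V lV VW] := leaf_shrink_outer lW xR yR xy nxy.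
  have fs := add_edge_sym x y e_sym; have fe := @add_edgeP T e x y.
  have V2 : #|V| <= 2 by rewrite -ltnS; apply: leq_trans VW W3.
  have [xV|xV] := boolP (x \in V).
    by rewrite (missing_arc fs fe xR yR lV V2 (big3 V V2) xV).
  have [yV|yV] := boolP (y \in V).
    rewrite orbC; rewrite (missing_arc (x := y) (y := x) fs _ yR xR lV V2 (big3 V V2) yV) //.
    by move=> a b /fe[]; [constructor 1 | constructor 3 | constructor 2].
  by have := big3 V V2; rewrite (missing_avoid fe xR yR lV xV yV).
(* If [w] and [w'] dominated [R], they would bring the excess down to 2. *)
- move=> w w' wN w'N; have [/exists_inP[r rR h]|none] :=
    boolP [exists r in R, ~~ e w r && ~~ e w' r]; first by exists r.
  have ww2 : #|[set w; w']| <= 2 by rewrite cards2; case: (w != w').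
  have /andP[wL cw] : (w \in L) && e c w by rewrite -mem_N.
  have /andP[w'L cw'] : (w' \in L) && e c w' by rewrite -mem_N.
  case/negP: (big3 _ ww2); apply/local_cdP; split.
  - by rewrite subUset !sub1set wL.
  - have -> : c |: [set w; w'] = w |: (w' |: [set c]).
      by rewrite setUC -setUA.
    apply: (connectedU1 e_sym _ _ cw); last by rewrite !inE eqxx orbT.
    exact: (connectedU1 e_sym (connected_in1 e c) (set11 c) cw').
  - move=> y yL _; have [cy|cy] := boolP (e c y).
      by exists c; rewrite ?setU11 // e_sym.
    have : e w y || e w' y.
      apply: contraNT none; rewrite negb_or => h; apply/exists_inP; exists y => //.
      by rewrite mem_R yL.
    by case/orP=> h; [exists w | exists w']; rewrite ?inE ?eqxx ?orbT // e_sym.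
Qed.

Lemma big_leaf_hamiltonian : has_hamiltonian_path e.
Proof.
have [n [p [nN pp up mp]]] := big_leaf_traceable.
have [s [ps us ms]] := away_path cZ.
have cn : e c n by move: nN; rewrite mem_N => /andP[].
have mX w : (w \in rev s ++ c :: n :: p) = true.
  rewrite mem_cat mem_rev in_cons mp NUR orbA [(w \in s) || _]orbC -in_cons ms in_setU1.
  rewrite mem_away branch_L; case: (w \in L); rewrite ?orbT // orbF andbT.
  by case: (w == c).
have uX : uniq (rev s ++ c :: n :: p).
  move: us; rewrite cons_uniq => /andP[cs us'].
  rewrite cat_uniq rev_uniq us' cons_uniq mp NUR up (leaf_rootN lL) !andbT andTb.
  apply/hasPn => w; rewrite in_cons mem_rev => /orP[/eqP->//|wp].
  have wL : w \in L by rewrite -NUR -mp.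
  apply/negP => ws; have : w \in c :: s by rewrite in_cons ws orbT.
  rewrite ms in_setU1 (negbTE (neq_c wL)) /= => wA.
  by have /pred0P/(_ w) := L_away cZ; rewrite /= wL wA.
have sX : sorted e (rev s ++ c :: n :: p).
  have pr : sorted e (rcons (rev s) c).
    by rewrite -rev_cons sorted_rev.
  by rewrite -cat_rcons (sorted_cat e c) ?pr ?last_rcons /= ?cn ?pp //; case: (rev s).
case E: (rev s ++ c :: n :: p) sX uX mX => [|h l] sX uX mX.
  by move: E; case: (rev s).
by exists h, l; split.
Qed.

End BigLeaf.

Theorem many_cuts_hamiltonian : has_hamiltonian_path e.
Proof.
have [c [L [lL big]]] := big_leaf_exists; have [q qL] := leaf_neq0 lL.
exact: big_leaf_hamiltonian lL big qL.
Qed.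

End Critical.

Unset Implicit Arguments.

Theorem theorem2p1 (k zeta : nat) (hk : 4 <= k) (hzeta : zeta <= k - 2) :
  (forall (T : finType) (e : rel T),
      simple_graph e -> gamma_c_critical k e -> #|cut_vertices e| = zeta ->
      has_hamiltonian_path e)
  <-> k - 3 <= zeta <= k - 2.
Proof.
split=> [ham|/andP[kz _] T e [e_sym e_irr] crit cz].
  rewrite hzeta andbT leqNgt; apply/negP => zk; have zk4 : zeta <= k - 4 by lia.
  have [T [e [sg cr cz nh]]] := nontraceable_critical hk zk4.
  exact: nh (ham T e sg cr cz).
apply: (many_cuts_hamiltonian e_sym e_irr crit); first by rewrite cz; lia.
(* A cut vertex exists because [zeta >= k - 3 >= 1]. *)
by rewrite -card_gt0 cz; lia.
Qed.
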